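(* Let $\mathcal M$ be a proper $LT$-space with locally compact model $\widetilde M=\mathcal M/\Omega T_0$. Then $$LT\ltimes_\tau C_0(\mathcal M)\cong\bigl((T\times\Pi_T)\ltimes_\tau C_0(\widetilde M)\bigr)\otimes\mathcal K(L^2(\Omega T_0)).$$ In particular $LT\ltimes_\tau C_0(\mathcal M)$ is Morita equivalent to $(T\times\Pi_T)\ltimes_\tau C_0(\widetilde M)$.
   Context: $T$ is a circle group, $\mathfrak t\cong\mathbb R$ its Lie algebra, $\Pi_T=\ker(\exp:\mathfrak t\to T)$, $\Lambda_T=\mathrm{Hom}(\Pi_T,\mathbb Z)$, identified with the character group of $T$. $LT=C^\infty(S^1,T)$; $\Omega T_0$ is the identity component of the based loop group $\Omega T$, identified with the additive group $U=\{f\in C^\infty(S^1,\mathfrak t):\int f\,d\theta=0\}$; $\Omega T=\Pi_T\times\Omega T_0$ and $LT=T\times\Pi_T\times\Omega T_0$. Fix a homomorphism $\kappa^\tau:\Pi_T\to\Lambda_T$ whose induced form $\langle v,w\rangle_\tau=\kappa^\tau(v)(w)$ on $\mathfrak t$ is positive definite; $\omega(f,g)=\int_{S^1}\langle f,dg/d\theta\rangle_\tau\,d\theta$; $\tau\bigl((t_1,n_1,l_1),(t_2,n_2,l_2)\bigr)=\kappa^\tau(n_1)(t_2)\,e^{i\omega(l_1,l_2)}$. A proper $LT$-space is an infinite dimensional Banach manifold $\mathcal M$ with an $LT$-action such that $\Omega T$ acts freely, $M=\mathcal M/\Omega T$ is compact with a $T$-equivariant $Spin^c$-structure, and the principal bundle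 $\Omega T_0\to\mathcal M\to\mathcal M/\Omega T_0=:\widetilde M$ is trivial. Identify $\mathfrak t=\mathbb R$ by a unit vector for $\langle,\rangle_\tau$; $U_N\subset U$ is the span of $\cos k\theta/\sqrt{k\pi},\ \sin k\theta/\sqrt{k\pi}$, $1\le k\le N$, with this basis declared orthonormal. For a 2-cocycle $\sigma$ on an amenable locally compact unimodular group $\Gamma$ acting on a $C^*$-algebra $B$, $\Gamma\ltimes_\sigma B$ is the $C^*$-completion (max = reduced) of $C_c(\Gamma,B)$ under $f_1*_\sigma f_2(\gamma)=\int f_1(\gamma')\,\gamma'.\bigl(f_2(\gamma'^{-1}\gamma)\bigr)\sigma(\gamma',\gamma'^{-1}\gamma)\,d\gamma'$. $LT\ltimes_\tau C_0(\mathcal M)$ is by definition the $C^*$-inductive limit over $N$ of $(T\times\Pi_T\times U_N)\ltimes_\tau C_0(\widetilde M\times U_N)$ (product action), which is identified with $\bigl((T\times\Pi_T)\ltimes_\tau C_0(\widetilde M)\bigr)\otimes\bigl(U_N\ltimes_\tau C_0(U_N)\bigr)$, where $U_N\ltimes_\tau C_0(U_N)\cong\mathcal K(L^2(U_N))$ via $(f.\phi)(x)=\int f(g,x)\phi(x-g)\tau(g,x)\,dg$; the connecting maps are $\mathrm{id}\otimes(k\mapsto k\otimes P)$, where $P$ is the rank one projection onto the normalized Gaussian $\Omega\propto e^{-|x|^2/2}$ on the orthogonal complement of $U_N$ in $U_{N+1}$ and $L^2(U_{N+1})\cong L^2(U_N)\otimes L^2(U_{N+1}\ominus U_N)$. $L^2(\Omega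 T_0)$ is the completed limit of $L^2(U_N)$ under $\phi\mapsto\phi\otimes\Omega$. $\mathcal K$ denotes compact operators. *)

(* Defs.v *)
From HB Require Import structures.
From mathcomp Require Import all_boot all_order all_algebra.
From mathcomp Require Import complex.
From mathcomp Require Import all_classical all_reals all_analysis.
Set Implicit Arguments.
Unset Strict Implicit.
Unset Printing Implicit Defensive.
Import Order.TTheory GRing.Theory Num.Theory.
Import numFieldNormedType.Exports.
Local Open Scope classical_set_scope.
Local Open Scope ring_scope.

(* R[i] carries its topology and norm under the name R[i]^o. *)

Section OperatorAlgebras.
Variable R : realType.
Local Notation C := R[i].

(* Norms of normed R[i]-modules take values in R[i] (in its nonnegative reals). *)
Definition nrm (V : normedModType C) (v : V) : R := complex.Re `|v|.

Definition finsums (V : normedModType C) (S : set V) : set V :=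
  [set x | exists n (s : 'I_n -> V), (forall i, S (s i)) /\ x = \sum_i s i].

Definition opbound (V W : normedModType C) (f : V -> W) (c : R) : Prop :=
  forall x, nrm (f x) <= c * nrm x.

Definition is_opnorm (V W : normedModType C) (f : V -> W) (c : R) : Prop :=
  [/\ 0 <= c, opbound f c & forall c', 0 <= c' -> opbound f c' -> c <= c'].

(* bilinear over C *)
Definition bilin (U V W : lmodType C) (t : U -> V -> W) : Prop :=
  (forall v, linear (t ^~ v)) /\ (forall u, linear (t u)).

(* Not necessarily unital, hence not built on a ring structure. *)
Record cstarAlg := CStarAlg {
  cs_sort :> completeNormedModType C;
  cs_mul : cs_sort -> cs_sort -> cs_sort;
  cs_star : cs_sort -> cs_sort;
  cs_mulA : associative cs_mul;
  cs_mul_bilin : bilin cs_mul;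
  cs_starP : forall (a : C) x y,
    cs_star (a *: x + y) = a^* *: cs_star x + cs_star y;
  cs_starM : forall x y, cs_star (cs_mul x y) = cs_mul (cs_star y) (cs_star x);
  cs_starK : involutive cs_star;
  cs_normM : forall x y, nrm (cs_mul x y) <= nrm x * nrm y;
  cs_normC : forall x, nrm (cs_mul (cs_star x) x) = nrm x ^+ 2 }.

(* The inner product is linear in the first variable. *)
Record hilbert := Hilbert {
  h_sort :> completeNormedModType C;
  ip : h_sort -> h_sort -> C;
  ipP : forall (a : C) u v w, ip (a *: u + v) w = a * ip u w + ip v w;
  ipC : forall u v, ip v u = (ip u v)^*;
  ip_norm : forall u, ip u u = `|u| ^+ 2 }.

(* Boundedness is automatic for *-homomorphisms of C*-algebras. *)
Record starHom (A B : cstarAlg) := StarHom {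
  sh_fun :> {linear A -> B};
  sh_mul : forall x y, sh_fun (cs_mul x y) = cs_mul (sh_fun x) (sh_fun y);
  sh_star : forall x, sh_fun (cs_star x) = cs_star (sh_fun x);
  sh_bounded : exists c, opbound sh_fun c }.

Definition star_isomorphic (A B : cstarAlg) : Prop :=
  exists (f : starHom A B) (g : starHom B A), cancel f g /\ cancel g f.

Definition is_star_rep (A : cstarAlg) (H : hilbert) (r : A -> H -> H) : Prop :=
  [/\ bilin r,
      exists c, forall x, opbound (r x) (c * nrm x),
      forall x y u, r (cs_mul x y) u = r x (r y u)
    & forall x u v, ip (r (cs_star x) u) v = ip u (r x v)].

Definition compact_op (H : hilbert) (f : H -> H) : Prop :=
  linear f /\ precompact (f @` [set u | nrm u <= 1]).

(* K, acting on H by r, is the algebra of compact operators of H *)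
Definition is_compact_algebra (H : hilbert) (K : cstarAlg) (r : K -> H -> H) :
    Prop :=
  [/\ is_star_rep r,
      forall k, is_opnorm (r k) (nrm k),
      forall k, compact_op (r k)
    & forall f, compact_op f -> exists k, r k = f].

Definition is_hilbert_tensor (H1 H2 H : hilbert) (t : H1 -> H2 -> H) : Prop :=
  [/\ bilin t,
      forall u v u' v', ip (t u v) (t u' v') = ip u u' * ip v v'
    & dense (finsums [set w | exists u v, w = t u v])].

(* The norms of (pi1 (x) pi2)(\sum_i a_i (x) b_i), over all pairs of
   *-representations pi1, pi2 on Hilbert spaces. *)
Definition tensor_rep_norms (A B : cstarAlg) n (a : 'I_n -> A) (b : 'I_n -> B) :
    set R :=
  [set c | exists (H1 : hilbert) (r1 : A -> H1 -> H1)
                  (H2 : hilbert) (r2 : B -> H2 -> H2)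
                  (H : hilbert) (t : H1 -> H2 -> H) (f : H -> H),
     [/\ is_star_rep r1, is_star_rep r2, is_hilbert_tensor t,
         linear f /\
         (forall u v, f (t u v) = \sum_i t (r1 (a i) u) (r2 (b i) v))
       & is_opnorm f c]].

(* D, with t a b = a (x) b, is the minimal (spatial) tensor product.  When A or
   B is nuclear, e.g. compact operators, it is the only C*-tensor product. *)
Definition is_cstar_tensor (A B D : cstarAlg) (t : A -> B -> D) : Prop :=
  [/\ bilin t,
      forall a a' b b', t (cs_mul a a') (cs_mul b b') = cs_mul (t a b) (t a' b'),
      forall a b, t (cs_star a) (cs_star b) = cs_star (t a b),
      dense (finsums [set d | exists a b, d = t a b])
    & forall n (a : 'I_n -> A) (b : 'I_n -> B),
        supremums (tensor_rep_norms a b) (nrm (\sum_i t (a i) (b i)))].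

Fixpoint iter_conn (B : nat -> cstarAlg)
    (c : forall N, starHom (B N) (B N.+1)) N m : B N -> B (m + N)%N :=
  match m with
  | 0%N => id
  | m'.+1 => fun x => c (m' + N)%N (iter_conn c m' x)
  end.

Definition is_inductive_limit (B : nat -> cstarAlg)
    (c : forall N, starHom (B N) (B N.+1))
    (L : cstarAlg) (eta : forall N, starHom (B N) L) : Prop :=
  [/\ forall N x, eta N.+1 (c N x) = eta N x,
      dense (\bigcup_N range (eta N))
    & forall N x, nrm (iter_conn c m x) @[m --> \oo] --> nrm (eta N x)].

(* Rieffel's A-B-imprimitivity bimodules *)
Record imprimitivity_bimodule (A B : cstarAlg) := ImprimitivityBimodule {
  ib_sort :> completeNormedModType C;
  ib_l : A -> ib_sort -> ib_sort;
  ib_r : ib_sort -> B -> ib_sort;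
  ib_lip : ib_sort -> ib_sort -> A;
  ib_rip : ib_sort -> ib_sort -> B;
  ib_l_bilin : bilin ib_l;
  ib_r_bilin : bilin ib_r;
  ib_lA : forall a a' x, ib_l (cs_mul a a') x = ib_l a (ib_l a' x);
  ib_rA : forall x b b', ib_r x (cs_mul b b') = ib_r (ib_r x b) b';
  ib_lr : forall a x b, ib_r (ib_l a x) b = ib_l a (ib_r x b);
  ib_lipP : forall y, linear (ib_lip ^~ y);
  ib_lipC : forall x y, cs_star (ib_lip x y) = ib_lip y x;
  ib_lipM : forall a x y, ib_lip (ib_l a x) y = cs_mul a (ib_lip x y);
  ib_lip_pos : forall x, exists a, ib_lip x x = cs_mul (cs_star a) a;
  ib_lip_norm : forall x, nrm (ib_lip x x) = nrm x ^+ 2;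
  ib_lip_full : dense (finsums [set a | exists x y, a = ib_lip x y]);
  ib_ripP : forall x, linear (ib_rip x);
  ib_ripC : forall x y, cs_star (ib_rip x y) = ib_rip y x;
  ib_ripM : forall x y b, ib_rip x (ib_r y b) = cs_mul (ib_rip x y) b;
  ib_rip_pos : forall x, exists b, ib_rip x x = cs_mul (cs_star b) b;
  ib_rip_norm : forall x, nrm (ib_rip x x) = nrm x ^+ 2;
  ib_rip_full : dense (finsums [set b | exists x y, b = ib_rip x y]);
  ib_rip_l : forall a x y, ib_rip (ib_l a x) y = ib_rip x (ib_l (cs_star a) y);
  ib_lip_r : forall x y b, ib_lip (ib_r x b) y = ib_lip x (ib_r y (cs_star b));
  ib_assoc : forall x y z, ib_l (ib_lip x y) z = ib_r x (ib_rip y z) }.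

Definition morita_equivalent (A B : cstarAlg) : Prop :=
  exists X : imprimitivity_bimodule A B, True.

(* The operations and the Haar integral of a locally compact group. *)
Record groupData := GroupData {
  gd_sort :> topologicalType;
  gd_mul : gd_sort -> gd_sort -> gd_sort;
  gd_inv : gd_sort -> gd_sort;
  gd_haar : (gd_sort -> R) -> R }.

Definition haarC (G : groupData) (f : G -> C) : C :=
  (gd_haar (fun g => complex.Re (f g)) +i*
   gd_haar (fun g => complex.Im (f g)))%C.

Definition C0 (X : topologicalType) (f : X -> C) : Prop :=
  continuous (f : X -> C^o) /\
  forall e : R, 0 < e ->
    exists2 K, compact K & forall x, ~ K x -> nrm (f x : C^o) < e.

(* C_c(G, C_0(X)); elements are written as functions of two variables. *)
Definition Cc (G X : topologicalType) (F : G -> X -> C) : Prop :=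
  [/\ forall g, C0 (F g),
      forall g0 (e : R), 0 < e -> \forall g \near g0,
        forall x, nrm (F g x - F g0 x : C^o) <= e
    & exists2 K, compact K & forall g, ~ K g -> forall x, F g x = 0].

Section CrossedProduct.
Variables (G : groupData) (X : topologicalType) (act : G -> X -> X).
Variable sigma : G -> G -> C.
Implicit Types F : G -> X -> C.

(* the action of G on C_0(X) is (g.f)(x) = f (g^-1.x) *)
Definition cp_mul F1 F2 : G -> X -> C := fun g x =>
  haarC (fun h => F1 h x *
                  F2 (gd_mul (gd_inv h) g) (act (gd_inv h) x) *
                  sigma h (gd_mul (gd_inv h) g)).

(* the involution of a twisted convolution algebra of a unimodular group *)
Definition cp_star F : G -> X -> C := fun g x =>
  (sigma g (gd_inv g))^* * (F (gd_inv g) (act (gd_inv g) x))^*.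

Definition cp_L1norm F : R :=
  gd_haar (fun g => sup [set nrm (F g x : C^o) | x in setT]).

Definition cp_is_rep (H : hilbert) (r : (G -> X -> C) -> H -> H) : Prop :=
  [/\ forall (a : C) F1 F2 u, Cc F1 -> Cc F2 ->
        r (fun g x => a * F1 g x + F2 g x) u = a *: r F1 u + r F2 u,
      forall F, Cc F -> linear (r F) /\ opbound (r F) (cp_L1norm F),
      forall F1 F2 u, Cc F1 -> Cc F2 -> r (cp_mul F1 F2) u = r F1 (r F2 u)
    & forall F u v, Cc F -> ip (r (cp_star F) u) v = ip u (r F v)].

(* A, with j : C_c(G, C_0(X)) -> A, is the completion of the convolution
   algebra in the maximal C*-norm. *)
Definition is_crossed_product (A : cstarAlg) (j : (G -> X -> C) -> A) : Prop :=
  [/\ forall (a : C) F1 F2, Cc F1 -> Cc F2 ->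
        j (fun g x => a * F1 g x + F2 g x) = a *: j F1 + j F2,
      forall F1 F2, Cc F1 -> Cc F2 -> j (cp_mul F1 F2) = cs_mul (j F1) (j F2),
      forall F, Cc F -> j (cp_star F) = cs_star (j F),
      dense (j @` [set F | Cc F])
    & forall F, Cc F ->
        supremums [set c | exists (H : hilbert) (r : (G -> X -> C) -> H -> H),
                             cp_is_rep r /\ is_opnorm (r F) c] (nrm (j F))].

End CrossedProduct.
End OperatorAlgebras.

Section Circle.
Variable R : realType.
Local Notation C := R[i].

Definition expi (x : R) : C := (cos x +i* sin x)%C.

(* T is the unit circle, t = R with exp x = e^{2 i pi x}, so Pi_T = int. *)
Definition circle := set_type [set z : C^o | z * z^* = 1].

Lemma circle_mul_subproof (z w : circle) :
  (set_val z * set_val w : C) \in [set z : C^o | z * z^* = 1].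
Proof.
rewrite inE /= rmorphM /=.
have /set_mem /= hz := valP z; have /set_mem /= hw := valP w.
by rewrite mulrACA hz hw mulr1.
Qed.

Definition circle_mul (z w : circle) : circle :=
  exist _ (set_val z * set_val w : C) (circle_mul_subproof z w).

Lemma circle_inv_subproof (z : circle) :
  ((set_val z)^* : C) \in [set z : C^o | z * z^* = 1].
Proof.
rewrite inE /=; have /set_mem /= := valP z.
by rewrite conjCK mulrC.
Qed.

Definition circle_inv (z : circle) : circle :=
  exist _ ((set_val z)^* : C) (circle_inv_subproof z).

Lemma circle_exp_subproof (x : R) :
  expi (2 * pi * x) \in [set z : C^o | z * z^* = 1].
Proof.
rewrite inE /=; apply/eqP; rewrite eq_complex /= mulrN opprK -!expr2.
by rewrite cos2Dsin2 eqxx mulrN mulrC addNr /= eqxx.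
Qed.

Definition circle_exp (x : R) : circle :=
  exist _ (expi (2 * pi * x)) (circle_exp_subproof x).

Definition circle_one : circle := circle_exp 0.

End Circle.

Section Manifolds.
Variable R : realType.
Local Notation C := R[i].

(* C^k maps on an open set U, by iterated directional derivatives.  For maps
   between Banach spaces, being C^k in this sense for all k is the same as being
   Frechet-smooth. *)
Fixpoint Ck (k : nat) (E F : normedModType R) (U : set E) (f : E -> F) : Prop :=
  match k with
  | 0%N => forall x, U x -> {for x, continuous f}
  | k'.+1 =>
      [/\ forall x, U x -> {for x, continuous f},
          forall x v, U x -> derivable f x v
        & @Ck k' (E * E)%type F (U `*` setT) (fun p => 'D_(p.2) f p.1)]
  end.

Definition smooth_on (E F : normedModType R) (U : set E) (f : E -> F) : Prop :=
  forall k, Ck k U f.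

Definition smooth_onC (E : normedModType R) (U : set E) (f : E -> C) : Prop :=
  smooth_on U (fun x => complex.Re (f x) : R^o) /\
  smooth_on U (fun x => complex.Im (f x) : R^o).

Record manifold (E : normedModType R) := Manifold {
  mf_sort :> topologicalType;
  mf_index : Type;
  mf_dom : mf_index -> set mf_sort;
  mf_chart : mf_index -> mf_sort -> E;
  mf_inv : mf_index -> E -> mf_sort;
  mf_hausdorff : hausdorff_space mf_sort;
  mf_cover : forall p, exists i, mf_dom i p;
  mf_dom_open : forall i, open (mf_dom i);
  mf_im_open : forall i, open (mf_chart i @` mf_dom i);
  mf_chartK : forall i p, mf_dom i p -> mf_inv i (mf_chart i p) = p;
  mf_chart_cont : forall i p, mf_dom i p -> {for p, continuous (mf_chart i)};
  mf_inv_cont : forall i p, mf_dom i p ->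
    {for mf_chart i p, continuous (mf_inv i)};
  mf_smooth : forall i j,
    smooth_on (mf_chart i @` (mf_dom i `&` mf_dom j))
              (mf_chart j \o mf_inv i) }.

Definition smooth_map (E F : normedModType R) (M : manifold E) (N : manifold F)
    (f : M -> N) : Prop :=
  continuous f /\
  forall i j, smooth_on (mf_chart i @` (mf_dom i `&` f @^-1` mf_dom j))
                        (mf_chart j \o f \o @mf_inv _ M i).

(* The kernel of the differential is complemented since N is finite
   dimensional. *)
Definition submersion (E : normedModType R) n (M : manifold E)
    (N : manifold 'rV[R]_n) (f : M -> N) : Prop :=
  smooth_map f /\
  forall i j p, mf_dom i p -> mf_dom j (f p) ->
    forall w, exists v,
      'D_v (mf_chart j \o f \o @mf_inv _ M i) (mf_chart i p) = w.

Section CircleManifold.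
Variables (n : nat) (M : manifold 'rV[R]_n) (act : circle R -> M -> M).

Definition smooth_circle_action : Prop :=
  [/\ forall p, act (circle_one R) p = p,
      forall s t p, act (circle_mul s t) p = act s (act t p),
      continuous (fun z : circle R * M => act z.1 z.2)
    & forall i j,
        @smooth_on (R^o * 'rV[R]_n)%type 'rV[R]_n
          [set z | exists p, [/\ mf_dom i p, z.2 = mf_chart i p &
                                 mf_dom j (act (circle_exp z.1) p)]]
          (fun z => mf_chart j (act (circle_exp z.1) (mf_inv i z.2)))].

(* Jacobian matrices act on the right of row vectors: a tangent vector at p with
   coordinates v in chart i has coordinates v *m trans_jac i j p in chart j. *)
Definition trans_jac (i j : mf_index M) (p : M) : 'M[R]_n :=
  'J (mf_chart j \o @mf_inv _ M i) (mf_chart i p).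

Definition act_jac (t : circle R) (i j : mf_index M) (p : M) : 'M[R]_n :=
  'J (mf_chart j \o act t \o @mf_inv _ M i) (mf_chart i p).

(* A T-equivariant Spin^c structure: a T-invariant Riemannian metric and
   orientation, and a T-equivariant Hermitian bundle of irreducible complex
   Clifford modules (the spinor bundle).  Tangent vectors are given by their
   coordinates in a chart i, spinors by their coordinates (column vectors) in a
   local trivialization j. *)
Record spinc_structure := SpincStructure {
  sc_metric : mf_index M -> M -> 'M[R]_n;
  sc_metric_sym : forall i p, mf_dom i p -> (sc_metric i p)^T = sc_metric i p;
  sc_metric_pos : forall i p (v : 'rV[R]_n), mf_dom i p -> v != 0 ->
    0 < (v *m sc_metric i p *m v^T) 0 0;
  sc_metric_trans : forall i j p, mf_dom i p -> mf_dom j p ->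
    sc_metric i p = trans_jac i j p *m sc_metric j p *m (trans_jac i j p)^T;
  sc_metric_smooth : forall i a b,
    smooth_on (mf_chart i @` mf_dom i)
              (fun x => sc_metric i (mf_inv i x) a b : R^o);
  sc_metric_inv : forall t i j p, mf_dom i p -> mf_dom j (act t p) ->
    sc_metric i p = act_jac t i j p *m sc_metric j (act t p)
                      *m (act_jac t i j p)^T;
  (* 1 or -1, according to whether chart i preserves orientation at p *)
  sc_or : mf_index M -> M -> R;
  sc_or_sign : forall i p, mf_dom i p -> sc_or i p = 1 \/ sc_or i p = -1;
  sc_or_cont : forall i p, mf_dom i p ->
    \forall q \near p, sc_or i q = sc_or i p;
  sc_or_trans : forall i j p, mf_dom i p -> mf_dom j p ->
    sc_or j p = Num.sg (\det (trans_jac i j p)) * sc_or i p;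
  sc_or_inv : forall t i j p, mf_dom i p -> mf_dom j (act t p) ->
    sc_or j (act t p) = Num.sg (\det (act_jac t i j p)) * sc_or i p;
  sc_index : Type;
  sc_dom : sc_index -> set M;
  sc_dom_open : forall j, open (sc_dom j);
  sc_dom_cover : forall p, exists j, sc_dom j p;
  (* change of trivialization, from j to k *)
  sc_trans : sc_index -> sc_index -> M -> 'M[C]_(2 ^ n./2);
  sc_trans_unitary : forall j k p, sc_dom j p -> sc_dom k p ->
    sc_trans j k p \is unitarymx;
  sc_trans1 : forall j p, sc_dom j p -> sc_trans j j p = 1%:M;
  sc_transM : forall j k l p, sc_dom j p -> sc_dom k p -> sc_dom l p ->
    sc_trans j l p = sc_trans k l p *m sc_trans j k p;
  sc_trans_smooth : forall i j k a b,
    smooth_onC (mf_chart i @` (mf_dom i `&` (sc_dom j `&` sc_dom k)))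
               (fun x => sc_trans j k (mf_inv i x) a b);
  (* Clifford multiplication *)
  sc_cliff : mf_index M -> sc_index -> M -> 'rV[R]_n -> 'M[C]_(2 ^ n./2);
  sc_cliff_linear : forall i j p (s : R) v w, mf_dom i p -> sc_dom j p ->
    sc_cliff i j p (s *: v + w) =
      (s%:C)%C *: sc_cliff i j p v + sc_cliff i j p w;
  sc_cliff_sqr : forall i j p v, mf_dom i p -> sc_dom j p ->
    sc_cliff i j p v *m sc_cliff i j p v =
      - ((((v *m sc_metric i p *m v^T) 0 0)%:C)%C)%:M;
  sc_cliff_skew : forall i j p v, mf_dom i p -> sc_dom j p ->
    map_mx Num.conj (sc_cliff i j p v)^T = - sc_cliff i j p v;
  sc_cliff_trans : forall i i' j k p v,
    mf_dom i p -> mf_dom i' p -> sc_dom j p -> sc_dom k p ->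
    sc_cliff i' k p (v *m trans_jac i i' p) *m sc_trans j k p =
      sc_trans j k p *m sc_cliff i j p v;
  sc_cliff_smooth : forall i j v a b,
    smooth_onC (mf_chart i @` (mf_dom i `&` sc_dom j))
               (fun x => sc_cliff i j (mf_inv i x) v a b);
  (* For odd n the two irreducible modules of the Clifford algebra are told apart
     by the action of the complex volume element. *)
  sc_cliff_vol : forall i j p (w : 'M[R]_n), odd n ->
    mf_dom i p -> sc_dom j p ->
    w *m sc_metric i p *m w^T = 1%:M -> 0 < \det w * sc_or i p ->
    'i ^+ uphalf n *:
      \big[mulmx/1%:M]_(a < n) sc_cliff i j p (row a w) = 1%:M;
  (* the action of t from the fibre over p, trivialized by j, to the fibre over
     t.p, trivialized by k *)
  sc_lift : sc_index -> sc_index -> circle R -> M -> 'M[C]_(2 ^ n./2);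
  sc_lift_unitary : forall j k t p, sc_dom j p -> sc_dom k (act t p) ->
    sc_lift j k t p \is unitarymx;
  sc_lift1 : forall j k p, sc_dom j p -> sc_dom k p ->
    sc_lift j k (circle_one R) p = sc_trans j k p;
  sc_liftM : forall j k l s t p,
    sc_dom j p -> sc_dom k (act t p) -> sc_dom l (act s (act t p)) ->
    sc_lift j l (circle_mul s t) p = sc_lift k l s (act t p) *m sc_lift j k t p;
  sc_lift_cliff : forall i i' j k t p v,
    mf_dom i p -> sc_dom j p -> mf_dom i' (act t p) -> sc_dom k (act t p) ->
    sc_cliff i' k (act t p) (v *m act_jac t i i' p) *m sc_lift j k t p =
      sc_lift j k t p *m sc_cliff i j p v;
  sc_lift_smooth : forall i j k a b,
    @smooth_onC (R^o * 'rV[R]_n)%type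
      [set z | exists p, [/\ mf_dom i p, sc_dom j p, z.2 = mf_chart i p &
                             sc_dom k (act (circle_exp z.1) p)]]
      (fun z => sc_lift j k (circle_exp z.1) (mf_inv i z.2) a b) }.

End CircleManifold.
End Manifolds.

Section LoopGroup.
Variable R : realType.
Local Notation C := R[i].

Definition smooth1 (f : R -> R) : Prop :=
  forall k x, derivable (derive1n k f : R -> R^o) x 1.

(* Loops are 2 pi-periodic functions of the angle. *)
Definition is_loop (g : R -> C) : Prop :=
  [/\ forall x, g (x + 2 * pi) = g x,
      forall x, g x * (g x)^* = 1,
      smooth1 (fun x => complex.Re (g x))
    & smooth1 (fun x => complex.Im (g x))].

Definition based (g : R -> C) : Prop := g 0 = 1.

(* |g - h| < e in C^k, i.e. a basic entourage of the C^oo topology *)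
Definition loop_close (k : nat) (e : R) (g h : R -> C) : Prop :=
  forall m x, (m <= k)%N ->
    `|derive1n m (fun y => complex.Re (g y)) x
      - derive1n m (fun y => complex.Re (h y)) x| < e /\
    `|derive1n m (fun y => complex.Im (g y)) x
      - derive1n m (fun y => complex.Im (h y)) x| < e.

Definition loop_mul (g h : R -> C) : R -> C := fun x => g x * h x.
Definition cst_loop (t : circle R) : R -> C := fun=> set_val t.
Definition winding_loop (m : int) : R -> C := fun x => expi (m%:~R * x).

(* the Lie algebra valued loops of integral 0 *)
Definition in_U (f : R -> R) : Prop :=
  [/\ forall x, f (x + 2 * pi) = f x, smooth1 f
    & (\int[lebesgue_measure]_(x in `[0%R, 2 * pi]) f x)%R = 0].

(* The based loop with logarithmic derivative 2 i pi f'; this identifies U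
   with the identity component of the based loop group. *)
Definition U_loop (f : R -> R) : R -> C :=
  fun x => set_val (circle_exp (f x - f 0)).

Definition in_OmegaT (g : R -> C) : Prop := is_loop g /\ based g.
Definition in_OmegaT0 (g : R -> C) : Prop := exists2 f, in_U f & g = U_loop f.

(* q exhibits Q as the quotient, with the quotient topology, of X by the action
   of the loops in S. *)
Definition is_orbit_space (X Q : topologicalType) (act : (R -> C) -> X -> X)
    (S : set (R -> C)) (q : X -> Q) : Prop :=
  [/\ forall y, exists x, q x = y,
      forall x x', q x = q x' <-> exists2 g, S g & x' = act g x
    & forall O : set Q, open O <-> open (q @^-1` O)].

Definition infinite_dimensional (E : lmodType R) : Prop :=
  forall n (e : 'I_n -> E), exists x, forall a : 'I_n -> R,
    x <> \sum_i a i *: e i.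

(* Pi_T as a discrete group, and T x Pi_T *)
Definition PiT : Type := discrete_topology int.
Definition TPi : Type := (circle R * PiT)%type.

Record properLTspace := ProperLTspace {
  pl_E : completeNormedModType R;
  pl_E_infdim : infinite_dimensional pl_E;
  pl_M : manifold pl_E;
  (* the action of LT; only its values on loops matter *)
  pl_act : (R -> C) -> pl_M -> pl_M;
  pl_act1 : forall x, pl_act (fun=> 1) x = x;
  pl_actM : forall g h x, is_loop g -> is_loop h ->
    pl_act (loop_mul g h) x = pl_act g (pl_act h x);
  (* joint continuity, for the C^oo topology on LT *)
  pl_act_cont : forall g x, is_loop g -> forall V, nbhs (pl_act g x) V ->
    exists k (e : R), 0 < e /\
      \forall y \near x, forall h, is_loop h -> loop_close k e h g ->
        V (pl_act h y);
  pl_free : forall g x, in_OmegaT g -> pl_act g x = x -> g = (fun=> 1);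
  (* the compact quotient M by the based loop group *)
  pl_dim : nat;
  pl_quot : manifold 'rV[R]_pl_dim;
  pl_q : pl_M -> pl_quot;
  pl_q_orbit : is_orbit_space pl_act in_OmegaT pl_q;
  pl_q_submersion : submersion pl_q;
  pl_quot_compact : compact [set: pl_quot];
  pl_quot_act : circle R -> pl_quot -> pl_quot;
  pl_quot_actE : forall t x, pl_quot_act t (pl_q x) = pl_q (pl_act (cst_loop t) x);
  pl_quot_act_smooth : smooth_circle_action pl_quot_act;
  pl_spinc : spinc_structure pl_quot_act;
  (* the quotient by the identity component of the based loop group, with the
     induced action of T x Pi_T *)
  pl_tilde : topologicalType;
  pl_p : pl_M -> pl_tilde;
  pl_p_orbit : is_orbit_space pl_act in_OmegaT0 pl_p;
  pl_tilde_act : TPi -> pl_tilde -> pl_tilde;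
  pl_tilde_actE : forall z x, pl_tilde_act z (pl_p x) =
    pl_p (pl_act (loop_mul (cst_loop z.1) (winding_loop z.2)) x);
  (* triviality of the principal bundle pl_p: a global section and the
     continuous U-valued coordinate it defines *)
  pl_section : pl_tilde -> pl_M;
  pl_section_cont : continuous pl_section;
  pl_sectionK : forall y, pl_p (pl_section y) = y;
  pl_coord : pl_M -> R -> R;
  pl_coordU : forall x, in_U (pl_coord x);
  pl_coordE : forall x, pl_act (U_loop (pl_coord x)) (pl_section (pl_p x)) = x;
  pl_coord_cont : forall x k (e : R), 0 < e -> \forall y \near x,
    forall m s, (m <= k)%N ->
      `|derive1n m (pl_coord y) s - derive1n m (pl_coord x) s| < e }.

End LoopGroup.

Section TwistedLoopGroup.
Variable R : realType.
Local Notation C := R[i].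
(* kappa n m = kappa^tau(n)(m) *)
Variable kappa : int -> int -> int.

(* the R-bilinear extension of kappa to the Lie algebra *)
Definition tau_form (v w : R) : R := (kappa 1 1)%:~R * v * w.

Definition omega (f g : R -> R) : R :=
  (\int[lebesgue_measure]_(x in `[0%R, 2 * pi]) tau_form (f x) (derive1 g x))%R.

(* lambda in Hom(Pi_T, Z) is the character exp x |-> e^{2 i pi lambda(x)} *)
Definition character (lambda : int -> int) (t : circle R) : C :=
  set_val t ^ lambda 1.

(* the cocycle of T x Pi_T, i.e. the restriction of tau *)
Definition tauTPi (z1 z2 : TPi R) : C := character (kappa z1.2) z2.1.

Definition groupTPi : groupData R :=
  @GroupData R (TPi R)
    (fun z1 z2 => (circle_mul z1.1 z2.1, (z1.2 : int) + z2.2))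
    (fun z => (circle_inv z.1, - (z.2 : int)))
    (fun f => \sum_(m \in [set: int])
       (\int[lebesgue_measure]_(x in `[0%R, 1]) f (circle_exp x, m))%R).

(* Row k of x : 'M_(N, 2) holds the coordinates of an element of U_N along
   cos ((k+1) theta) / sqrt ((k+1) pi) and sin ((k+1) theta) / sqrt ((k+1) pi),
   times the unit vector of the Lie algebra. *)
Definition unit_vec : R := (Num.sqrt (tau_form 1 1))^-1.

Definition U_fun N (x : 'M[R]_(N, 2)) : R -> R := fun theta =>
  \sum_(k < N)
    (x k 0 * cos (k.+1%:R * theta) + x k 1 * sin (k.+1%:R * theta))
      / Num.sqrt (k.+1%:R * pi) * unit_vec.

Definition tauU N (x y : 'M[R]_(N, 2)) : C := expi (omega (U_fun x) (U_fun y)).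

Definition U_extend N (x : 'M[R]_(N, 2)) (a b : R) : 'M[R]_(N.+1, 2) :=
  \matrix_(k, j) if unlift ord_max k is Some l then x l j
                 else if j == 0 then a else b.

(* the Lebesgue integral in orthonormal coordinates, as an iterated integral *)
Fixpoint intU N : ('M[R]_(N, 2) -> R) -> R :=
  match N with
  | 0%N => fun f => f 0
  | N'.+1 => fun f =>
      (\int[lebesgue_measure]_a \int[lebesgue_measure]_b
         intU (fun x : 'M[R]_(N', 2) => f (U_extend x a b)))%R
  end.

Definition groupU N : groupData R :=
  @GroupData R 'M[R]_(N, 2) (fun x y => x + y) (fun x => - x) (@intU N).

Definition groupTPiU N : groupData R :=
  @GroupData R (TPi R * 'M[R]_(N, 2))%type
    (fun g h => (@gd_mul _ groupTPi g.1 h.1, g.2 + h.2))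
    (fun g => (@gd_inv _ groupTPi g.1, - g.2))
    (fun f => @gd_haar _ groupTPi (fun z => intU (fun u => f (z, u)))).

(* the restriction of tau to T x Pi_T x U_N *)
Definition tauN N (g h : TPi R * 'M[R]_(N, 2)) : C :=
  tauTPi g.1 h.1 * tauU g.2 h.2.

(* L^2(U_N) is modelled as the completion of this space of functions for the
   L^2 inner product; it contains C_c(U_N) and the Gaussian functions. *)
Definition rapid N (f : 'M[R]_(N, 2) -> C) : Prop :=
  continuous (f : 'M[R]_(N, 2) -> C^o) /\
  forall k, exists c, forall x, (1 + `|x|) ^+ k * nrm (f x : C^o) <= c.

Definition is_L2 N (H : hilbert R) (cls : ('M[R]_(N, 2) -> C) -> H) : Prop :=
  [/\ forall (a : C) f g, rapid f -> rapid g ->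
        cls (fun x => a * f x + g x) = a *: cls f + cls g,
      forall f g, rapid f -> rapid g ->
        ip (cls f) (cls g) = haarC (G := groupU N) (fun x => f x * (g x)^*)
    & dense (cls @` [set f | rapid f])].

(* L^2(Omega T_0) as the completed limit of the L^2(U_N) *)
Record L2tower := L2Tower {
  l2_H : nat -> hilbert R;
  l2_cls : forall N, ('M[R]_(N, 2) -> C) -> l2_H N;
  l2_L2 : forall N, is_L2 (@l2_cls N);
  (* L^2 of the orthogonal complement of U_N in U_{N+1} *)
  l2_E : hilbert R;
  l2_clsE : ('M[R]_(1, 2) -> C) -> l2_E;
  l2_L2E : is_L2 l2_clsE;
  l2_ten : forall N, l2_H N -> l2_E -> l2_H N.+1;
  l2_ten_tensor : forall N, is_hilbert_tensor (@l2_ten N);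
  l2_tenE : forall N (f : 'M[R]_(N, 2) -> C) (g : 'M[R]_(1, 2) -> C),
    rapid f -> rapid g ->
    l2_ten (l2_cls f) (l2_clsE g) =
      l2_cls (fun x : 'M[R]_(N.+1, 2) =>
                f (row' ord_max x) * g (row ord_max x));
  l2_gauss : l2_E;
  l2_gaussE : exists2 a : R, 0 < a &
    l2_gauss = (a%:C)%C *:
      l2_clsE (fun y => ((expR (- (y 0 0 ^+ 2 + y 0 1 ^+ 2) / 2))%:C)%C);
  l2_gauss_norm : `|l2_gauss| = 1;
  l2_lim : hilbert R;
  l2_inc : forall N, {linear l2_H N -> l2_lim};
  l2_inc_ip : forall N u v, ip (l2_inc N u) (l2_inc N v) = ip u v;
  l2_inc_gauss : forall N u, l2_inc N.+1 (l2_ten u l2_gauss) = l2_inc N u;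
  l2_inc_dense : dense (\bigcup_N range (l2_inc N)) }.

Section LTCrossedProduct.
Variables (X : topologicalType) (act : TPi R -> X -> X).

(* the product action *)
Definition actN N (g : TPi R * 'M[R]_(N, 2)) (y : X * 'M[R]_(N, 2)) :
    X * 'M[R]_(N, 2) := (act g.1 y.1, y.2 + g.2).

Definition is_TPi_crossed_product (A : cstarAlg R)
    (j : (TPi R -> X -> C) -> A) : Prop :=
  is_crossed_product (G := groupTPi) act tauTPi j.

Definition is_TPiU_crossed_product N (B : cstarAlg R)
    (j : (TPi R * 'M[R]_(N, 2) -> X * 'M[R]_(N, 2) -> C) -> B) : Prop :=
  is_crossed_product (G := groupTPiU N) (@actN N) (@tauN N) j.

(* the action of U_N |x C_0(U_N) on L^2(U_N) *)
Definition U_act N (f : 'M[R]_(N, 2) -> 'M[R]_(N, 2) -> C)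
    (phi : 'M[R]_(N, 2) -> C) : 'M[R]_(N, 2) -> C := fun x =>
  haarC (G := groupU N) (fun g => f g x * phi (x - g) * tauU g x).

Variables (A : cstarAlg R) (jA : (TPi R -> X -> C) -> A) (W : L2tower).

(* LT |x C_0(M), for a proper LT-space M with quotient X = M / Omega T_0, where
   A = (T x Pi_T) |x C_0(X). *)
Record LTcrossedProduct := LTCrossedProduct {
  lx_K : nat -> cstarAlg R;
  lx_rep : forall N, lx_K N -> l2_H W N -> l2_H W N;
  lx_rep_compact : forall N, is_compact_algebra (@lx_rep N);
  lx_AK : nat -> cstarAlg R;
  lx_ten : forall N, A -> lx_K N -> lx_AK N;
  lx_ten_tensor : forall N, is_cstar_tensor (@lx_ten N);
  lx_B : nat -> cstarAlg R;
  lx_j : forall N, (TPi R * 'M[R]_(N, 2) -> X * 'M[R]_(N, 2) -> C) -> lx_B N;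
  lx_j_crossed : forall N, is_TPiU_crossed_product (@lx_j N);
  (* the identification of lx_B N with A (x) K(L^2(U_N)) *)
  lx_Phi : forall N, starHom (lx_B N) (lx_AK N);
  lx_Psi : forall N, starHom (lx_AK N) (lx_B N);
  lx_PhiK : forall N, cancel (lx_Phi N) (lx_Psi N);
  lx_PsiK : forall N, cancel (lx_Psi N) (lx_Phi N);
  lx_PhiE : forall N (f1 : TPi R -> X -> C)
      (f2 : 'M[R]_(N, 2) -> 'M[R]_(N, 2) -> C),
    Cc f1 -> Cc f2 ->
    exists2 k : lx_K N,
      forall phi, rapid phi -> lx_rep k (l2_cls W phi) = l2_cls W (U_act f2 phi)
      & lx_Phi N (lx_j (fun g y => f1 g.1 y.1 * f2 g.2 y.2)) =
          lx_ten (jA f1) k;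
  (* k |-> k (x) P, with P the projection onto the Gaussian *)
  lx_tenP : forall N, lx_K N -> lx_K N.+1;
  lx_tenPE : forall N k u v,
    lx_rep (lx_tenP k) (l2_ten u v) =
      l2_ten (lx_rep (N := N) k u) (ip v (l2_gauss W) *: l2_gauss W);
  lx_conn : forall N, starHom (lx_B N) (lx_B N.+1);
  lx_connE : forall N b a k, lx_Phi N b = lx_ten a k ->
    lx_Phi N.+1 (lx_conn N b) = lx_ten a (lx_tenP k);
  lx_alg :> cstarAlg R;
  lx_eta : forall N, starHom (lx_B N) lx_alg;
  lx_lim : is_inductive_limit lx_conn lx_eta }.

End LTCrossedProduct.
End TwistedLoopGroup.

(* Main.v *)
(** The Gaussians are the vectors along which the spaces L^2(U_N) are embedded in
    one another, so k |-> k (x) P is the inclusion of a corner of K(L^2(Omega T_0))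
    in the next one.  The minimal tensor norm of \sum_i a_i (x) k_i is a supremum of
    norms of finite operator matrices, which do not see in which corner the k_i lie.
    Hence the algebras A (x) K(L^2(U_N)) embed isometrically and compatibly in
    A (x) K(L^2(Omega T_0)); their union is dense there, because the finite rank
    operators are dense in the compact ones.

    For the Morita equivalence, take the bimodule X = D (1 (x) p) with p a rank one
    projection, so that X^* X = A (x) p and X X^* spans D.  Fullness needs an
    approximate unit of A, and positivity of the inner products a square root in A;
    both are obtained by explicit iterations, estimated in the Hilbert space
    representations of A.  These determine the norm of A since A is a crossed
    product, once the convolution algebra C_c(T x Pi_T, C_0(M~)) is known to be
    closed under its operations. *)

Require Import Defs.
From HB Require Import structures.
From mathcomp Require Import all_boot all_order all_algebra.
From mathcomp Require Import complex ring lra.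
From mathcomp Require Import all_classical all_reals all_analysis.
Import Order.TTheory GRing.Theory Num.Theory.
Import numFieldNormedType.Exports.
Set Implicit Arguments.
Unset Strict Implicit.
Unset Printing Implicit Defensive.
Local Open Scope classical_set_scope.
Local Open Scope ring_scope.

(** * Norms, limits and completions *)

(** The supremum defining the minimal norm runs over all *-representations of K, not only over the
    identical one, and they have to be compared. This is done at finite rank. A representation sends
    the matrix units of a finite corner to partial isometries between mutually orthogonal copies of
    one subspace, so on the corner it is a multiple of the identical representation, up to a summand
    on which it vanishes. Hence the norm of \sum_i a_i (x) k_i is determined by operator matrices
    over representations of A, indexed by orthonormal systems of the Hilbert space.

    Spectral theory is bypassed throughout. Contractivity of representations comes from 2^n-th
    powers and the C*-identity, the approximate unit from a telescoping estimate for the powers of 1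
    - a^* a, the square root from a quadratic iteration dominated by its scalar case. The square
    root is needed on one side only: X X^* is positive in D with a factor at hand, whereas x^* x
    lies in A (x) p and x does not. *)

Section Norms.
Variable R : realType.
Local Notation C := R[i].

Lemma ge0_Re (z : C) : 0 <= z -> z = ((complex.Re z)%:C)%C.
Proof. by case: z => a b; rewrite lecE /= => /andP[/eqP -> _]. Qed.

Lemma nrmE (V : normedModType C) (v : V) : `|v| = ((nrm v)%:C)%C.
Proof. exact/ge0_Re/normr_ge0. Qed.

Lemma nrm_ge0 (V : normedModType C) (v : V) : 0 <= nrm v.
Proof. by rewrite -lecR -nrmE normr_ge0. Qed.

Lemma nrmD (V : normedModType C) (u v : V) : nrm (u + v) <= nrm u + nrm v.
Proof. by rewrite -lecR rmorphD /= -!nrmE ler_normD. Qed.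

Lemma nrmN (V : normedModType C) (v : V) : nrm (- v) = nrm v.
Proof. by rewrite /nrm normrN. Qed.

Lemma nrmB (V : normedModType C) (u v : V) : nrm (u - v) = nrm (v - u).
Proof. by rewrite -nrmN opprB. Qed.

Lemma nrm0 (V : normedModType C) : nrm (0 : V) = 0.
Proof. by rewrite /nrm normr0. Qed.

Lemma nrm_eq0 (V : normedModType C) (v : V) : nrm v = 0 -> v = 0.
Proof. by move=> h; apply/normr0_eq0; rewrite nrmE h. Qed.

(** The modulus as an element of [R]; the norm of [R[i]] itself takes values in [R[i]], where [lra]
    and [nra] do not apply. *)
Definition cn (a : C) : R := nrm (a : C^o).

Lemma cnE (a : C) : `|a| = ((cn a)%:C)%C.
Proof. by rewrite -(nrmE (a : C^o)). Qed.

Lemma nrmZ (V : normedModType C) a (v : V) : nrm (a *: v) = cn a * nrm v.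
Proof. by apply: complexI; rewrite -nrmE normrZ rmorphM /= -(nrmE v) -cnE. Qed.

Lemma cn_ge0 a : 0 <= cn a. Proof. exact: nrm_ge0. Qed.
Lemma cnM a b : cn (a * b) = cn a * cn b.
Proof. exact: (nrmZ a (b : C^o)). Qed.
Lemma cnD a b : cn (a + b) <= cn a + cn b.
Proof. exact: nrmD. Qed.
Lemma cnR (x : R) : cn (x%:C)%C = `|x|.
Proof. by apply: complexI; rewrite -cnE normc_def /= expr0n addr0 sqrtr_sqr. Qed.
Lemma cnN a : cn (- a) = cn a. Proof. exact: nrmN. Qed.
Lemma cnJ a : cn a^* = cn a.
Proof. by apply: complexI; rewrite -!cnE norm_conjC. Qed.
Lemma cn0 : cn 0 = 0. Proof. exact: nrm0. Qed.
Lemma cn1 : cn 1 = 1. Proof. by rewrite (cnR 1) normr1. Qed.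
Lemma cni : cn 'i = 1. Proof. by apply: complexI; rewrite -cnE normCi. Qed.
Lemma cn_sqr a : ((cn a ^+ 2)%:C)%C = a * a^*.
Proof. by rewrite rmorphXn /= -cnE normCK. Qed.

Lemma cn_ge_Re (z : C) : `|complex.Re z| <= cn z.
Proof. by rewrite -lecR -cnE; exact: normc_ge_Re. Qed.

Lemma cn_ge_Im (z : C) : `|complex.Im z| <= cn z.
Proof.
have -> : cn z = cn ('i * z) by rewrite cnM cni mul1r.
by apply: le_trans (cn_ge_Re _); case: z => a b /=; rewrite mul0r mul1r add0r normrN.
Qed.

Lemma cn_le_ReIm (z : C) : cn z <= `|complex.Re z| + `|complex.Im z|.
Proof.
rewrite {1}(_ : z = ((complex.Re z)%:C)%C + 'i * ((complex.Im z)%:C)%C).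
  by rewrite (le_trans (cnD _ _))// cnM !cnR cni mul1r.
by case: z => a b; apply/eqP; rewrite eq_complex /=; apply/andP; split; apply/eqP; ring.
Qed.

Lemma nrmBt (V : normedModType C) (v u w : V) :
  nrm (u - w) <= nrm (u - v) + nrm (v - w).
Proof. by rewrite (le_trans _ (nrmD _ _))// addrA subrK. Qed.

Lemma nrm_le_dist (V : normedModType C) (u w : V) : nrm u <= nrm (u - w) + nrm w.
Proof. by have := nrmD (u - w) w; rewrite subrK. Qed.

(** The last step of the duality estimates below: x ^+ 2 is an inner product or a C*-norm, and
    Cauchy-Schwarz or submultiplicativity bounds it by c * x. *)
Lemma sqr_le_mul (x c : R) : 0 <= x -> 0 <= c -> x ^+ 2 <= c * x -> x <= c.
Proof.
move=> x0 c0; have [->//|xn0] := eqVneq x 0.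
by rewrite expr2 ler_pM2r// lt_def xn0.
Qed.

Lemma nrm_sum (V : normedModType C) (I : Type) (r : seq I) (P : pred I)
    (F : I -> V) :
  nrm (\sum_(i <- r | P i) F i) <= \sum_(i <- r | P i) nrm (F i).
Proof.
elim/big_rec2: _ => [|i y x _ h]; first by rewrite nrm0.
by rewrite (le_trans (nrmD _ _))// lerD2l.
Qed.

Lemma ltC_real (e : C) : 0 < e -> exists2 r : R, 0 < r & e = (r%:C)%C.
Proof.
case: e => a b; rewrite ltcE /= => /andP[/eqP bE a0].
by exists a => //; rewrite bE.
Qed.

Lemma nbhs_nrmP (V : normedModType C) (x : V) (A : set V) :
  nbhs x A <-> exists2 e : R, 0 < e & forall y, nrm (x - y) < e -> A y.
Proof.
split.
  move/nbhs_ballP => [e /= e0 eA]; have [r r0 eE] := ltC_real e0.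
  exists r => // y xy; apply: eA; rewrite -ball_normE /ball_ /= eE nrmE.
  by rewrite ltcR.
move=> [e e0 eA]; apply/nbhs_ballP; exists (e%:C)%C => /=; first by rewrite ltcR.
move=> y; rewrite -ball_normE /ball_ /= nrmE ltcR; exact: eA.
Qed.

Lemma nrm_le_eps (V : normedModType C) (x : V) :
  (forall e : R, 0 < e -> nrm x <= e) -> x = 0.
Proof.
move=> h; apply: nrm_eq0; apply/eqP; rewrite eq_le nrm_ge0 andbT.
by apply/ler_addgt0Pl => e e0; rewrite addr0; exact: h.
Qed.

Lemma nrm_eq_eps (V : normedModType C) (x y : V) :
  (forall e : R, 0 < e -> nrm (x - y) <= e) -> x = y.
Proof. by move=> h; apply/subr0_eq/nrm_le_eps. Qed.

(** Closure tested with real radii, so that all epsilon estimates take place in [R]; [ndenseP] and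
    [tendsP] translate back to the topology. *)
Definition ncl (V : normedModType C) (S : set V) : set V :=
  [set x | forall e : R, 0 < e -> exists2 s, S s & nrm (x - s) < e].

Definition ndense (V : normedModType C) (S : set V) : Prop := forall x, ncl S x.

Lemma ndenseP (V : normedModType C) (S : set V) : dense S <-> ndense S.
Proof.
split=> [dS x e e0|dS O [x Ox] oO].
  have [] := dS (interior [set y | nrm (x - y) < e]).
  - exists x; apply/nbhs_nrmP; exists e => // y.
  - exact: open_interior.
  - by move=> y [/interior_subset /= xy Sy]; exists y.
have /nbhs_nrmP[e e0 eO] : nbhs x O by exact: open_nbhs_nbhs.
by have [s Ss xs] := dS x e e0; exists s; split => //; exact: eO.
Qed.

Definition tends (V : normedModType C) (u : nat -> V) (l : V) : Prop :=
  forall e : R, 0 < e -> exists N, forall n, (N <= n)%N -> nrm (u n - l) < e.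

Definition ncauchy (V : normedModType C) (u : nat -> V) : Prop :=
  forall e : R, 0 < e ->
    exists N, forall m n, (N <= m)%N -> (N <= n)%N -> nrm (u m - u n) < e.

Lemma tendsP (V : normedModType C) (u : nat -> V) (l : V) :
  tends u l <-> u @ \oo --> l.
Proof.
split=> [ul A /nbhs_nrmP[e e0 eA]|ul e e0].
  have [N hN] := ul e e0; exists N => // n /= Nn; apply: eA.
  by rewrite nrmB; exact: hN.
have : nbhs l [set y | nrm (l - y) < e] by apply/nbhs_nrmP; exists e.
by move/ul => [N _ hN]; exists N => n Nn; rewrite nrmB; exact: hN.
Qed.

Lemma ncauchy_cvg (V : completeNormedModType C) (u : nat -> V) :
  ncauchy u -> exists l, tends u l.
Proof.
move=> uC; have /cvg_ex[l ul] : cvg (u @ \oo).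
  apply: cauchy_cvg; apply: cauchy_exP => e /ltC_real[r r0 ->].
  have [N hN] := uC r r0; exists (u N); exists N => // n /= Nn.
  by rewrite /= -ball_normE /ball_ /= nrmE ltcR; exact: hN.
by exists l; apply/tendsP.
Qed.

Lemma tends_uniq (V : normedModType C) (u : nat -> V) l l' :
  tends u l -> tends u l' -> l = l'.
Proof.
move=> h h'; apply: nrm_eq_eps => e e0.
have e2 : 0 < e / 2 by rewrite divr_gt0.
have [N hN] := h _ e2; have [N' hN'] := h' _ e2.
rewrite (splitr e) (le_trans (nrmBt (u (maxn N N')) _ _))// lerD//.
  by rewrite nrmB ltW// hN// leq_maxl.
by rewrite ltW// hN'// leq_maxr.
Qed.

Lemma tends_ge0 (z : nat -> C^o) (l : C^o) :
  tends z l -> (forall n, 0 <= (z n : C)) -> 0 <= (l : C).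
Proof.
move=> zl z0; rewrite -[l](_ : `|l| = l) ?normr_ge0//.
have /tendsP/cvg_norm zl' := zl; apply: (tends_uniq _ zl); apply/tendsP.
by rewrite (_ : z = fun n => `|z n|)//; apply/funext => n; rewrite ger0_norm.
Qed.

Lemma tends_lipschitz (V W : normedModType C) (f : V -> W) (c : R) (u : nat -> V) l :
  (forall x y, nrm (f x - f y) <= c * nrm (x - y)) ->
  tends u l -> tends (f \o u) (f l).
Proof.
move=> fc ul e e0.
(* Adding 1 keeps the divisor positive when c vanishes; the same device recurs in most epsilon
   estimates below. *)
have c1 : 0 < `|c| + 1 by rewrite ltr_wpDl.
have [N hN] := ul (e / (`|c| + 1)) (divr_gt0 e0 c1).
exists N => n Nn; rewrite (le_lt_trans (fc _ _))//.
have := hN n Nn; rewrite ltr_pdivlMr// => /(le_lt_trans _); apply.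
by rewrite mulrC ler_wpM2l ?nrm_ge0// (le_trans (ler_norm c))// lerDl.
Qed.

Lemma inv_lt_eps (e : R) : 0 < e ->
  exists N, forall n, (N <= n)%N -> n.+1%:R^-1 < e.
Proof.
move=> e0; exists (Num.truncn e^-1) => n Nn.
rewrite (@le_lt_trans _ _ (Num.truncn e^-1).+1%:R^-1)//.
  by rewrite lef_pV2 ?posrE// ler_nat.
by rewrite invf_plt ?posrE// truncnS_gt.
Qed.

Lemma ncl_seq (V : normedModType C) (S : set V) x : ncl S x ->
  exists2 u : nat -> V, forall n, S (u n) & tends u x.
Proof.
move=> dS.
have h n : exists s, S s /\ nrm (s - x) < n.+1%:R^-1.
  by have [s Ss xs] := dS n.+1%:R^-1 ltac:(by []); exists s; rewrite nrmB.
have [u hu] := choice h; exists u => [n|e e0]; first by case: (hu n).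
have [N hN] := inv_lt_eps e0; exists N => n Nn.
by have [_ /lt_trans->//] := hu n; exact: hN.
Qed.

Lemma tends_cauchy (V : normedModType C) (u : nat -> V) l : tends u l -> ncauchy u.
Proof.
move=> h e e0; have e2 : 0 < e / 2 by rewrite divr_gt0.
have [N hN] := h _ e2; exists N => m n Nm Nn.
rewrite (splitr e) (le_lt_trans (nrmBt l _ _))// ltrD ?hN//.
by rewrite nrmB hN.
Qed.

Lemma tends_cst (V : normedModType C) (x : V) : tends (fun=> x) x.
Proof. by move=> e e0; exists 0%N => n _; rewrite subrr nrm0. Qed.

Lemma tendsL (V : normedModType C) (a : C) (u v : nat -> V) x y :
  tends u x -> tends v y -> tends (fun n => a *: u n + v n) (a *: x + y).
Proof.
by move=> ux vy; apply/tendsP; apply: cvgD; [apply: cvgZl_tmp|]; exact/tendsP.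
Qed.

Lemma tends_le (V W : normedModType C) (u : nat -> V) (w : nat -> W) x y (c : R) :
  tends u x -> tends w y -> 0 <= c -> (forall n, nrm (w n) <= c * nrm (u n)) ->
  nrm y <= c * nrm x.
Proof.
move=> ux wy c0 wu; apply/ler_addgt0Pl => e e0.
have e2 : 0 < e / 2 by rewrite divr_gt0.
have c1 : 0 < c + 1 by rewrite ltr_wpDl.
have [N hN] := ux _ (divr_gt0 e2 c1); have [M hM] := wy _ e2.
have {}hM := hM _ (leq_maxr N M); have {}hN := hN _ (leq_maxl N M).
set n := maxn N M in hM hN.
have h1 := nrm_le_dist y (w n); rewrite nrmB in h1.
have h2 := ler_wpM2l c0 (nrm_le_dist (u n) x); have := wu n.
have : c * nrm (u n - x) <= e / 2.
  move: hN; rewrite ltr_pdivlMr// => /ltW; apply: le_trans.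
  by rewrite mulrC ler_wpM2l ?nrm_ge0// lerDl.
by move: hM h1 h2; rewrite mulrDr; lra.
Qed.

(* Maps out of a completion are built by closing a graph, so that well-definedness
   comes from the bound. *)
Lemma extend_graph (V : normedModType C) (W : completeNormedModType C)
    (G : V -> W -> Prop) (c : R) :
  0 <= c ->
  (forall a x y x' y', G x y -> G x' y' -> G (a *: x + x') (a *: y + y')) ->
  (forall x y, G x y -> nrm y <= c * nrm x) ->
  ndense [set x | exists y, G x y] ->
  exists f : V -> W, [/\ linear f, opbound f c, forall x y, G x y -> f x = y &
    forall x, exists u w, [/\ forall n, G (u n) (w n), tends u x & tends w (f x)]].
Proof.
move=> c0 Glin Gc Gd.
(* [lim] is the closure of the graph. The bound survives the closure, and applied to a difference it
   makes [lim] single-valued; completeness of W makes it total. *)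
pose lim x y := exists u w,
  [/\ forall n, G (u n) (w n), tends u x & tends w y].
have limL a x y x' y' : lim x y -> lim x' y' -> lim (a *: x + x') (a *: y + y').
  move=> [u [w [Gu ux wy]]] [u' [w' [Gu' ux' wy']]].
  exists (fun n => a *: u n + u' n), (fun n => a *: w n + w' n).
  by split=> [n||]; [exact: Glin|exact: tendsL|exact: tendsL].
have lim_le x y : lim x y -> nrm y <= c * nrm x.
  by move=> [u [w [Gu ux wy]]]; apply: (tends_le ux wy c0) => n; exact: Gc.
have lim_uniq x y y' : lim x y -> lim x y' -> y = y'.
  move=> h h'; have := lim_le _ _ (limL (-1) _ _ _ _ h' h).
  rewrite !scaleN1r addNr nrm0 mulr0 addrC => le0.
  by apply/subr0_eq/nrm_eq0/eqP; rewrite eq_le le0 nrm_ge0.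
have GB x y x' y' : G x y -> G x' y' -> G (x - x') (y - y').
  by move=> h h'; have := Glin (-1) _ _ _ _ h' h; rewrite !scaleN1r addrC (addrC _ y).
have ex x : exists y, lim x y.
  have [u hu ux] := ncl_seq (Gd x); have [w hw] := choice hu.
  suff /ncauchy_cvg[y wy] : ncauchy w by exists y, u, w.
  move=> e e0; have c1 : 0 < c + 1 by rewrite ltr_wpDl.
  have [N hN] := tends_cauchy ux (divr_gt0 e0 c1).
  exists N => m n Nm Nn; apply: le_lt_trans (Gc _ _ (GB _ _ _ _ (hw m) (hw n))) _.
  have := hN m n Nm Nn; rewrite ltr_pdivlMr//; apply: le_lt_trans.
  by rewrite mulrC ler_wpM2l ?nrm_ge0// lerDl.
have [f ff] := choice ex; exists f; split=> //.
- by move=> a x x'; apply: lim_uniq (ff _) (limL _ _ _ _ _ (ff x) (ff x')).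
- by move=> x; exact: lim_le.
- move=> x y Gxy; apply: lim_uniq (ff x) _.
  by exists (fun=> x), (fun=> y); split=> //; exact: tends_cst.
Qed.

End Norms.

Section ComplexContinuity.
Variable R : realType.
Local Notation C := R[i].

Lemma contCP (T : topologicalType) (f : T -> C) :
  continuous (f : T -> C^o) <-> forall z0 (e : R), 0 < e ->
    \forall z \near z0, cn (f z - f z0) < e.
Proof.
split=> [fc z0 e e0|h z0 A /nbhs_nrmP[e e0 eA]].
  have : nbhs (f z0 : C^o) [set y : C^o | nrm ((f z0 : C^o) - y) < e].
    by apply/nbhs_nrmP; exists e.
  move=> /(fc z0) h; have {}h : \forall z \near z0, nrm ((f z0 : C^o) - f z) < e := h.
  by apply: filterS h => z; rewrite nrmB.
suff : \forall z \near z0, A (f z) by [].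
by apply: filterS (h z0 e e0) => z hz; apply: eA; rewrite nrmB.
Qed.

Lemma contC_mul (T : topologicalType) (f g : T -> C) :
  continuous (f : T -> C^o) -> continuous (g : T -> C^o) ->
  continuous ((fun z => f z * g z) : T -> C^o).
Proof. by move=> fc gc z; exact: (@cvgM C T (nbhs z) _ f g _ _ (fc z) (gc z)). Qed.

Lemma contC_conj (T : topologicalType) (f : T -> C) :
  continuous (f : T -> C^o) -> continuous ((fun z => (f z)^*) : T -> C^o).
Proof.
move=> /contCP fc; apply/contCP => z0 e e0; apply: filterS (fc z0 e e0) => z.
by rewrite -rmorphB cnJ.
Qed.

Lemma contC_pair (T : topologicalType) (f g : T -> R) :
  continuous (f : T -> R^o) -> continuous (g : T -> R^o) ->
  continuous ((fun z => (f z +i* g z)%C) : T -> C^o).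
Proof.
move=> fc gc; apply/contCP => z e e0; have e2 : 0 < e / 2 by rewrite divr_gt0.
have /cvgrPdist_lt/(_ _ e2) h1 := fc z; have /cvgrPdist_lt/(_ _ e2) h2 := gc z.
apply: filterS2 h1 h2 => y h1 h2; rewrite (le_lt_trans (cn_le_ReIm _))// (splitr e).
by rewrite /= distrC (distrC (g y)) ltrD.
Qed.

Lemma contC_Re (T : topologicalType) (f : T -> C) :
  continuous (f : T -> C^o) -> continuous ((fun z => complex.Re (f z)) : T -> R^o).
Proof.
move=> /contCP fc z0; apply/cvgrPdist_lt => e e0; apply: filterS (fc z0 e e0) => z.
by rewrite distrC -raddfB; apply: le_lt_trans; exact: cn_ge_Re.
Qed.

Lemma contC_Im (T : topologicalType) (f : T -> C) :
  continuous (f : T -> C^o) -> continuous ((fun z => complex.Im (f z)) : T -> R^o).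
Proof.
move=> /contCP fc z0; apply/cvgrPdist_lt => e e0; apply: filterS (fc z0 e e0) => z.
by rewrite distrC -raddfB; apply: le_lt_trans; exact: cn_ge_Im.
Qed.

(** Turns a locally uniform statement into a uniform one over K. The filter is arbitrary because it
    is used for neighbourhoods, for infinity and for the compact subsets ordered by inclusion. *)
Lemma compact_near (T : topologicalType) (K : set T) (I : Type)
    (F : set_system I) (P : I -> T -> Prop) : Filter F -> compact K ->
  (forall x, K x -> \forall x' \near x & i \near F, P i x') ->
  \forall i \near F, forall x, K x -> P i x.
Proof.
move=> FF /compact_near_coveringP cK hP.
by apply: filterS (cK I F P FF hP) => i h x Kx; exact: h.
Qed.

End ComplexContinuity.

(** * Banach spaces carved out of a vector space *)

Section SubBanach.
Variable R : realType.
Local Notation C := R[i].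

(** Sequences suffice: a Cauchy filter contains a ball of radius 1 / (n + 1) for each n, and the
    centres form a Cauchy sequence because two members of the filter meet. *)
Lemma ncauchy_complete (V : normedModType C) :
  (forall u : nat -> V, ncauchy u -> exists l, tends u l) ->
  forall F : set_system V, ProperFilter F -> cauchy F -> cvg F.
Proof.
move=> hV F PF /(cauchyP F) FC.
have h n : exists x, F [set y | nrm (x - y) < n.+1%:R^-1].
  have [|x Fx] := FC ((n.+1%:R^-1 : R)%:C)%C; first by rewrite ltcR invr_gt0.
  exists x; apply: filterS Fx => y.
  by rewrite -ball_normE /ball_ /= nrmE ltcR.
have [u hu] := choice h.
have uu m n : nrm (u m - u n) < m.+1%:R^-1 + n.+1%:R^-1.
  have [y [/= y1 y2]] := filter_ex (filterI (hu m) (hu n)).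
  by rewrite (le_lt_trans (nrmBt y _ _))// ltrD// nrmB.
have half e : 0 < e -> exists N, forall n, (N <= n)%N -> (n.+1%:R^-1 : R) < e / 2.
  by move=> e0; apply: inv_lt_eps; rewrite divr_gt0.
have [|l ul] := hV u.
  move=> e e0; have [N hN] := half e e0; exists N => m n Nm Nn.
  by rewrite (lt_trans (uu _ _))// (splitr e) ltrD// hN.
apply/cvg_ex; exists l => A /nbhs_nrmP[e e0 eA].
have [N hN] := half e e0; have [M hM] := ul _ (divr_gt0 e0 (ltr0n R 2)).
apply: filterS (hu (maxn N M)) => y /= uy; apply: eA.
rewrite (le_lt_trans (nrmBt (u (maxn N M)) _ _))// (splitr e) ltrD//.
  by rewrite nrmB hM// leq_maxr.
by rewrite (lt_trans uy)// hN// leq_maxl.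
Qed.

Variables (E : lmodType C) (P : set E) (N : E -> R).
Hypothesis P0 : P 0.
Hypothesis PL : forall a x y, P x -> P y -> P (a *: x + y).
Hypothesis ND : forall x y, P x -> P y -> N (x + y) <= N x + N y.
Hypothesis NZ : forall a x, P x -> N (a *: x) = cn a * N x.
Hypothesis N0 : forall x, P x -> N x = 0 -> x = 0.
Hypothesis NC : forall u : nat -> E, (forall n, P (u n)) ->
  (forall e : R, 0 < e -> exists M, forall m n, (M <= m)%N -> (M <= n)%N ->
     N (u m - u n) < e) ->
  exists2 l, P l & forall e : R, 0 < e -> exists M, forall n, (M <= n)%N ->
     N (u n - l) < e.

Definition subP : {pred E} := [pred x | `[< P x >]].

Lemma subP_closed : GRing.submod_closed subP.
Proof.
split=> [|a x y /asboolP hx /asboolP hy]; apply/asboolP => //.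
exact: PL.
Qed.

HB.instance Definition _ := GRing.isSubmodClosed.Build C E subP subP_closed.

Definition subBanach := {x : E | x \in subP}.
HB.instance Definition _ := SubChoice.copy subBanach {x : E | x \in subP}.
HB.instance Definition _ := [SubChoice_isSubLmodule of subBanach by <:].

Lemma subBanachP (x : subBanach) : P (val x).
Proof. by have /asboolP := valP x. Qed.

Definition subNorm (x : subBanach) : C := ((N (val x))%:C)%C.

Let normD x y : subNorm (x + y) <= subNorm x + subNorm y.
Proof. by rewrite -rmorphD lecR; apply: ND; exact: subBanachP. Qed.

Let normZ a x : subNorm (a *: x) = `|a| * subNorm x.
Proof. by rewrite /subNorm cnE -rmorphM /= NZ//; exact: subBanachP. Qed.

Let norm0 x : subNorm x = 0 -> x = 0.
Proof.
move=> /complexI h; apply: val_inj; apply: N0 => //; exact: subBanachP.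
Qed.

HB.instance Definition _ :=
  Lmodule_isNormed.Build C subBanach normD normZ norm0.

Lemma subBanach_complete (F : set_system subBanach) :
  ProperFilter F -> cauchy F -> cvg F.
Proof.
apply: ncauchy_complete => u uC.
have [|e e0|l Pl ul] := NC (u := fun n => val (u n)).
- by move=> n; exact: subBanachP.
- by have [M hM] := uC e e0; exists M.
have lP : l \in subP by apply/asboolP.
by exists (Sub l lP) => e e0; have [M hM] := ul e e0; exists M.
Qed.

HB.instance Definition _ := Uniform_isComplete.Build subBanach subBanach_complete.

(** N has to be a norm on P only, since E may be a mere function space. This yields the completed
    Hilbert tensor product and the imprimitivity bimodule. *)
Lemma subBanach_exists : exists (V : completeNormedModType C) (i : V -> E),
  [/\ linear i, forall v, P (i v), forall x, P x -> exists v, i v = x &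
      forall v, nrm v = N (i v)].
Proof.
exists subBanach, val; split=> //.
- exact: subBanachP.
- move=> x Px; have xP : x \in subP by apply/asboolP.
  by exists (Sub x xP).
Qed.

End SubBanach.

Section LinearMaps.
Variables (K : pzRingType) (U V : lmodType K) (f : U -> V).
Hypothesis lf : linear f.

Lemma lin0 : f 0 = 0.
Proof. by have := lf (-1) 0 0; rewrite !scaleN1r oppr0 !addr0 addNr. Qed.
Lemma linD x y : f (x + y) = f x + f y.
Proof. by have := lf 1 x y; rewrite !scale1r. Qed.
Lemma linZ a x : f (a *: x) = a *: f x.
Proof. by have := lf a x 0; rewrite lin0 !addr0. Qed.
Lemma linN x : f (- x) = - f x.
Proof. by rewrite -scaleN1r linZ scaleN1r. Qed.
Lemma linB x y : f (x - y) = f x - f y.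
Proof. by rewrite linD linN. Qed.
Lemma linsum (I : Type) (r : seq I) (P : pred I) (F : I -> U) :
  f (\sum_(i <- r | P i) F i) = \sum_(i <- r | P i) f (F i).
Proof. by elim/big_rec2: _ => [|i x y _ <-]; rewrite ?lin0 ?linD. Qed.
End LinearMaps.

Lemma conjR (R : realType) (x : R) : ((x%:C)%C : R[i])^* = (x%:C)%C.
Proof. exact: conjc_real. Qed.

Lemma two_real (R : realType) : ((2 : R)%:C)%C = 2 :> R[i].
Proof. by rewrite rmorph_nat. Qed.

(** * Hilbert spaces *)

Section PositiveForms.
Variable R : realType.
Local Notation C := R[i].
Variables (V : lmodType C) (q : V -> V -> C).
Hypothesis qP : forall (a : C) u v w, q (a *: u + v) w = a * q u w + q v w.
Hypothesis qC : forall u v, q v u = (q u v)^*.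
Hypothesis qpos : forall u, 0 <= q u u.

Lemma formPr a u v w : q w (a *: u + v) = a^* * q w u + q w v.
Proof. by rewrite qC qP rmorphD rmorphM /= -!qC. Qed.

Lemma form0l w : q 0 w = 0.
Proof.
have := qP (-1) 0 0 w; rewrite scaler0 addr0 mulN1r.
by move=> h; rewrite h addNr.
Qed.

Lemma form_Re u : q u u = ((complex.Re (q u u))%:C)%C.
Proof. exact: ge0_Re. Qed.

Lemma form_CauchySchwarz u v :
  cn (q u v) ^+ 2 <= complex.Re (q u u) * complex.Re (q v v).
Proof.
set A := complex.Re (q u u); set D := complex.Re (q v v).
set b := q u v; have [B BE] : exists B, B = cn b ^+ 2 by exists (cn b ^+ 2).
rewrite -BE.
have A0 : 0 <= A by have := qpos u; rewrite form_Re lecR.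
have D0 : 0 <= D by have := qpos v; rewrite form_Re lecR.
have B0 : 0 <= B by rewrite BE sqr_ge0.
(* Positivity of q at u - t b v: the factor b = q u v turns the cross terms into - 2 t |b|^2. *)
have key (t : R) : 0 <= A - 2 * t * B + t ^+ 2 * B * D.
  have := qpos ((- ((t%:C)%C * b)) *: v + u).
  rewrite qP !formPr (qC u v) -/b !rmorphN rmorphM /= conjR.
  rewrite (form_Re u) (form_Re v) -/A -/D -lecR.
  have bb : b * b^* = (B%:C)%C by rewrite BE -cn_sqr.
  rewrite (_ : (_ + _)%R = ((A - 2 * t * B + t ^+ 2 * B * D)%:C)%C)//.
  rewrite !(rmorphD, rmorphN, rmorphM, rmorphXn) /= -bb.
  by rewrite ?rmorph1; ring.
have [D00|Dn0] := eqVneq D 0.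
  have [->|Bn0] := eqVneq B 0; first by rewrite mulr_ge0.
  (* If q v v = 0 the bound is affine in t, and this t makes it equal to -1. *)
  have := key ((A + 1) / (2 * B)); rewrite D00 mulr0 addr0.
  by rewrite (_ : 2 * _ * B = A + 1); [lra|field].
have Dp : 0 < D by rewrite lt_def Dn0.
have := key D^-1; rewrite (_ : _ + _ = A - B / D); last by field.
by rewrite subr_ge0 ler_pdivrMr.
Qed.

End PositiveForms.

Section Hilbert.
Variable R : realType.
Local Notation C := R[i].
Variable H : hilbert R.
Implicit Types u v w : H.

Lemma ipDl u v w : ip (u + v) w = ip u w + ip v w.
Proof. by have := ipP 1 u v w; rewrite scale1r mul1r. Qed.
Lemma ip0l w : ip 0 w = 0.
Proof. by apply: form0l => *; exact: ipP. Qed.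
Lemma ipZl a u w : ip (a *: u) w = a * ip u w.
Proof. by have := ipP a u 0 w; rewrite addr0 ip0l addr0. Qed.
Lemma ipNl u w : ip (- u) w = - ip u w.
Proof. by rewrite -scaleN1r ipZl mulN1r. Qed.
Lemma ipBl u v w : ip (u - v) w = ip u w - ip v w.
Proof. by rewrite ipDl ipNl. Qed.
Lemma ip_suml (I : Type) (r : seq I) (P : pred I) (F : I -> H) w :
  ip (\sum_(i <- r | P i) F i) w = \sum_(i <- r | P i) ip (F i) w.
Proof. by elim/big_rec2: _ => [|i x y _ <-]; rewrite ?ip0l ?ipDl. Qed.
Lemma ipDr u v w : ip w (u + v) = ip w u + ip w v.
Proof. by rewrite ipC ipDl rmorphD /= -!ipC. Qed.
Lemma ip0r w : ip w 0 = 0.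
Proof. by rewrite ipC ip0l rmorph0. Qed.
Lemma ipZr a u w : ip w (a *: u) = a^* * ip w u.
Proof. by rewrite ipC ipZl rmorphM /= -ipC. Qed.
Lemma ipNr u w : ip w (- u) = - ip w u.
Proof. by rewrite ipC ipNl rmorphN /= -ipC. Qed.
Lemma ipBr u v w : ip w (u - v) = ip w u - ip w v.
Proof. by rewrite ipDr ipNr. Qed.
Lemma ip_sumr (I : Type) (r : seq I) (P : pred I) (F : I -> H) w :
  ip w (\sum_(i <- r | P i) F i) = \sum_(i <- r | P i) ip w (F i).
Proof. by elim/big_rec2: _ => [|i x y _ <-]; rewrite ?ip0r ?ipDr. Qed.

Lemma ipE u : ip u u = ((nrm u ^+ 2)%:C)%C.
Proof. by rewrite ip_norm nrmE rmorphXn. Qed.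

Lemma ip_ge0 u : 0 <= ip u u.
Proof. by rewrite ipE lecR sqr_ge0. Qed.

Lemma ip_CauchySchwarz u v : cn (ip u v) <= nrm u * nrm v.
Proof.
have := form_CauchySchwarz (@ipP _ H) (@ipC _ H) ip_ge0 u v.
rewrite !ipE /= -exprMn ler_sqr// nnegrE ?cn_ge0// mulr_ge0// nrm_ge0//.
Qed.

Lemma tends_ipl (f : nat -> H) l w :
  tends f l -> tends (fun n => ip (f n) w : C^o) (ip l w : C^o).
Proof.
apply: (@tends_lipschitz R H C^o (fun x => ip x w) (nrm w)) => x y.
by rewrite -ipBl mulrC; exact: ip_CauchySchwarz.
Qed.

Lemma tends_ipr (f : nat -> H) l w :
  tends f l -> tends (fun n => ip w (f n) : C^o) (ip w l : C^o).
Proof.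
apply: (@tends_lipschitz R H C^o (ip w) (nrm w)) => x y.
by rewrite -ipBr; exact: ip_CauchySchwarz.
Qed.

Lemma ip_inj u v : (forall w, ip u w = ip v w) -> u = v.
Proof.
move=> h; apply/subr0_eq/nrm_eq0/eqP; rewrite -sqrf_eq0; apply/eqP/complexI.
by rewrite -ipE ipBl h subrr.
Qed.

Lemma nrm_ip_le u (c : R) : 0 <= c -> ip u u <= ((c ^+ 2)%:C)%C -> nrm u <= c.
Proof. by move=> c0; rewrite ipE lecR ler_sqr ?nnegrE// nrm_ge0. Qed.

Lemma nrm_sqrD u v : nrm (u + v) ^+ 2 =
  nrm u ^+ 2 + nrm v ^+ 2 + 2 * complex.Re (ip u v).
Proof.
have h : ((2 * complex.Re (ip u v))%:C)%C = ip u v + (ip u v)^*.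
  by rewrite rmorphM /= two_real -addcJ.
move: (2 * _) h => z h.
apply: complexI; rewrite -ipE ipDl !ipDr rmorphD rmorphD /= h -!ipE (ipC u v).
by ring.
Qed.

Definition orthonormal (I : finType) (e : I -> H) : Prop :=
  forall i j, ip (e i) (e j) = (i == j)%:R.

Definition oproj (I : finType) (e : I -> H) (u : H) : H :=
  \sum_i ip u (e i) *: e i.

Lemma oprojP (I : finType) (e : I -> H) (u : H) i : orthonormal e ->
  ip (oproj e u) (e i) = ip u (e i).
Proof.
move=> oe; rewrite ip_suml (bigD1 i)//= ipZl oe eqxx mulr1 big1 ?addr0//.
by move=> j ji; rewrite ipZl oe (negPf ji) mulr0.
Qed.

Lemma oproj_linear (I : finType) (e : I -> H) : linear (oproj e).
Proof.
move=> a u v; rewrite /oproj scaler_sumr -big_split /=; apply: eq_bigr => i _.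
by rewrite ipP scalerDl scalerA.
Qed.

Lemma ip_sum_orthonormal (I : finType) (e : I -> H) (c d : I -> C) :
  orthonormal e ->
  ip (\sum_i c i *: e i) (\sum_i d i *: e i) = \sum_i c i * (d i)^*.
Proof.
move=> oe; rewrite ip_suml; apply: eq_bigr => i _.
rewrite ipZl ip_sumr (bigD1 i)//= ipZr oe eqxx mulr1 big1 ?addr0//.
by move=> j ji; rewrite ipZr oe eq_sym (negPf ji) mulr0.
Qed.

Lemma ip_oproj (I : finType) (e : I -> H) u v : orthonormal e ->
  ip (oproj e u) v = ip (oproj e u) (oproj e v).
Proof.
move=> oe; rewrite ip_sum_orthonormal// ip_suml; apply: eq_bigr => i _.
by rewrite ipZl -ipC.
Qed.

Lemma ip_oprojr (I : finType) (e : I -> H) u v : orthonormal e ->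
  ip u (oproj e v) = ip (oproj e u) v.
Proof.
by move=> oe; rewrite ipC ip_oproj// -ipC -ip_oproj.
Qed.

Lemma nrm_oproj (I : finType) (e : I -> H) u : orthonormal e ->
  nrm (oproj e u) <= nrm u.
Proof.
move=> oe; have := ip_CauchySchwarz (oproj e u) u; rewrite ip_oproj// ipE cnR.
by rewrite ger0_norm ?sqr_ge0// mulrC; apply: sqr_le_mul; exact: nrm_ge0.
Qed.

Lemma nrm_oprojC (I : finType) (e : I -> H) u : orthonormal e ->
  nrm (u - oproj e u) <= nrm u.
Proof.
move=> oe; rewrite nrm_ip_le ?nrm_ge0// ipBl !ipBr -ip_oproj// -ip_oprojr//.
by rewrite subrr subr0 ip_oprojr// ip_oproj// !ipE -rmorphB lecR gerBl sqr_ge0.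
Qed.

Definition is_subspace (V : lmodType C) (P : set V) : Prop :=
  P 0 /\ forall a x y, P x -> P y -> P (a *: x + y).

Lemma subspaceD (V : lmodType C) (P : set V) : is_subspace P ->
  forall x y, P x -> P y -> P (x + y).
Proof. by move=> [P0 PL] x y Px Py; have := PL 1 x y Px Py; rewrite scale1r. Qed.
Lemma subspaceZ (V : lmodType C) (P : set V) : is_subspace P ->
  forall a x, P x -> P (a *: x).
Proof. by move=> [P0 PL] a x Px; have := PL a x 0 Px P0; rewrite addr0. Qed.
Lemma subspaceB (V : lmodType C) (P : set V) : is_subspace P ->
  forall x y, P x -> P y -> P (x - y).
Proof.
move=> SP x y Px Py; apply: subspaceD => //.
by rewrite -scaleN1r; exact: subspaceZ.
Qed.
Lemma subspace_sum (V : lmodType C) (P : set V) (I : Type) (r : seq I)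
    (Q : pred I) (F : I -> V) : is_subspace P ->
  (forall i, Q i -> P (F i)) -> P (\sum_(i <- r | Q i) F i).
Proof.
move=> SP PF; apply: big_ind => //; first by case: SP.
exact: subspaceD.
Qed.

(** P is carried along because [finite_part_bound] needs the orthonormal vectors to stay in the
    range of a projection. *)
Lemma GramSchmidt_seq (P : set H) (s : seq H) : is_subspace P ->
  {in s, forall v, P v} ->
  exists m (e : 'I_m -> H), [/\ orthonormal e, forall j, P (e j) &
    {in s, forall v, v = oproj e v}].
Proof.
move=> SP; elim: s => [|x s IH] sP.
  by exists 0%N, (fun=> 0); split=> // -[].
have [|m [e [oe Pe se]]] := IH.
  by move=> v vs; apply: sP; rewrite inE vs orbT.
pose y := x - oproj e x.
have Py : P y.
  apply: subspaceB => //; first by apply: sP; rewrite inE eqxx.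
  by apply: subspace_sum => // i _; exact: subspaceZ.
have ye i : ip y (e i) = 0 by rewrite ipBl oprojP// subrr.
have [y0|yn0] := eqVneq y 0.
  exists m, e; split=> // v; rewrite inE => /predU1P[->|]; last exact: se.
  exact/subr0_eq.
have ny : nrm y != 0 by apply: contra yn0 => /eqP/nrm_eq0->.
pose z := (((nrm y)^-1)%:C)%C *: y.
pose e' (i : 'I_m.+1) := if unlift ord0 i is Some j then e j else z.
have e'0 : e' ord0 = z by rewrite /e' unlift_none.
have e'S j : e' (lift ord0 j) = e j by rewrite /e' liftK.
have ze i : ip z (e i) = 0 by rewrite ipZl ye mulr0.
have zz : ip z z = 1.
  rewrite ipZl ipZr ipE conjR -!rmorphM /=.
  by rewrite (_ : _ * _ = 1)//; field.
exists m.+1, e'; split.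
- move=> i j; case: (unliftP ord0 i) => [i'|] ->; case: (unliftP ord0 j) => [j'|] ->;
    rewrite ?e'0 ?e'S.
  + by rewrite oe (inj_eq (@lift_inj _ _)).
  + by rewrite ipC ze rmorph0 eq_sym (negPf (neq_lift _ _)).
  + by rewrite ze (negPf (neq_lift _ _)).
  + by rewrite zz eqxx.
- move=> j; case: (unliftP ord0 j) => [j'|] ->; rewrite ?e'0 ?e'S//.
  exact: subspaceZ.
- have oE v : oproj e' v = ip v z *: z + oproj e v.
    rewrite /oproj big_ord_recl e'0; congr (_ + _).
    by apply: eq_bigr => j _; rewrite e'S.
  move=> v; rewrite inE => /predU1P[->|vs]; rewrite oE.
    rewrite {2}(_ : x = y + oproj e x); last by rewrite subrK.
    rewrite ipDl (_ : ip (oproj e x) z = 0) ?addr0; last first.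
      rewrite ip_suml big1// => i _.
      by rewrite ipZl [ip _ z]ipC ze rmorph0 mulr0.
    rewrite ipZr conjR ipE -rmorphM /= scalerA -rmorphM /=.
    rewrite (_ : _ * _ = 1) ?scale1r ?subrK//; by field.
  rewrite -se// {2}(se v vs) ip_suml big1 ?scale0r ?add0r//.
  by move=> i _; rewrite ipZl [ip _ z]ipC ze rmorph0 mulr0.
Qed.

Lemma GramSchmidt (P : set H) (I : finType) (v : I -> H) : is_subspace P ->
  (forall i, P (v i)) ->
  exists m (e : 'I_m -> H), [/\ orthonormal e, forall j, P (e j) &
    forall i, v i = \sum_j ip (v i) (e j) *: e j].
Proof.
move=> SP vP; have [|m [e [oe Pe se]]] := @GramSchmidt_seq P (codom v) SP.
  by move=> x /codomP[i ->].
by exists m, e; split=> // i; exact/se/codom_f.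
Qed.

Lemma GramSchmidtT (I : finType) (v : I -> H) :
  exists m (e : 'I_m -> H), orthonormal e /\
    forall i, v i = \sum_j ip (v i) (e j) *: e j.
Proof.
by have [//|//|m [e [oe _ h]]] := @GramSchmidt setT I v; exists m, e.
Qed.

End Hilbert.

Section Adjoint.
Variable R : realType.
Local Notation C := R[i].
Variables (H' H : hilbert R) (V : H' -> H).
Hypothesis lV : linear V.
Hypothesis Vip : forall u v, ip (V u) (V v) = ip u v.

Lemma isometry_nrm u : nrm (V u) = nrm u.
Proof.
have := ipE (V u); rewrite Vip ipE => /complexI/eqP.
by rewrite eqrXn2 ?nrm_ge0// => /eqP.
Qed.

Lemma parallelogram (u v : H) :
  nrm (u + v) ^+ 2 + nrm (u - v) ^+ 2 = 2 * nrm u ^+ 2 + 2 * nrm v ^+ 2.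
Proof. by rewrite !nrm_sqrD nrmN ipNr raddfN /=; ring. Qed.

(** The nearest point to u in the range of V. Since V preserves norms, a minimizing sequence can be
    made to converge in the complete space H', without discussing closedness of the range. *)
Lemma isometry_projection (u : H) :
  exists w, forall w', ip (u - V w) (V w') = 0.
Proof.
pose S := [set nrm (u - V w) | w in [set: H']].
have S0 : has_inf S.
  split; first by exists (nrm (u - V 0)), 0.
  by exists 0 => _ [w _ <-]; exact: nrm_ge0.
set d := inf S.
have d0 : 0 <= d by apply: lb_le_inf; [case: S0|move=> _ [w _ <-]; exact: nrm_ge0].
have dle w : d <= nrm (u - V w) by apply: ge_inf; [case: S0|exists w].
have ex n : exists w, nrm (u - V w) < d + n.+1%:R^-1.
  have i0 : (0 : R) < n.+1%:R^-1 by [].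
  have [_ [w _ <-] h] := inf_adherent i0 S0.
  by exists w.
have [w hw] := choice ex.
(* Parallelogram law: the midpoint of [w m] and [w n] is again at distance at least d. *)
have cau m n : nrm (w m - w n) ^+ 2 <=
    2 * (d + m.+1%:R^-1) ^+ 2 + 2 * (d + n.+1%:R^-1) ^+ 2 - 4 * d ^+ 2.
  have := parallelogram (u - V (w m)) (u - V (w n)).
  have -> : u - V (w m) - (u - V (w n)) = V (w n - w m).
    by rewrite (linB lV) opprB addrC addrA subrK.
  rewrite isometry_nrm (nrmB (w n)) => h.
  have h1 : 4 * d ^+ 2 <= nrm (u - V (w m) + (u - V (w n))) ^+ 2.
    have -> : u - V (w m) + (u - V (w n)) =
        (2 : C) *: (u - V (2^-1 *: (w m + w n))).
      rewrite scalerBr (linZ lV) scalerA divff ?pnatr_eq0// scale1r (linD lV).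
      by rewrite addrACA opprD scaler_nat mulr2n.
    rewrite nrmZ (_ : cn 2 = 2); last by rewrite -two_real cnR ger0_norm.
    rewrite exprMn (_ : 2 ^+ 2 = 4 :> R); last by ring.
    by rewrite ler_pM2l// ler_sqr ?nnegrE ?nrm_ge0.
  have h2 : nrm (u - V (w m)) ^+ 2 <= (d + m.+1%:R^-1) ^+ 2.
    by rewrite ler_sqr ?nnegrE ?nrm_ge0 ?addr_ge0// ltW.
  have h3 : nrm (u - V (w n)) ^+ 2 <= (d + n.+1%:R^-1) ^+ 2.
    by rewrite ler_sqr ?nnegrE ?nrm_ge0 ?addr_ge0// ltW.
  move: h h1 h2 h3; set p := m.+1%:R^-1; set q := n.+1%:R^-1.
  by move: p q => p q h h1 h2 h3; lra.
have wC : ncauchy w.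
  move=> e e0.
  (* For p, q <= 1 the bound in [cau] is at most (4 d + 2) (p + q), so p and q below this constant
     make it smaller than e ^+ 2. *)
  have e1 : 0 < e ^+ 2 / (8 * d + 4).
    by rewrite divr_gt0 ?exprn_gt0// ltr_wpDl// mulr_ge0.
  have [N hN] := inv_lt_eps e1; exists N => m n Nm Nn.
  have le1 k : (k.+1%:R^-1 : R) <= 1 by rewrite invf_le1// ler1n.
  have b k : (N <= k)%N -> (k.+1%:R^-1 : R) * (8 * d + 4) < e ^+ 2.
    by move=> Nk; rewrite -ltr_pdivlMr ?hN// ltr_wpDl// mulr_ge0.
  have := b m Nm; have := b n Nn; have := le1 m; have := le1 n.
  have : 0 < (m.+1%:R^-1 : R) by [].
  have : 0 < (n.+1%:R^-1 : R) by [].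
  have := cau m n.
  set p := m.+1%:R^-1; set q := n.+1%:R^-1; set X := nrm _.
  move=> hX q0 p0 q1 p1 hq hp.
  rewrite -(ltr_pXn2r (n := 2))// ?nnegrE ?nrm_ge0 ?ltW//.
  apply: (le_lt_trans hX); nra.
have [w0 ww0] := ncauchy_cvg wC.
have min : nrm (u - V w0) <= d.
  apply/ler_addgt0Pl => e e0; have e2 : 0 < e / 2 by rewrite divr_gt0.
  have [N hN] := ww0 _ e2; have [M hM] := inv_lt_eps e2.
  have := hN (maxn N M) (leq_maxl _ _).
  set k := maxn N M => hk.
  rewrite (le_trans (nrmBt (V (w k)) _ _))// -(linB lV) isometry_nrm.
  have := hw k; have : (k.+1%:R^-1 : R) < e / 2 by rewrite hM// leq_maxr.
  by move: (k.+1%:R^-1) hk => p hk; lra.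
exists w0 => v; set z := u - V w0 in min *.
(* first-order condition at the minimum, along a multiple of V v *)
set b := ip z (V v); have [B BE] : exists B, B = cn b ^+ 2 by exists (cn b ^+ 2).
have key (s : R) : 0 <= s -> 2 * s * B <= s ^+ 2 * B * nrm v ^+ 2.
  move=> s0; have := dle (w0 + ((s%:C)%C * b) *: v).
  rewrite (linD lV) (linZ lV) opprD addrA -/z.
  move=> /(le_trans min); rewrite -(ler_sqr (x := nrm z)) ?nnegrE ?nrm_ge0//.
  rewrite (nrm_sqrD z) nrmN nrmZ isometry_nrm ipNr ipZr -/b.
  rewrite rmorphM /= conjR -mulrA (mulrC b^*) -cn_sqr -BE -rmorphM /=.
  rewrite cnM cnR ger0_norm// !exprMn -BE; lra.
have B0 : B <= 0.
  have n1 : 0 < nrm v ^+ 2 + 1 by rewrite ltr_wpDl ?sqr_ge0.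
  (* With this s one has s^2 |v|^2 = s - s^2, so [key] reads (s + s^2) B <= 0. *)
  pose s := (nrm v ^+ 2 + 1)^-1; have s0 : 0 < s by rewrite invr_gt0.
  have s1 : s ^+ 2 * B * nrm v ^+ 2 = (s - s ^+ 2) * B by rewrite /s; field; rewrite gt_eqF.
  have := key s (ltW s0); rewrite s1 => h.
  have : (s + s ^+ 2) * B <= 0 by lra.
  by rewrite pmulr_rle0// addr_gt0// exprn_gt0.
apply: (@nrm_eq0 _ (C^o : normedModType C)).
by apply/eqP; rewrite -sqrf_eq0 eq_le sqr_ge0 andbT -/(cn b) -BE.
Qed.

(** For an isometry the adjoint is the projection onto the range followed by the inverse of V, which
    replaces the Riesz representation theorem. *)
Lemma isometry_adjoint : exists Vs : H -> H',
  [/\ forall u w, ip (Vs u) w = ip u (V w), linear Vs,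
      forall u, nrm (Vs u) <= nrm u & cancel V Vs].
Proof.
have [Vs hVs] := choice isometry_projection.
have VsP u w : ip (Vs u) w = ip u (V w).
  by apply/esym/subr0_eq; rewrite -Vip -ipBl; exact: hVs.
exists Vs; split=> //.
- by move=> a u v; apply: ip_inj => w; rewrite VsP !ipP !VsP.
- move=> u; have := ip_CauchySchwarz u (V (Vs u)).
  rewrite -VsP ipE cnR isometry_nrm ger0_norm ?sqr_ge0//.
  by apply: sqr_le_mul; exact: nrm_ge0.
- by move=> u; apply: ip_inj => w; rewrite VsP Vip.
Qed.

End Adjoint.

(** * Compact operators *)

Section CompactOperators.
Variable R : realType.
Local Notation C := R[i].

Lemma opbound_continuous (V W : normedModType C) (f : V -> W) (c : R) :
  linear f -> opbound f c -> continuous f.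
Proof.
move=> lf fc x A /nbhs_nrmP[e e0 eA]; apply/nbhs_nrmP.
have c1 : 0 < `|c| + 1 by rewrite ltr_wpDl.
exists (e / (`|c| + 1)) => [|y]; first exact: divr_gt0.
rewrite ltr_pdivlMr// => xy; apply: eA.
rewrite -(linB lf) (le_lt_trans (fc _))// (le_lt_trans _ xy)// mulrC.
by rewrite ler_wpM2l ?nrm_ge0// (le_trans (ler_norm c))// lerDl.
Qed.

Lemma opbound_tends (V W : normedModType C) (f : V -> W) (c : R) u l :
  linear f -> opbound f c -> tends u l -> tends (f \o u) (f l).
Proof.
move=> lf fc; apply: (@tends_lipschitz _ _ _ _ c) => x y.
by rewrite -(linB lf).
Qed.

Lemma precompact_image (V W : normedModType C) (f : V -> W) (A : set V) :
  continuous f -> precompact A -> precompact (f @` A).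
Proof.
rewrite precompactE => cf cA.
apply: (@precompact_subset _ _ (f @` closure A)).
  by move=> _ [x Ax <-]; exists x => //; exact: subset_closure.
apply: compact_precompact; first exact: norm_hausdorff.
by apply: continuous_compact => //; exact: continuous_subspaceT.
Qed.

Lemma precompact_net (V : normedModType C) (A : set V) (e : R) :
  0 < e -> precompact A ->
  exists s : seq V, forall x, A x -> exists2 y, y \in s & nrm (x - y) < e.
Proof.
rewrite precompactE compact_cover => e0 cA.
have [||D _ hD] := cA V setT (fun y => interior [set x | nrm (y - x) < e]).
- by move=> y _; exact: open_interior.
- by move=> x _; exists x => //; apply/nbhs_nrmP; exists e.
exists (finmap.enum_fset D) => x Ax; have [y /= yD] := hD x (subset_closure Ax).
by move=> /interior_subset /= h; exists y => //; rewrite nrmB.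
Qed.

Variable H : hilbert R.
Implicit Types u v w xi eta : H.

Definition rank1 xi eta u : H := ip u eta *: xi.

Lemma rank1_linear xi eta : linear (rank1 xi eta).
Proof. by move=> a u v; rewrite /rank1 ipP scalerDl scalerA. Qed.

Lemma rank1_compact xi eta : compact_op (rank1 xi eta).
Proof.
split; first exact: rank1_linear.
pose c := nrm eta.
(* The image of the unit ball lies in a disc of multiples of xi, hence in the continuous image of a
   compact square. *)
pose g (z : (R^o * R^o)%type) : H := (z.1 +i* z.2)%C *: xi.
have gc : continuous g.
  by move=> z; apply: cvgZr_tmp; apply: contC_pair => y; [exact: cvg_fst|exact: cvg_snd].
apply: (@precompact_subset _ _ (g @` (`[- c, c] `*` `[- c, c]))).
  move=> _ [u /= u1 <-]; exists (complex.Re (ip u eta), complex.Im (ip u eta)).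
    have le : cn (ip u eta) <= c.
      rewrite (le_trans (ip_CauchySchwarz _ _))//.
      by rewrite ler_piMl ?nrm_ge0.
    by split => /=; rewrite in_itv /= -ler_norml (le_trans _ le)// ?cn_ge_Re ?cn_ge_Im.
  by rewrite /g /rank1 /=; case: (ip u eta).
apply: compact_precompact; first exact: norm_hausdorff.
apply: continuous_compact; first exact: continuous_subspaceT.
by apply: compact_setX; exact: segment_compact.
Qed.

Lemma compact_conj (H' : hilbert R) (V : H' -> H) (Vs : H -> H') (f : H' -> H') :
  linear V -> opbound V 1 -> linear Vs -> opbound Vs 1 -> compact_op f ->
  compact_op (V \o f \o Vs).
Proof.
move=> lV bV lVs bVs [lf cf]; split.
  by move=> a u v /=; rewrite lVs lf lV.
apply: (@precompact_subset _ _ (V @` (f @` [set u | nrm u <= 1]))).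
  move=> _ [u /= u1 <-]; exists (f (Vs u)) => //; exists (Vs u) => //=.
  by rewrite (le_trans (bVs u))// mul1r.
by apply: precompact_image => //; exact: opbound_continuous bV.
Qed.

(** Orthonormalize the union of eps-nets of the images of the unit ball. The projection [oproj e]
    fixes the net and 1 - [oproj e] is a contraction, so the distance to the net bounds the error;
    homogeneity extends this from the unit ball. *)
Lemma compact_finite_approx n (f : 'I_n -> H -> H) (eps : R) : 0 < eps ->
  (forall i, compact_op (f i)) ->
  exists m (e : 'I_m -> H), orthonormal e /\
    forall i u, nrm (f i u - oproj e (f i u)) <= eps * nrm u.
Proof.
move=> e0 cf.
have ex i : exists s : seq H, forall x, (f i @` [set u | nrm u <= 1]) x ->
    exists2 y, y \in s & nrm (x - y) < eps.
  by apply: precompact_net => //; case: (cf i).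
have [s hs] := choice ex.
have [|//|m [e [oe _ he]]] := @GramSchmidt_seq _ H setT
  (flatten [seq s i | i <- enum 'I_n]).
  by split.
exists m, e; split=> // i u; have [lf _] := cf i.
have base v : nrm v <= 1 -> nrm (f i v - oproj e (f i v)) <= eps.
  move=> v1; have [|y ys hy] := hs i (f i v); first by exists v.
  have -> : f i v - oproj e (f i v) = (f i v - y) - oproj e (f i v - y).
    rewrite (linB (oproj_linear e)) -(he y) ?opprB ?addrA ?subrK//.
    by apply/flattenP; exists (s i) => //; apply: map_f; rewrite mem_enum.
  by rewrite (le_trans (nrm_oprojC _ oe))// ltW.
have [u0|un0] := eqVneq (nrm u) 0.
  rewrite (nrm_eq0 u0) (lin0 lf) (lin0 (oproj_linear e)) subr0 !nrm0 mulr0//.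
pose a : C := (((nrm u)^-1)%:C)%C.
have up : 0 < nrm u by rewrite lt_def un0 nrm_ge0.
have := base (a *: u).
rewrite (linZ lf) (linZ (oproj_linear e)) -scalerBr !nrmZ cnR.
rewrite ger0_norm ?invr_ge0 ?nrm_ge0// mulVf// => /(_ (lexx _)).
by rewrite mulrC ler_pdivrMr.
Qed.

Lemma star_rep_sum (A : cstarAlg R) (r : A -> H -> H) (I : Type) (s : seq I)
    (Q : pred I) (F : I -> A) u : is_star_rep r ->
  r (\sum_(i <- s | Q i) F i) u = \sum_(i <- s | Q i) r (F i) u.
Proof.
by move=> [[rl _] _ _ _]; exact: (linsum (f := r^~ u)).
Qed.

End CompactOperators.

Section CompactAlgebra.
Variable R : realType.
Local Notation C := R[i].
Variables (H : hilbert R) (K : cstarAlg R) (r : K -> H -> H).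
Hypothesis hK : is_compact_algebra r.

Lemma ka_rep : is_star_rep r. Proof. by case: hK. Qed.
Lemma ka_lin k : linear (r k). Proof. by case: ka_rep => -[_ h] _ _ _; exact: h. Qed.
Lemma ka_linl u : linear (r^~ u). Proof. by case: ka_rep => -[h _] _ _ _; exact: h. Qed.
Lemma ka_mul k k' u : r (cs_mul k k') u = r k (r k' u).
Proof. by case: ka_rep. Qed.
Lemma ka_star k u v : ip (r (cs_star k) u) v = ip u (r k v).
Proof. by case: ka_rep. Qed.
Lemma ka_bound k u : nrm (r k u) <= nrm k * nrm u.
Proof. by case: hK => _ h _ _; case: (h k) => _ b _; exact: b. Qed.
Lemma ka_norm k c : 0 <= c -> opbound (r k) c -> nrm k <= c.
Proof. by case: hK => _ h _ _ c0 b; case: (h k) => _ _; apply. Qed.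
Lemma ka_inj k k' : (forall u, r k u = r k' u) -> k = k'.
Proof.
move=> h; apply/subr0_eq/nrm_eq0/eqP; rewrite eq_le nrm_ge0 andbT.
by apply: ka_norm => // u; rewrite (linB (ka_linl u)) h subrr nrm0 mul0r.
Qed.
Lemma ka_exists f : compact_op f -> exists k, r k = f.
Proof. by case: hK => _ _ _ h; exact: h. Qed.

Lemma theta_exists : exists th : H -> H -> K,
  forall xi eta u, r (th xi eta) u = ip u eta *: xi.
Proof.
have ex (z : H * H) : exists k, r k = rank1 z.1 z.2.
  by apply: ka_exists; exact: rank1_compact.
have [th hth] := choice ex.
by exists (fun xi eta => th (xi, eta)) => xi eta u; rewrite hth.
Qed.

Variable th : H -> H -> K.
Hypothesis thE : forall xi eta u, r (th xi eta) u = ip u eta *: xi.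

Lemma thetaMl k xi eta : cs_mul k (th xi eta) = th (r k xi) eta.
Proof. by apply: ka_inj => u; rewrite ka_mul !thE (linZ (ka_lin k)). Qed.

Lemma thetaM xi eta xi' eta' :
  cs_mul (th xi eta) (th xi' eta') = ip xi' eta *: th xi eta'.
Proof.
by apply: ka_inj => u; rewrite thetaMl (linZ (ka_linl u)) !thE !scalerA mulrC.
Qed.

Lemma theta_star xi eta : cs_star (th xi eta) = th eta xi.
Proof.
apply: ka_inj => u; apply: ip_inj => v.
by rewrite ka_star !thE ipZr ipZl -ipC mulrC.
Qed.

Lemma theta_nrm xi eta : nrm (th xi eta) <= nrm xi * nrm eta.
Proof.
apply: ka_norm => [|u]; first by rewrite mulr_ge0// nrm_ge0.
rewrite thE nrmZ mulrC -mulrA ler_wpM2l ?nrm_ge0// mulrC.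
exact: ip_CauchySchwarz.
Qed.

Lemma theta_linear eta : linear (th^~ eta).
Proof.
move=> a x y; apply: ka_inj => u.
by rewrite (ka_linl u) !thE scalerDr !scalerA mulrC.
Qed.

Lemma theta_linearr xi a y z : th xi (a *: y + z) = a^* *: th xi y + th xi z.
Proof.
apply: ka_inj => u.
by rewrite (ka_linl u) !thE ipDr ipZr scalerDl !scalerA.
Qed.

(** The compression of k to the span of e, written in matrix units so that any representation of K
    can be evaluated on it. *)
Definition finite_part m (e : 'I_m -> H) (k : K) : K :=
  \sum_a \sum_b ip (r k (e b)) (e a) *: th (e a) (e b).

Lemma finite_partE m (e : 'I_m -> H) k u :
  r (finite_part e k) u = oproj e (r k (oproj e u)).
Proof.
rewrite (star_rep_sum _ _ _ _ ka_rep) /oproj; apply: eq_bigr => a _.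
rewrite (star_rep_sum _ _ _ _ ka_rep) (linsum (ka_lin k)) ip_suml scaler_suml.
apply: eq_bigr => b _.
by rewrite (linZ (ka_linl u)) thE (linZ (ka_lin k)) ipZl !scalerA mulrC.
Qed.

(** With P the projection, k - P k P = (1 - P) k + P k (1 - P), and k (1 - P) is the adjoint of (1 -
    P) k^*. Hence one system e has to serve all the k i and their adjoints, n + n operators. *)
Lemma finite_part_approx n (k : 'I_n -> K) (eps : R) : 0 < eps ->
  exists m (e : 'I_m -> H), orthonormal e /\
    forall i, nrm (k i - finite_part e (k i)) <= eps.
Proof.
move=> e0; have e2 : 0 < eps / 2 by rewrite divr_gt0.
pose f (i : 'I_(n + n)) := r (match fintype.split i with
  | inl j => k j | inr j => cs_star (k j) end).
have [|m [e [oe he]]] := compact_finite_approx (f := f) e2.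
  by move=> i; case: hK => _ _ h _; exact: h.
exists m, e; split=> // i; apply: ka_norm => [|u]; first exact: ltW.
have h1 v : nrm (r (k i) v - oproj e (r (k i) v)) <= eps / 2 * nrm v.
  have := he (unsplit (inl i)) v; rewrite /f unsplitK //.
have h2 v : nrm (r (cs_star (k i)) v - oproj e (r (cs_star (k i)) v))
    <= eps / 2 * nrm v.
  have := he (unsplit (inr i)) v; rewrite /f unsplitK //.
rewrite (linB (ka_linl u)) finite_partE.
rewrite (le_trans (nrmBt (oproj e (r (k i) u)) _ _))//.
rewrite (splitr eps) mulrDl lerD//.
rewrite -(linB (oproj_linear e)) (le_trans (nrm_oproj _ oe))//.
rewrite -(linB (ka_lin (k i))).
set x := r (k i) _.
have [x0|xn0] := eqVneq (nrm x) 0; first by rewrite x0 mulr_ge0 ?nrm_ge0// ltW.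
have xp : 0 < nrm x by rewrite lt_def xn0 nrm_ge0.
rewrite -(ler_pM2r xp).
have -> : nrm x * nrm x = cn (ip x x) by rewrite ipE cnR ger0_norm ?sqr_ge0.
(* With x = k (1 - P) u, moving k and 1 - P to the other side leaves (1 - P) k^* x, which [h2]
   controls. *)
have -> : ip x x =
    ip u (r (cs_star (k i)) x - oproj e (r (cs_star (k i)) x)).
  rewrite {1}/x -[k i]cs_starK ka_star ipBl ipBr cs_starK.
  by rewrite ip_oprojr.
rewrite (le_trans (ip_CauchySchwarz _ _))// mulrC [leRHS]mulrAC.
by rewrite ler_wpM2r ?nrm_ge0.
Qed.

End CompactAlgebra.

(** * Hilbert tensor products *)

Section HilbertTensorTheory.
Variable R : realType.
Local Notation C := R[i].

Lemma finsums_fin (V : normedModType C) (S : set V) (I : finType) (s : I -> V) :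
  (forall i, S (s i)) -> finsums S (\sum_i s i).
Proof.
move=> hs; exists #|I|, (fun i => s (enum_val i)); split=> //.
by rewrite (reindex (@enum_val I I)) //=; exact/onW_bij/enum_val_bij.
Qed.

Lemma finsums_sub (V : normedModType C) (S : set V) x : S x -> finsums S x.
Proof. by move=> Sx; exists 1%N, (fun=> x); split=> //; rewrite big_ord1. Qed.

Lemma finsums_subspace (V : normedModType C) (S : set V) :
  (forall a x, S x -> S (a *: x)) -> is_subspace (finsums S).
Proof.
move=> SZ; split; first by exists 0%N, (fun=> 0); split; [case|rewrite big_ord0].
move=> a _ _ [n [s [Ss ->]]] [m [s' [Ss' ->]]].
pose f (z : 'I_n + 'I_m) := match z with inl i => a *: s i | inr i => s' i end.
have -> : a *: (\sum_i s i) + \sum_i s' i = \sum_z f z.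
  by rewrite big_sumType /= scaler_sumr.
by apply: finsums_fin; case=> i /=; [exact: SZ|exact: Ss'].
Qed.

Lemma hilbert_tensor_swap (H1 H2 H : hilbert R) (t : H1 -> H2 -> H) :
  is_hilbert_tensor t -> is_hilbert_tensor (fun v u => t u v).
Proof.
move=> [[t1 t2] tip td]; split; [by split| |].
- by move=> v u v' u'; rewrite tip mulrC.
- rewrite (_ : [set w | _] = [set w | exists u v, w = t u v])//.
  by apply/seteqP; split=> w [a [b ->]]; exists b, a.
Qed.

Variables (H1 H2 H : hilbert R) (t : H1 -> H2 -> H).
Hypothesis ht : is_hilbert_tensor t.

Lemma tenl v : linear (t^~ v). Proof. by case: ht => -[h _] _ _; exact: h. Qed.
Lemma tenr u : linear (t u). Proof. by case: ht => -[_ h] _ _; exact: h. Qed.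
Lemma ten_ip u v u' v' : ip (t u v) (t u' v') = ip u u' * ip v v'.
Proof. by case: ht. Qed.

Lemma ten_dense : ndense [set w | exists n (u : 'I_n -> H1) (v : 'I_n -> H2),
  w = \sum_i t (u i) (v i)].
Proof.
case: ht => _ _ /ndenseP td x e e0; have [w [n [s [hs ->]]] xw] := td x e e0.
exists (\sum_i s i) => //.
have ex i : exists uv : H1 * H2, s i = t uv.1 uv.2.
  by have [u [v ->]] := hs i; exists (u, v).
have [f hf] := choice ex; exists n, (fun i => (f i).1), (fun i => (f i).2).
by apply: eq_bigr => i _; rewrite hf.
Qed.

Lemma ten_orthonormal (I : finType) (e : I -> H2) (x y : I -> H1) :
  orthonormal e ->
  ip (\sum_i t (x i) (e i)) (\sum_i t (y i) (e i)) = \sum_i ip (x i) (y i).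
Proof.
move=> oe; rewrite ip_suml; apply: eq_bigr => i _.
rewrite ip_sumr (bigD1 i)//= ten_ip oe eqxx mulr1 big1 ?addr0// => j ji.
by rewrite ten_ip oe eq_sym (negPf ji) mulr0.
Qed.

Lemma ten_orthonormal_nrm (I : finType) (e : I -> H2) (x : I -> H1) :
  orthonormal e ->
  nrm (\sum_i t (x i) (e i)) ^+ 2 = \sum_i nrm (x i) ^+ 2.
Proof.
move=> oe; apply: complexI; rewrite -ipE ten_orthonormal// rmorph_sum /=.
by apply: eq_bigr => i _; rewrite ipE.
Qed.

Lemma ten_expand (I J : finType) (u : I -> H1) (v : I -> H2) (e : J -> H2)
    (c : I -> J -> C) : (forall i, v i = \sum_j c i j *: e j) ->
  \sum_i t (u i) (v i) = \sum_j t (\sum_i c i j *: u i) (e j).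
Proof.
move=> vE; under eq_bigr => i _ do rewrite vE (linsum (tenr _)).
rewrite exchange_big /=; apply: eq_bigr => j _.
rewrite (linsum (tenl _)); apply: eq_bigr => i _.
by rewrite (linZ (tenr _)) (linZ (tenl _)).
Qed.

(** Expanding the second legs in an orthonormal system makes the sum orthogonal, and the bound on T
    then applies term by term. *)
Lemma ten_amplify (I : finType) (T : H1 -> H1) (c : R) (u : I -> H1)
    (v : I -> H2) : linear T -> 0 <= c -> opbound T c ->
  nrm (\sum_i t (T (u i)) (v i)) <= c * nrm (\sum_i t (u i) (v i)).
Proof.
move=> lT c0 bT; have [m [e [oe ve]]] := GramSchmidtT v.
rewrite (ten_expand _ ve) (ten_expand _ ve).
rewrite -(ler_sqr (x := nrm _)) ?nnegrE ?mulr_ge0 ?nrm_ge0//.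
rewrite exprMn !ten_orthonormal_nrm// mulr_sumr ler_sum// => j _.
have -> : \sum_i ip (v i) (e j) *: T (u i) = T (\sum_i ip (v i) (e j) *: u i).
  by rewrite (linsum lT); apply: eq_bigr => i _; rewrite (linZ lT).
rewrite -exprMn ler_sqr ?nnegrE ?mulr_ge0 ?nrm_ge0//; exact: bT.
Qed.

End HilbertTensorTheory.

Section HilbertTensorOperators.
Variable R : realType.
Variables (H1 H2 H : hilbert R) (t : H1 -> H2 -> H).
Hypothesis ht : is_hilbert_tensor t.

Lemma ten_amplifyr (I : finType) (T : H2 -> H2) (c : R) (u : I -> H1)
    (v : I -> H2) : linear T -> 0 <= c -> opbound T c ->
  nrm (\sum_i t (u i) (T (v i))) <= c * nrm (\sum_i t (u i) (v i)).
Proof. exact: (ten_amplify (hilbert_tensor_swap ht)). Qed.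

Lemma ten_op_exists n (S : 'I_n -> H1 -> H1) (T : 'I_n -> H2 -> H2)
    (c d : 'I_n -> R) :
  (forall i, linear (S i)) -> (forall i, linear (T i)) ->
  (forall i, 0 <= c i) -> (forall i, 0 <= d i) ->
  (forall i, opbound (S i) (c i)) -> (forall i, opbound (T i) (d i)) ->
  exists f : H -> H, [/\ linear f, opbound f (\sum_i c i * d i) &
    forall u v, f (t u v) = \sum_i t (S i u) (T i v)].
Proof.
move=> lS lT c0 d0 bS bT.
(* G relates a finite tensor, in any of its expressions, to the corresponding value; that the value
   does not depend on the expression is left to the norm bound. *)
pose G (x y : H) := exists m (u : 'I_m -> H1) (v : 'I_m -> H2),
  x = \sum_j t (u j) (v j) /\ y = \sum_j \sum_i t (S i (u j)) (T i (v j)).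
have Gfin (J : finType) (u : J -> H1) (v : J -> H2) :
    G (\sum_j t (u j) (v j)) (\sum_j \sum_i t (S i (u j)) (T i (v j))).
  exists #|J|, (u \o enum_val), (v \o enum_val).
  by split; rewrite (reindex (@enum_val J J)) //=; exact/onW_bij/enum_val_bij.
have [||||f [lf bf fG _]] := @extend_graph _ _ _ G (\sum_i c i * d i).
- by rewrite sumr_ge0// => i _; rewrite mulr_ge0.
- move=> a _ _ _ _ [m [u [v [-> ->]]]] [m' [u' [v' [-> ->]]]].
  pose U (z : 'I_m + 'I_m') := match z with inl i => a *: u i | inr i => u' i end.
  pose V (z : 'I_m + 'I_m') := match z with inl i => v i | inr i => v' i end.
  have := Gfin _ U V; rewrite !big_sumType /= !scaler_sumr.
  congr G; congr (_ + _); apply: eq_bigr => j _.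
    by rewrite (linZ (tenl ht _)).
  rewrite scaler_sumr; apply: eq_bigr => i _.
  by rewrite (linZ (lS i)) (linZ (tenl ht _)).
- move=> _ _ [m [u [v [-> ->]]]]; rewrite exchange_big /=.
  rewrite mulr_suml (le_trans (nrm_sum _ _ _))// ler_sum// => i _.
  rewrite (le_trans (ten_amplify ht _ (fun j => T i (v j)) (lS i) _ (bS i)))//.
  by rewrite -mulrA ler_wpM2l// (ten_amplifyr _ _ (lT i)).
- move=> x e e0; have [w [m [u [v ->]]] xw] := ten_dense ht x e0.
  by exists (\sum_i t (u i) (v i)) => //; eexists; exists m, u, v.
exists f; split=> // u v; apply: fG; have := Gfin 'I_1 (fun=> u) (fun=> v).
by rewrite !big_ord1.
Qed.

End HilbertTensorOperators.

(** * Extending an inner product from a dense subspace *)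

Section HilbertFromForm.
Variable R : realType.
Local Notation C := R[i].

(** The polarization identity for forms linear in the first variable. It defines the inner product
    on the whole completion from its norm; the laws then follow by density from the subspace where
    it equals the given form. *)
Definition polar (V : normedModType C) (f h : V) : C :=
  4^-1 * (`|f + h| ^+ 2 - `|f - h| ^+ 2 + 'i * `|f + 'i *: h| ^+ 2
          - 'i * `|f - 'i *: h| ^+ 2).

Lemma polar_tends (V : normedModType C) (u w : nat -> V) f h :
  tends u f -> tends w h ->
  (fun n => polar (u n) (w n) : C^o) @ \oo --> (polar f h : C^o).
Proof.
move=> uf wh.
have T (a : C) : (fun n => `|u n + a *: w n| ^+ 2 : C^o) @ \oo -->
    (`|f + a *: h| ^+ 2 : C^o).
  have : (fun n => u n + a *: w n) @ \oo --> f + a *: h.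
    by apply: cvgD; [exact/tendsP|apply: cvgZl_tmp; exact/tendsP].
  by move=> /cvg_norm nn; rewrite expr2; under eq_fun do rewrite expr2; exact: cvgM.
have T' (a : C) : (fun n => `|u n - a *: w n| ^+ 2 : C^o) @ \oo -->
    (`|f - a *: h| ^+ 2 : C^o).
  by rewrite -scaleNr; under eq_fun do rewrite -scaleNr; exact: T.
have := T 1; rewrite scale1r; under eq_fun do rewrite scale1r; move=> T1.
have := T' 1; rewrite scale1r; under eq_fun do rewrite scale1r; move=> T1'.
exact: (@cvgZl_tmp _ (C^o : normedModType C) _ _ _ 4^-1 _ _ (cvgB (cvgD (cvgB T1 T1')
  (@cvgZl_tmp _ (C^o : normedModType C) _ _ _ 'i _ _ (T 'i)))
  (@cvgZl_tmp _ (C^o : normedModType C) _ _ _ 'i _ _ (T' 'i)))).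
Qed.

Variables (V : completeNormedModType C) (S : set V) (B : V -> V -> C).
Hypothesis SP : is_subspace S.
Hypothesis Sd : ndense S.
Hypothesis BP : forall (a : C) u v w, S u -> S v -> S w ->
  B (a *: u + v) w = a * B u w + B v w.
Hypothesis BC : forall u v, S u -> S v -> B v u = (B u v)^*.
Hypothesis BN : forall u, S u -> B u u = `|u| ^+ 2.

Lemma polar_form u v : S u -> S v -> @polar V u v = B u v.
Proof.
move=> Su Sv.
have e (c : C) : `|u + c *: v| ^+ 2 =
    B u u + c * B v u + c^* * B u v + c * c^* * B v v.
  have Scv : S (c *: v + u) by case: SP => _; apply.
  rewrite addrC -BN// BP// (BC Scv Su) BP// rmorphD rmorphM /= -!BC//.
  rewrite (BC Scv Sv) BP// rmorphD rmorphM /= -!BC//; ring.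
have e' (c : C) : `|u - c *: v| ^+ 2 =
    B u u - c * B v u - c^* * B u v + c * c^* * B v v.
  by rewrite -scaleNr e rmorphN; ring.
have e1 := e 1; have e1' := e' 1; rewrite !scale1r in e1 e1'.
rewrite /polar e1 e1' e e' rmorph1 conjCi.
have ii : 'i * 'i = -1 :> C by rewrite -expr2 sqrCi.
have h4 : (4 : C) != 0 by rewrite pnatr_eq0.
rewrite (_ : _ + _ - _ = 2 * (B v u + B u v) + 2 * ('i * 'i) * (B v u - B u v)).
  by rewrite ii; field.
by ring.
Qed.

Lemma polarP (a : C) u v w :
  @polar V (a *: u + v) w = a * @polar V u w + @polar V v w.
Proof.
have [us uS uu] := ncl_seq (Sd u).
have [vs vS vv] := ncl_seq (Sd v).
have [ws wS ww] := ncl_seq (Sd w).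
have L := polar_tends (tendsL a uu vv) ww.
have : (fun n => a * @polar V (us n) (ws n) + @polar V (vs n) (ws n) : C^o) @ \oo -->
    (a * @polar V u w + @polar V v w : C^o).
  apply: cvgD; last exact: polar_tends.
  by apply: cvgM; [exact: cvg_cst|exact: polar_tends].
rewrite (_ : (fun n => _) = (fun n => @polar V (a *: us n + vs n) (ws n) : C^o)).
  by move=> /(cvg_unique (@norm_hausdorff _ (C^o : normedModType C)) L).
apply/funext => n; have auS : S (a *: us n + vs n) by case: SP => _; apply.
rewrite (polar_form auS (wS n)) (polar_form (uS n) (wS n)).
by rewrite (polar_form (vS n) (wS n)) BP.
Qed.

Lemma polarC u v : @polar V v u = (@polar V u v)^*.
Proof.
have [us uS uu] := ncl_seq (Sd u).
have [vs vS vv] := ncl_seq (Sd v).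
have L := polar_tends uu vv; have L' := polar_tends vv uu.
have cc : continuous (fun z : C^o => z^* : C^o).
  move=> z A /nbhs_nrmP[e e0 eA]; apply/nbhs_nrmP; exists e => // y zy.
  by apply: eA; rewrite -(rmorphB Num.conj) -/(cn _) cnJ.
have : (fun n => (@polar V (us n) (vs n))^* : C^o) @ \oo --> ((@polar V u v)^* : C^o).
  exact: (cvg_comp _ _ L (cc _)).
rewrite (_ : (fun n => _) = (fun n => @polar V (vs n) (us n) : C^o)).
  by move=> /(cvg_unique (@norm_hausdorff _ (C^o : normedModType C)) L').
apply/funext => n; rewrite (polar_form (uS n) (vS n)) (polar_form (vS n) (uS n)).
by rewrite -BC.
Qed.

Lemma polarN u : @polar V u u = `|u| ^+ 2.
Proof.
have i1 : `|1 + 'i| ^+ 2 = 2 :> C.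
  by rewrite normCK rmorphD /= rmorph1 conjCi;
    rewrite (_ : _ * _ = 1 - 'i * 'i); [rewrite -expr2 sqrCi|]; ring.
have i2 : `|1 - 'i| ^+ 2 = 2 :> C.
  by rewrite normCK rmorphB /= rmorph1 conjCi opprK;
    rewrite (_ : _ * _ = 1 - 'i * 'i); [rewrite -expr2 sqrCi|]; ring.
have u0 : `|u - u| = 0 :> C by rewrite subrr normr0.
rewrite /polar u0 (expr2 0) mul0r subr0.
rewrite (_ : u + u = (2 : C) *: u); last by rewrite scaler_nat mulr2n.
rewrite (_ : u + 'i *: u = (1 + 'i) *: u); last by rewrite scalerDl scale1r.
rewrite (_ : u - 'i *: u = (1 - 'i) *: u); last by rewrite scalerBl scale1r.
rewrite !normrZ !exprMn i1 i2 normr_nat.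
by field.
Qed.

Lemma hilbert_from_form : exists q : V -> V -> C,
  [/\ forall (a : C) u v w, q (a *: u + v) w = a * q u w + q v w,
      forall u v, q v u = (q u v)^*, forall u, q u u = `|u| ^+ 2 &
      forall u v, S u -> S v -> q u v = B u v].
Proof.
exists (@polar V); split; [exact: polarP|exact: polarC|exact: polarN|].
exact: polar_form.
Qed.

End HilbertFromForm.

Section ComplexComplete.
Variable R : realType.

Lemma real_cauchy_cvg (u : nat -> R) :
  (forall e : R, 0 < e -> exists N, forall m n, (N <= m)%N -> (N <= n)%N ->
     `|u m - u n| < e) ->
  exists l, forall e : R, 0 < e -> exists N, forall n, (N <= n)%N ->
     `|u n - l| < e.
Proof.
move=> uC; have /cvg_ex[/= l ul] : cvg ((u : nat -> R^o) @ \oo).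
  apply: cauchy_cvg; apply: cauchy_exP => e e0.
  have [N hN] := uC e e0; exists (u N); exists N => // n /= Nn.
  by rewrite /= -ball_normE /ball_ /=; exact: hN.
exists l => e e0; move/cvgrPdist_lt : ul => /(_ e e0)[N _ hN].
by exists N => n Nn; rewrite distrC; exact: hN.
Qed.

Lemma complex_cauchy_cvg (u : nat -> R[i]) :
  (forall e : R, 0 < e -> exists N, forall m n, (N <= m)%N -> (N <= n)%N ->
     cn (u m - u n) < e) ->
  exists l, forall e : R, 0 < e -> exists N, forall n, (N <= n)%N ->
     cn (u n - l) < e.
Proof.
move=> uC.
have [|a ha] := @real_cauchy_cvg (fun n => complex.Re (u n)).
  move=> e e0; have [N hN] := uC e e0; exists N => m n Nm Nn.
  by rewrite -raddfB (le_lt_trans (cn_ge_Re _))// hN.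
have [|b hb] := @real_cauchy_cvg (fun n => complex.Im (u n)).
  move=> e e0; have [N hN] := uC e e0; exists N => m n Nm Nn.
  by rewrite -raddfB (le_lt_trans (cn_ge_Im _))// hN.
exists (a +i* b)%C => e e0; have e2 : 0 < e / 2 by rewrite divr_gt0.
have [N hN] := ha _ e2; have [M hM] := hb _ e2.
exists (maxn N M) => n; rewrite geq_max => /andP[/hN h1 /hM h2].
rewrite (le_lt_trans (cn_le_ReIm _))// (splitr e) !raddfB.
exact: ltrD.
Qed.

End ComplexComplete.

(** * Construction of the Hilbert tensor product *)

Section HilbertTensorExists.
Variable R : realType.
Local Notation C := R[i].
Variables H1 H2 : hilbert R.

(* [s : fam] stands for the tensor \sum_(x <- s) x.1 (x) x.2, and [fform] for the
   inner product of two such tensors. *)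
Definition fam : Type := seq (H1 * H2).
Implicit Types s : fam.

Definition fform s s' : C :=
  \sum_(x <- s) \sum_(y <- s') ip x.1 y.1 * ip x.2 y.2.

Definition fscale (a : C) s : fam := [seq (a *: x.1, x.2) | x <- s].

Lemma fform_catl s1 s2 s : fform (s1 ++ s2) s = fform s1 s + fform s2 s.
Proof. by rewrite /fform big_cat. Qed.

Lemma fformC s s' : fform s' s = (fform s s')^*.
Proof.
rewrite /fform exchange_big /= rmorph_sum; apply: eq_bigr => x _ /=.
by rewrite rmorph_sum; apply: eq_bigr => y _ /=; rewrite rmorphM /= -!ipC.
Qed.

Lemma fform_scalel a s s' : fform (fscale a s) s' = a * fform s s'.
Proof.
rewrite /fform big_map mulr_sumr; apply: eq_bigr => x _.
by rewrite mulr_sumr; apply: eq_bigr => y _; rewrite ipZl mulrA.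
Qed.

(** Orthonormalizing all second components writes [fform] as a finite sum of inner products of H1,
    whence positivity and Cauchy-Schwarz. *)
Lemma fform_expand s s' : exists m (U U' : 'I_m -> H1),
  [/\ fform s s = \sum_j ip (U j) (U j), fform s' s' = \sum_j ip (U' j) (U' j)
    & fform s s' = \sum_j ip (U j) (U' j)].
Proof.
have [|//|m [e [oe _ he]]] := @GramSchmidt_seq _ H2 setT
  [seq x.2 | x <- s ++ s']; first by split.
pose U (s0 : fam) (j : 'I_m) := \sum_(x <- s0) ip x.2 (e j) *: x.1.
have key s1 s2 : {subset s1 <= s ++ s'} -> {subset s2 <= s ++ s'} ->
    fform s1 s2 = \sum_j ip (U s1 j) (U s2 j).
  move=> h1 h2; rewrite /fform big_seq.
  under eq_bigr => x xs.
    rewrite big_seq; under eq_bigr => y ys.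
      rewrite (he x.2) ?(map_f snd) ?h1//.
      rewrite (he y.2) ?(map_f snd) ?h2// ip_sum_orthonormal// mulr_sumr.
      over.
    rewrite -big_seq exchange_big /=; over.
  rewrite -big_seq exchange_big /=; apply: eq_bigr => j _.
  rewrite ip_suml; apply: eq_bigr => x _.
  rewrite ip_sumr; apply: eq_bigr => y _.
  by rewrite ipZl ipZr; ring.
have i1 : {subset s <= s ++ s'} by move=> x xs; rewrite mem_cat xs.
have i2 : {subset s' <= s ++ s'} by move=> x xs; rewrite mem_cat xs orbT.
by exists m, (U s), (U s'); split; apply: key.
Qed.

Lemma fform_ge0 s : 0 <= fform s s.
Proof.
have [m [U [_ [-> _ _]]]] := fform_expand s s.
by apply: sumr_ge0 => j _; exact: ip_ge0.
Qed.

Definition fnorm s : R := Num.sqrt (complex.Re (fform s s)).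

Lemma fnorm_ge0 s : 0 <= fnorm s. Proof. exact: sqrtr_ge0. Qed.

Lemma fnorm_sqr s : fform s s = ((fnorm s ^+ 2)%:C)%C.
Proof.
have h := ge0_Re (fform_ge0 s).
by rewrite /fnorm sqr_sqrtr // -lecR -h fform_ge0.
Qed.

Lemma fform_CauchySchwarz s s' : cn (fform s s') <= fnorm s * fnorm s'.
Proof.
have [m [U [U' [h1 h2 h3]]]] := fform_expand s s'.
pose q (F G : 'I_m -> H1) : C := \sum_j ip (F j) (G j).
have := @form_CauchySchwarz R ('I_m -> H1)%type q _ _ _ U U'.
rewrite /q -h1 -h2 -h3 !fnorm_sqr /= -exprMn ler_sqr ?nnegrE ?cn_ge0//; last first.
  by rewrite mulr_ge0 ?fnorm_ge0.
apply.
- move=> a u v w; rewrite mulr_sumr -big_split; apply: eq_bigr => j _ /=.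
  by rewrite -ipP.
- by move=> u v; rewrite rmorph_sum; apply: eq_bigr => j _; rewrite ipC.
- by move=> u; apply: sumr_ge0 => j _; exact: ip_ge0.
Qed.

(* The completion is realized by functions on families: the tensor T becomes
   the function s |-> <T, s>. *)
Definition fbound (c : R) (f : fam -> C^o) : Prop :=
  forall s, cn (f s) <= c * fnorm s.

Definition femb s : fam -> C^o := fun s' => fform s s'.

(** Membership is approximation by finite tensors in the dual norm, so that density of the tensors
    in the completion holds by construction. *)
Definition fspace (f : fam -> C^o) : Prop :=
  forall e : R, 0 < e -> exists s, fbound e (f - femb s).

Definition fnrm (f : fam -> C^o) : R := inf [set c | 0 <= c /\ fbound c f].

Lemma fboundD c d f h : fbound c f -> fbound d h -> fbound (c + d) (f + h).
Proof.
by move=> bf bh s; rewrite mulrDl (le_trans (cnD _ _))// lerD.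
Qed.

Lemma fboundZ a c f : fbound c f -> fbound (cn a * c) (a *: f).
Proof.
by move=> bf s; rewrite (cnM a (f s)) -mulrA ler_wpM2l ?cn_ge0//; exact: bf.
Qed.

Lemma fbound_emb s : fbound (fnorm s) (femb s).
Proof. by move=> s'; exact: fform_CauchySchwarz. Qed.

Lemma fspace_bounded f : fspace f -> exists2 c, 0 <= c & fbound c f.
Proof.
move=> /(_ 1 ltr01)[s hs]; exists (1 + fnorm s).
  by rewrite addr_ge0// fnorm_ge0.
by have := fboundD hs (fbound_emb s); rewrite subrK.
Qed.

Lemma fnrm_ge0 f : 0 <= fnrm f.
Proof.
(* Without admissible constant the infimum is over the empty set and equals 0; by [fspace_bounded]
   this does not occur on [fspace]. *)
rewrite /fnrm; set S := [set c | _].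
have [S0|S0] := pselect (S !=set0); first by apply: lb_le_inf => // c [].
by rewrite (_ : S = set0) ?inf0//; apply/seteqP; split=> // c Sc; case: S0; exists c.
Qed.

Lemma fnrm_le c f : 0 <= c -> fbound c f -> fnrm f <= c.
Proof. by move=> c0 bf; apply: ge_inf => //; exists 0 => d []. Qed.

Lemma fnrm_bound f : fspace f -> fbound (fnrm f) f.
Proof.
move=> /fspace_bounded[c c0 bc] s.
have [s0|sn0] := eqVneq (fnorm s) 0.
  by rewrite s0 mulr0; have := bc s; rewrite s0 mulr0.
have sp : 0 < fnorm s by rewrite lt_def sn0 fnorm_ge0.
rewrite -ler_pdivrMr//; apply: lb_le_inf; first by exists c.
by move=> d [d0 bd]; rewrite ler_pdivrMr.
Qed.

Lemma fspace_emb s : fspace (femb s).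
Proof.
move=> e e0; exists s => s'; rewrite subrr /= (_ : cn _ = 0).
  by rewrite mulr_ge0 ?fnorm_ge0 ?(ltW e0).
exact: nrm0.
Qed.

Lemma fembD s s' : femb (s ++ s') = femb s + femb s'.
Proof. by apply/funext => x; exact: fform_catl. Qed.

Lemma fembZ a s : femb (fscale a s) = a *: femb s.
Proof. by apply/funext => x; exact: fform_scalel. Qed.

Lemma femb0 : femb [::] = 0.
Proof. by apply/funext => x; rewrite /femb /fform big_nil. Qed.

Lemma fspaceL a f h : fspace f -> fspace h -> fspace (a *: f + h).
Proof.
move=> Sf Sh e e0; have a1 : 0 < cn a + 1 by rewrite ltr_wpDl ?cn_ge0.
have [s hs] := Sf _ (divr_gt0 e0 (mulr_gt0 (ltr0n R 2) a1)).
have [s' hs'] := Sh _ (divr_gt0 e0 (ltr0n R 2)).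
exists (fscale a s ++ s'); rewrite fembD fembZ opprD addrACA -scalerBr => x.
apply: (le_trans (fboundD (fboundZ a hs) hs' x)); rewrite ler_wpM2r ?fnorm_ge0//.
rewrite {3}(splitr e) lerD2r (_ : _ / _ = (e / 2) / (cn a + 1)); last first.
  by field; rewrite gt_eqF.
by rewrite mulrA ler_pdivrMr// mulrC ler_wpM2l ?lerDl// ltW// divr_gt0.
Qed.

Lemma fspace0 : fspace 0.
Proof. by rewrite -femb0; exact: fspace_emb. Qed.

Lemma fspaceB f h : fspace f -> fspace h -> fspace (f - h).
Proof. by move=> Sf Sh; rewrite addrC -scaleN1r; exact: fspaceL. Qed.

Lemma fnrmD f h : fspace f -> fspace h -> fnrm (f + h) <= fnrm f + fnrm h.
Proof.
move=> Sf Sh; apply: fnrm_le; first by rewrite addr_ge0 ?fnrm_ge0.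
by apply: fboundD; exact: fnrm_bound.
Qed.

Lemma fspaceZ a f : fspace f -> fspace (a *: f).
Proof. by move=> Sf; rewrite -[_ *: _]addr0; exact: (fspaceL _ Sf fspace0). Qed.

Lemma fnrmZ a f : fspace f -> fnrm (a *: f) = cn a * fnrm f.
Proof.
have le b g : fspace g -> fnrm (b *: g) <= cn b * fnrm g.
  move=> Sg; apply: fnrm_le; first by rewrite mulr_ge0 ?fnrm_ge0 ?cn_ge0.
  exact: fboundZ (fnrm_bound Sg).
move=> Sf; apply/eqP; rewrite eq_le le//=.
have [->|a0] := eqVneq a 0.
  by rewrite cn0 mul0r fnrm_ge0.
have cp : cn a * cn a^-1 = 1 by rewrite -cnM divff// cn1.
have := le a^-1 _ (fspaceZ a Sf); rewrite scalerA mulVf// scale1r => h.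
by have := ler_wpM2l (cn_ge0 a) h; rewrite mulrA cp mul1r.
Qed.

Lemma fnrm_eq0 f : fspace f -> fnrm f = 0 -> f = 0.
Proof.
move=> Sf f0; apply/funext => s.
have := fnrm_bound Sf s; rewrite f0 mul0r => le0.
apply: (@nrm_eq0 _ (C^o : normedModType C)).
by apply/eqP; rewrite eq_le le0 nrm_ge0.
Qed.

Lemma fnrm_emb s : fnrm (femb s) = fnorm s.
Proof.
apply/eqP; rewrite eq_le fnrm_le ?fnorm_ge0//=; last exact: fbound_emb.
have := fnrm_bound (fspace_emb s) s; rewrite /femb fnorm_sqr cnR.
rewrite ger0_norm ?sqr_ge0//.
by apply: sqr_le_mul; [exact: fnorm_ge0|exact: fnrm_ge0].
Qed.

Lemma fspace_complete (u : nat -> fam -> C^o) : (forall n, fspace (u n)) ->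
  (forall e : R, 0 < e -> exists M, forall m n, (M <= m)%N -> (M <= n)%N ->
     fnrm (u m - u n) < e) ->
  exists2 l, fspace l & forall e : R, 0 < e -> exists M, forall n, (M <= n)%N ->
     fnrm (u n - l) < e.
Proof.
move=> Su uC.
have ex s : exists l : C, forall e : R, 0 < e -> exists N, forall n, (N <= n)%N ->
     cn (u n s - l) < e.
  apply: complex_cauchy_cvg => e e0.
  have s1 : 0 < fnorm s + 1 by rewrite ltr_wpDl ?fnorm_ge0.
  have [M hM] := uC _ (divr_gt0 e0 s1); exists M => m n Mm Mn.
  rewrite (le_lt_trans (fnrm_bound (fspaceB (Su m) (Su n)) s))//.
  have := hM m n Mm Mn; rewrite ltr_pdivlMr//; apply: le_lt_trans.
  by rewrite ler_wpM2l ?fnrm_ge0// lerDl.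
have [l hl] := choice ex.
have ul (e : R) : 0 < e -> exists M, forall n, (M <= n)%N -> fbound e (u n - (l : fam -> C^o)).
  move=> e0; have [M hM] := uC e e0; exists M => n Mn s.
  apply/ler_addgt0Pl => d d0; have [N hN] := hl s d d0.
  (* The index k depends on s and d but disappears from the final estimate, so pointwise convergence
     becomes convergence in [fnrm]. *)
  pose k := maxn M N.
  rewrite (_ : (u n - (l : fam -> C^o)) s = (u n s - u k s) + (u k s - l s)); last first.
    by rewrite addrA subrK.
  rewrite (le_trans (cnD _ _))// addrC lerD//.
    by rewrite ltW// hN// leq_maxr.
  rewrite (le_trans (fnrm_bound (fspaceB (Su n) (Su k)) s))//.
  by rewrite ler_wpM2r ?fnorm_ge0// ltW// hM// leq_maxl.
exists l => e e0; have e2 : 0 < e / 2 by rewrite divr_gt0.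
  have [M hM] := ul _ e2; have [s hs] := Su M _ e2; exists s.
  have hM' : fbound (e / 2) ((l : fam -> C^o) - u M).
    move=> x; rewrite -opprB (_ : (- _) x = - ((u M - (l : fam -> C^o)) x))//.
    by rewrite cnN; exact: hM.
  have := fboundD hM' hs; rewrite -splitr addrA subrK//.
have [M hM] := ul _ e2; exists M => n Mn.
rewrite (@le_lt_trans _ _ (e / 2))// ?fnrm_le ?ltW//; first exact: hM.
by rewrite {2}(splitr e) ltrDl.
Qed.

Theorem hilbert_tensor_exists : exists (H : hilbert R) (t : H1 -> H2 -> H),
  is_hilbert_tensor t.
Proof.
have [V [i [li Pi Si Ni]]] := @subBanach_exists R (fam -> C^o) fspace fnrm
  fspace0 fspaceL fnrmD fnrmZ fnrm_eq0 fspace_complete.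
have iI : injective i.
  move=> x y xy; apply/subr0_eq/nrm_eq0; rewrite Ni (linB li) xy subrr.
  apply/eqP; rewrite eq_le fnrm_ge0 andbT fnrm_le// => s.
  by rewrite (_ : cn _ = 0) ?mul0r//; exact: nrm0.
have [k hk] := choice (fun s => Si _ (fspace_emb s)).
have knrm s : nrm (k s) = fnorm s by rewrite Ni hk fnrm_emb.
pose S := [set v | exists s, v = k s].
have kD s s' : k (s ++ s') = k s + k s'.
  by apply: iI; rewrite (linD li) !hk fembD.
have kZ a s : k (fscale a s) = a *: k s.
  by apply: iI; rewrite (linZ li) !hk fembZ.
have SP : is_subspace S.
  split; first by exists [::]; apply: iI; rewrite (lin0 li) hk femb0.
  by move=> a _ _ [s ->] [s' ->]; exists (fscale a s ++ s'); rewrite kD kZ.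
have Sd : ndense S.
  move=> x e e0; have e2 : 0 < e / 2 by rewrite divr_gt0.
  have [s hs] := Pi x _ e2; exists (k s); first by exists s.
  rewrite Ni (linB li) hk (@le_lt_trans _ _ (e / 2))// ?fnrm_le ?ltW//.
  by rewrite {2}(splitr e) ltrDl.
(* The form needs a family representing its second argument. The choice is immaterial: [fform] s s'
   is the conjugate of the value at s of the function attached to s', as used in [BE]. *)
have [sg hsg] : exists sg : V -> fam, forall v, S v -> v = k (sg v).
  have ex v : exists s, S v -> v = k s.
    by have [[s ->]|nS] := pselect (S v); [exists s|exists [::]].
  by have [sg hsg] := choice ex; exists sg.
pose B (v w : V) : C := i v (sg w).
have BE s s' : B (k s) (k s') = fform s s'.
  have ks' : k s' = k (sg (k s')) by apply: hsg; exists s'.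
  rewrite /B hk /femb fformC [RHS]fformC; congr (_^*).
  have := congr1 (fun v => i v s) ks'; rewrite /= !hk /femb => <-//.
have [|||q [qP qC qN qB]] := @hilbert_from_form R V S B SP Sd.
- by move=> a u v w [s ->] [s' ->] [s'' ->];
    rewrite -kZ -kD !BE fform_catl fform_scalel.
- by move=> u v [s ->] [s' ->]; rewrite !BE fformC.
- by move=> u [s ->]; rewrite BE fnorm_sqr nrmE knrm rmorphXn.
pose H := @Hilbert R V q qP qC qN.
pose t (u : H1) (v : H2) : H := k [:: (u, v)].
have f1 u v u' v' : fform [:: (u, v)] [:: (u', v')] = ip u u' * ip v v'.
  by rewrite /fform !big_seq1.
have f1l u v s : fform [:: (u, v)] s = \sum_(y <- s) ip u y.1 * ip v y.2.
  by rewrite /fform big_seq1.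
exists H, t; split.
- split=> [v a x y|u a x y]; apply: iI; rewrite li !hk; apply/funext => s.
  + change (fform [:: (a *: x + y, v)] s =
      a * fform [:: (x, v)] s + fform [:: (y, v)] s).
    rewrite !f1l mulr_sumr -big_split; apply: eq_bigr => z _ /=.
    by rewrite ipP; ring.
  + change (fform [:: (u, a *: x + y)] s =
      a * fform [:: (u, x)] s + fform [:: (u, y)] s).
    rewrite !f1l mulr_sumr -big_split; apply: eq_bigr => z _ /=.
    by rewrite ipP; ring.
- move=> u v u' v'; rewrite -f1 -BE; apply: qB; [by exists [:: (u, v)]|].
  by exists [:: (u', v')].
- apply/ndenseP => x e e0; have [_ [s ->] xs] := Sd x e e0.
  exists (k s) => //.
  have h : is_subspace (finsums [set w : H | exists u v, w = t u v]).
    apply: finsums_subspace => a _ [u [v ->]].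
    by exists (a *: u), v; rewrite /t -kZ.
  elim: s {xs} => [|[u v] s IH].
    by rewrite (_ : k [::] = 0); [case: h|apply: iI; rewrite (lin0 li) hk femb0].
  rewrite -cat1s kD; apply: (subspaceD h) => //.
  by apply: finsums_sub; exists u, v.
Qed.

End HilbertTensorExists.

(** * The minimal tensor norm *)

Section CStarBasics.
Variable R : realType.
Local Notation C := R[i].

(** Taking 2^n-th roots removes the constant c. In place of roots, Bernoulli's inequality shows that
    the powers of x / y would be unbounded if y < x. *)
Lemma le_of_pow2 (x y c : R) : 0 <= x -> 0 <= y ->
  (forall n, x ^+ (2 ^ n) <= c * y ^+ (2 ^ n)) -> x <= y.
Proof.
move=> x0 y0 h; rewrite leNgt; apply/negP => yx.
have xp : 0 < x by exact: le_lt_trans yx.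
have [y00|yn0] := eqVneq y 0.
  by have := h 0%N; rewrite y00 expn0 !expr1 mulr0 leNgt xp.
have yp : 0 < y by rewrite lt_def yn0.
pose d := x / y - 1.
have dp : 0 < d by rewrite subr_gt0 ltr_pdivlMr// mul1r.
have bern n : 1 + n%:R * d <= (1 + d) ^+ n.
  elim: n => [|n IH]; first by rewrite mul0r addr0 expr0.
  rewrite exprS (le_trans _ (ler_wpM2l _ IH))//; last by rewrite addr_ge0// ltW.
  rewrite -natr1; have : 0 <= (n%:R : R) by []; nra.
have hc n : n%:R * d <= c.
  have [m hm] : exists m, (n <= 2 ^ m)%N by exists n; rewrite ltnW// ltn_expl.
  have := h m; rewrite -ler_pdivrMr ?exprn_gt0// -expr_div_n.
  rewrite (_ : x / y = 1 + d); last by rewrite /d addrC subrK.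
  move=> /(le_trans (bern _)) h1.
  have : n%:R * d <= (2 ^ m)%:R * d by rewrite ler_pM2r// ler_nat.
  move: h1; move: ((2 ^ m)%:R * d) => z; lra.
have := hc (Num.truncn (c / d)).+1.
rewrite -ler_pdivlMr// leNgt truncnS_gt//.
Qed.

Section OneAlgebra.
Variable A : cstarAlg R.
Implicit Types x y : A.

Lemma cs_linl y : linear (@cs_mul _ A ^~ y). Proof. exact: (cs_mul_bilin A).1. Qed.
Lemma cs_linr x : linear (@cs_mul _ A x). Proof. exact: (cs_mul_bilin A).2. Qed.

Lemma cs_star0 : cs_star (0 : A) = 0.
Proof.
by have := cs_starP (-1) (0 : A) 0; rewrite scaler0 addr0 rmorphN1 scaleN1r addNr.
Qed.
Lemma cs_starD x y : cs_star (x + y) = cs_star x + cs_star y.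
Proof. by have := cs_starP 1 x y; rewrite rmorph1 !scale1r. Qed.
Lemma cs_starZ (a : C) x : cs_star (a *: x) = a^* *: cs_star x.
Proof. by have := cs_starP a x 0; rewrite cs_star0 !addr0. Qed.
Lemma cs_starB x y : cs_star (x - y) = cs_star x - cs_star y.
Proof. by rewrite cs_starD -scaleN1r cs_starZ rmorphN1 scaleN1r. Qed.
Lemma cs_star_sum (I : Type) (s : seq I) (P : pred I) (F : I -> A) :
  cs_star (\sum_(i <- s | P i) F i) = \sum_(i <- s | P i) cs_star (F i).
Proof. by elim/big_rec2: _ => [|i x y _ <-]; rewrite ?cs_star0 ?cs_starD. Qed.

Lemma cs_nrm_star x : nrm (cs_star x) = nrm x.
Proof.
have le z : nrm z <= nrm (cs_star z).
  have := cs_normM (cs_star z) z; rewrite cs_normC.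
  by apply: sqr_le_mul; exact: nrm_ge0.
by apply/eqP; rewrite eq_le le andbT -{2}[x]cs_starK le.
Qed.

(** The power y^(2^n). Repeated squaring is the form in which the C*-identity gives the norms of
    powers of a self-adjoint element. *)
Fixpoint cs_pow2 (y : A) (n : nat) : A :=
  if n is m.+1 then cs_mul (cs_pow2 y m) (cs_pow2 y m) else y.

Lemma cs_pow2_star y n : cs_star y = y -> cs_star (cs_pow2 y n) = cs_pow2 y n.
Proof. by move=> ys; elim: n => //= n IH; rewrite cs_starM IH. Qed.

Lemma cs_pow2_nrm y n : cs_star y = y -> nrm (cs_pow2 y n) = nrm y ^+ (2 ^ n).
Proof.
move=> ys; elim: n => [|n IH] /=; first by rewrite expr1.
by rewrite -{1}cs_pow2_star// cs_normC IH -exprM expnSr.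
Qed.

Lemma cs_starM_self x : cs_star (cs_mul (cs_star x) x) = cs_mul (cs_star x) x.
Proof. by rewrite cs_starM cs_starK. Qed.

Lemma star_rep_linr (H : hilbert R) (r : A -> H -> H) x :
  is_star_rep r -> linear (r x).
Proof. by case=> -[_ h] _ _ _; exact: h. Qed.
Lemma star_rep_linl (H : hilbert R) (r : A -> H -> H) u :
  is_star_rep r -> linear (r^~ u).
Proof. by case=> -[h _] _ _ _; exact: h. Qed.

(** For self-adjoint y put s n = |r(y^(2^n)) u|. Cauchy-Schwarz gives (s n)^2 <= s (n + 1) |u|,
    hence (s 0)^(2^n) is at most c |y|^(2^n) |u|^(2^n), and [le_of_pow2] drops c. The general case
    follows from |r(x) u|^2 = <r(x^* x) u, u>. *)
Lemma star_rep_contractive (H : hilbert R) (r : A -> H -> H) x :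
  is_star_rep r -> opbound (r x) (nrm x).
Proof.
move=> [_ [c hc] rM rS].
have sa y u : cs_star y = y -> nrm (r y u) <= nrm y * nrm u.
  move=> ys; pose s n := nrm (r (cs_pow2 y n) u).
  have s0 n : 0 <= s n by exact: nrm_ge0.
  have sS n : s n ^+ 2 <= s n.+1 * nrm u.
    have := ip_CauchySchwarz (r (cs_pow2 y n.+1) u) u.
    rewrite -/(s n.+1) /= rM -{1}cs_pow2_star// rS ipE cnR ger0_norm//.
    exact: sqr_ge0.
  have sn n : s 0%N ^+ (2 ^ n) * nrm u <= s n * nrm u ^+ (2 ^ n).
    elim: n => [|n IH]; first by rewrite !expr1.
    have := nrm_ge0 u; rewrite le_eqVlt => /predU1P[u0|up].
      by rewrite -u0 mulr0 mulr_ge0// exprn_ge0.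
    rewrite -(ler_pM2r up).
    apply: (@le_trans _ _ ((s n * nrm u ^+ (2 ^ n)) ^+ 2)).
      rewrite -mulrA -expr2 expnSr exprM -exprMn ler_sqr ?nnegrE//.
      by rewrite mulr_ge0 ?exprn_ge0 ?nrm_ge0.
      by rewrite mulr_ge0 ?exprn_ge0 ?nrm_ge0.
    by rewrite exprMn -exprM -expnSr [leRHS]mulrAC ler_wpM2r ?exprn_ge0 ?nrm_ge0.
  have [u0|un0] := eqVneq (nrm u) 0.
    by rewrite (nrm_eq0 u0) (_ : r y 0 = 0) ?nrm0 ?mulr0//; apply: nrm_eq0;
      apply/eqP; rewrite eq_le nrm_ge0 andbT; have := hc y 0; rewrite nrm0 mulr0.
  have up : 0 < nrm u by rewrite lt_def un0 nrm_ge0.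
  apply: (@le_of_pow2 _ _ c) => [||n]; rewrite ?mulr_ge0 ?nrm_ge0//.
  rewrite -(ler_pM2r up) (le_trans (sn n))// exprMn -cs_pow2_nrm//.
  rewrite mulrA [leRHS]mulrAC ler_wpM2r ?exprn_ge0 ?nrm_ge0//; exact: hc.
move=> u; rewrite -ler_sqr ?nnegrE ?mulr_ge0 ?nrm_ge0//.
have -> : nrm (r x u) ^+ 2 = cn (ip (r (cs_mul (cs_star x) x) u) u).
  by rewrite rM rS ipE cnR ger0_norm ?sqr_ge0.
rewrite (le_trans (ip_CauchySchwarz _ _))// exprMn [nrm u ^+ 2]expr2 mulrA.
by rewrite ler_wpM2r ?nrm_ge0// -cs_normC sa// cs_starM_self.
Qed.

End OneAlgebra.

Lemma starHom_contractive (A B : cstarAlg R) (f : starHom A B) x :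
  nrm (f x) <= nrm x.
Proof.
have [c hc] := sh_bounded f.
have sa y : cs_star y = y -> nrm (f y) <= nrm y.
  move=> ys; apply: (@le_of_pow2 _ _ c) => [||n]; rewrite ?nrm_ge0//.
  have fp : cs_pow2 (f y) n = f (cs_pow2 y n).
    by elim: n => //= n ->; rewrite sh_mul.
  by rewrite -!cs_pow2_nrm// ?fp -?sh_star ?ys//; exact: hc.
rewrite -ler_sqr ?nnegrE ?nrm_ge0// -!cs_normC -sh_star -sh_mul.
by rewrite sa// cs_starM_self.
Qed.

Lemma opnorm_exists (V W : normedModType C) (f : V -> W) c :
  opbound f c -> exists c', is_opnorm f c'.
Proof.
move=> bc; pose S : set R := [set c0 | 0 <= c0 /\ opbound f c0].
have S0 : S `|c|.
  by split=> // x; rewrite (le_trans (bc x))// ler_wpM2r ?nrm_ge0 ?ler_norm.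
have Sl : has_lbound S by exists 0 => d [].
exists (inf S); split.
- by apply: lb_le_inf; [exists `|c| | move=> d []].
- move=> x; have [x0|xn0] := eqVneq (nrm x) 0.
    by rewrite x0 mulr0; have := bc x; rewrite x0 mulr0.
  have xp : 0 < nrm x by rewrite lt_def xn0 nrm_ge0.
  rewrite -ler_pdivrMr//; apply: lb_le_inf; first by exists `|c|.
  by move=> d [_ bd]; rewrite ler_pdivrMr.
- by move=> d d0 bd; apply: ge_inf.
Qed.

Lemma opbound_le (V W : normedModType C) (f : V -> W) c d :
  c <= d -> opbound f c -> opbound f d.
Proof. by move=> cd bc x; rewrite (le_trans (bc x))// ler_wpM2r ?nrm_ge0. Qed.

End CStarBasics.

Section MatrixBound.
Variable R : realType.
Local Notation C := R[i].
Variables (A : cstarAlg R) (H0 : hilbert R) (K : cstarAlg R) (r : K -> H0 -> H0).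
Hypothesis hK : is_compact_algebra r.

(* [c] bounds the norms of all finite compressions of \sum_i r1 (a i) (x) r (k i),
   as operator matrices over H1. *)
Definition matrix_bound (H1 : hilbert R) (r1 : A -> H1 -> H1) n
    (a : 'I_n -> A) (k : 'I_n -> K) (c : R) : Prop :=
  forall m (e : 'I_m -> H0) (u : 'I_m -> H1), orthonormal e ->
    \sum_x nrm (\sum_y \sum_i ip (r (k i) (e y)) (e x) *: r1 (a i) (u y)) ^+ 2 <=
    c ^+ 2 * \sum_y nrm (u y) ^+ 2.

(** On the corner spanned by the matrix units of e, the representation r2 is a multiple of the
    identical one. In the orthonormal system [zeta] the operator splits into blocks indexed by l,
    each being the matrix bounded by [matrix_bound]. *)
Lemma finite_part_bound (H1 : hilbert R) (r1 : A -> H1 -> H1)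
    (H2 : hilbert R) (r2 : K -> H2 -> H2) (H : hilbert R) (t : H1 -> H2 -> H)
    (th : H0 -> H0 -> K) n (a : 'I_n -> A) (k : 'I_n -> K) (c : R)
    m (e : 'I_m -> H0) p (u : 'I_p -> H1) (v : 'I_p -> H2) :
  (forall xi eta w, r (th xi eta) w = ip w eta *: xi) ->
  is_star_rep r1 -> is_star_rep r2 -> is_hilbert_tensor t ->
  0 <= c -> matrix_bound r1 a k c -> orthonormal e ->
  nrm (\sum_s \sum_i t (r1 (a i) (u s)) (r2 (finite_part r th e (k i)) (v s))) <=
    c * nrm (\sum_s t (u s) (v s)).
Proof.
(* With m = 0 there is no vector to serve as g below, but then the finite parts vanish. *)
move=> thE h1 h2 ht c0 mb; case: m e => [|m] e oe.
  rewrite big1 ?nrm0 ?mulr_ge0 ?nrm_ge0// => s _; apply: big1 => i _.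
  by rewrite /finite_part big_ord0 (lin0 (star_rep_linl _ h2)) (lin0 (tenr ht _)).
have r2M := let: And4 _ _ h _ := h2 in h.
have r2S := let: And4 _ _ _ h := h2 in h.
pose g := e ord0.
have gg : ip g g = 1 by rewrite oe eqxx.
pose x (z : 'I_p * 'I_m.+1) := r2 (th g (e z.2)) (v z.1).
(* The range of the projection r2 (th g g). The partial isometries r2 (th (e y) g) carry it onto
   mutually orthogonal copies of itself. *)
pose P := [set w : H2 | r2 (th g g) w = w].
have SP : is_subspace P.
  split; first by rewrite /P /= (lin0 (star_rep_linr _ h2)).
  by move=> b y z /= hy hz; rewrite /P /= (star_rep_linr _ h2) hy hz.
have Px z : P (x z).
  by rewrite /P /= /x -r2M (thetaM hK thE) gg scale1r.
have [q [eta [oeta Peta xE]]] := GramSchmidt SP Px.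
pose d z l := ip (x z) (eta l).
(* On this system r2 (th (e y) (e y')) sends zeta (y', l) to zeta (y, l): a matrix unit in the first
   index, the identity in the second. *)
pose zeta (z : 'I_m.+1 * 'I_q) := r2 (th (e z.1) g) (eta z.2).
have ozeta : orthonormal zeta.
  move=> [y l] [y' l']; rewrite /zeta /= -r2S (theta_star hK thE).
  rewrite -r2M (thetaM hK thE) oe.
  by rewrite (linZ (star_rep_linl _ h2)) Peta ipZl oeta -natrM mulnb.
have thx (y : 'I_m.+1) s y' :
    r2 (th (e y) (e y')) (v s) = \sum_l d (s, y') l *: zeta (y, l).
  have -> : th (e y) (e y') = cs_mul (th (e y) g) (th g (e y')).
    by rewrite (thetaM hK thE) gg scale1r.
  rewrite r2M -/(x (s, y')) xE (linsum (star_rep_linr _ h2)).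
  by apply: eq_bigr => l _; rewrite (linZ (star_rep_linr _ h2)).
pose xi (y : 'I_m.+1) l : H1 := \sum_s d (s, y) l *: u s.
pose co i y y' : C := ip (r (k i) (e y')) (e y).
have kE i s : r2 (finite_part r th e (k i)) (v s) =
    \sum_z (\sum_y co i z.1 y * d (s, y) z.2) *: zeta z.
  rewrite (star_rep_sum _ _ _ _ h2) -(pair_bigA _
    (fun y l => (\sum_y' co i y y' * d (s, y') l) *: zeta (y, l))) /=.
  apply: eq_bigr => y _; rewrite (star_rep_sum _ _ _ _ h2).
  transitivity (\sum_y' \sum_l (co i y y' * d (s, y') l) *: zeta (y, l)).
    apply: eq_bigr => y' _; rewrite (linZ (star_rep_linl _ h2)) thx scaler_sumr.
    by apply: eq_bigr => l _; rewrite scalerA.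
  by rewrite exchange_big /=; apply: eq_bigr => l _; rewrite scaler_suml.
have lhsE : \sum_s \sum_i t (r1 (a i) (u s)) (r2 (finite_part r th e (k i)) (v s))
   = \sum_z t (\sum_y \sum_i co i z.1 y *: r1 (a i) (xi y z.2)) (zeta z).
  rewrite (pair_bigA _ (fun s i =>
    t (r1 (a i) (u s)) (r2 (finite_part r th e (k i)) (v s)))) /=.
  rewrite (@ten_expand _ _ _ _ _ ht _ _ _ _ zeta
    (fun si z => \sum_y co si.2 z.1 y * d (si.1, y) z.2)); last first.
    by move=> si; exact: kE.
  apply: eq_bigr => z _; congr (t _ _).
  rewrite -(pair_bigA _ (fun s i =>
     (\sum_y co i z.1 y * d (s, y) z.2) *: r1 (a i) (u s))) /=.
  under eq_bigr => s _ do under eq_bigr => i _ do rewrite scaler_suml.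
  under eq_bigr => s _ do rewrite exchange_big /=.
  rewrite exchange_big /=; apply: eq_bigr => y _.
  rewrite exchange_big /=; apply: eq_bigr => i _.
  rewrite /xi (linsum (star_rep_linr _ h1)) scaler_sumr.
  by apply: eq_bigr => s _; rewrite (linZ (star_rep_linr _ h1)) scalerA.
(* Only the part r2 Q (v s) of v s lies in the span of [zeta]. Since r2 Q is a contraction, passing
   to it does not increase the norm of the tensor. *)
pose Q : K := \sum_y th (e y) (e y).
have nQ : opbound (r2 Q) 1.
  apply: opbound_le (star_rep_contractive Q h2).
  apply: (ka_norm hK) => // w; rewrite mul1r (star_rep_sum _ _ _ _ (ka_rep hK)).
  rewrite (_ : \sum_i _ = oproj e w); first exact: nrm_oproj.
  by apply: eq_bigr => y _; rewrite thE.
have QE : \sum_s t (u s) (r2 Q (v s)) = \sum_z t (xi z.1 z.2) (zeta z).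
  rewrite (@ten_expand _ _ _ _ _ ht _ _ _ _ zeta (fun s z => d (s, z.1) z.2))//.
  move=> s; rewrite (star_rep_sum _ _ _ _ h2).
  rewrite -(pair_bigA _ (fun y l => d (s, y) l *: zeta (y, l))) /=.
  by apply: eq_bigr => y _; rewrite thx.
have := ten_amplifyr ht u v (star_rep_linr Q h2) ler01 nQ.
rewrite mul1r QE lhsE -ler_sqr ?nnegrE ?nrm_ge0// (ten_orthonormal_nrm ht)// => hq.
rewrite -(ler_sqr (x := nrm _)) ?nnegrE ?mulr_ge0 ?nrm_ge0//.
rewrite (ten_orthonormal_nrm ht)// exprMn.
apply: (@le_trans _ _ (c ^+ 2 * \sum_z nrm (xi z.1 z.2) ^+ 2)); last first.
  by rewrite ler_wpM2l// sqr_ge0.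
rewrite -(pair_bigA _ (fun y l =>
  nrm (\sum_y' \sum_i co i y y' *: r1 (a i) (xi y' l)) ^+ 2)) /=.
rewrite -(pair_bigA _ (fun y l => nrm (xi y l) ^+ 2)) /= [leLHS]exchange_big /=.
rewrite [in leRHS]exchange_big mulr_sumr /= ler_sum// => l _.
exact: (mb m.+1 e (fun y => xi y l)).
Qed.

(** The bound involves r1 and the identical representation of K but not r2: finite parts are dense
    and [finite_part_bound] holds for every r2. The bound c' serves only to pass from finite tensors
    to all vectors. *)
Lemma ten_rep_bound (H1 : hilbert R) (r1 : A -> H1 -> H1)
    (H2 : hilbert R) (r2 : K -> H2 -> H2) (H : hilbert R) (t : H1 -> H2 -> H)
    (f : H -> H) n (a : 'I_n -> A) (k : 'I_n -> K) (c c' : R) :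
  is_star_rep r1 -> is_star_rep r2 -> is_hilbert_tensor t ->
  linear f -> (forall u v, f (t u v) = \sum_i t (r1 (a i) u) (r2 (k i) v)) ->
  opbound f c' -> 0 <= c -> matrix_bound r1 a k c -> opbound f c.
Proof.
move=> h1 h2 ht lf fE bf c0 mb.
have [th thE] := theta_exists hK.
have main p (u : 'I_p -> H1) (v : 'I_p -> H2) :
    nrm (f (\sum_s t (u s) (v s))) <= c * nrm (\sum_s t (u s) (v s)).
  apply/ler_addgt0Pl => eps eps0; set w := \sum_s t (u s) (v s).
  (* Compressing each k i up to eps / M changes the image of w by at most (\sum_i |a i|) (eps / M)
     |w| <= eps. *)
  pose M := (\sum_i nrm (a i) + 1) * (nrm w + 1).
  have a1 : 0 < \sum_i nrm (a i) + 1.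
    by rewrite ltr_wpDl ?sumr_ge0// => i _; exact: nrm_ge0.
  have w1 : 0 < nrm w + 1 by rewrite ltr_wpDl ?nrm_ge0.
  have M0 : 0 < M by rewrite mulr_gt0.
  have [m [e [oe he]]] := finite_part_approx hK thE k (divr_gt0 eps0 M0).
  have bnd := finite_part_bound u v thE h1 h2 ht c0 mb oe.
  set w' := \sum_s \sum_i t _ _ in bnd.
  rewrite (le_trans (nrm_le_dist _ w'))// lerD//.
  rewrite (linsum lf) -sumrB.
  under eq_bigr => s _.
    rewrite fE -sumrB.
    under eq_bigr => i _ do
      rewrite -(linB (tenr ht _)) -(linB (star_rep_linl _ h2)).
    over.
  rewrite exchange_big /= (le_trans (nrm_sum _ _ _))//.
  apply: (@le_trans _ _ (\sum_i nrm (a i) * (eps / M * nrm w))).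
    apply: ler_sum => i _.
    apply: (le_trans (ten_amplify ht _ _ (star_rep_linr _ h1) (nrm_ge0 _)
      (star_rep_contractive _ h1))).
    rewrite ler_wpM2l ?nrm_ge0//.
    apply: (le_trans (ten_amplifyr ht _ _ (star_rep_linr _ h2) (nrm_ge0 _)
      (star_rep_contractive _ h2))).
    by rewrite ler_wpM2r ?nrm_ge0.
  rewrite -mulr_suml.
  have -> : (\sum_i nrm (a i)) * (eps / M * nrm w) =
     eps * (((\sum_i nrm (a i)) / (\sum_i nrm (a i) + 1)) * (nrm w / (nrm w + 1))).
    by rewrite /M; field; rewrite !gt_eqF.
  rewrite ler_piMr ?(ltW eps0)// mulr_ile1 ?divr_ge0 ?nrm_ge0 ?(ltW a1) ?(ltW w1)//.
  - by rewrite sumr_ge0// => i _; exact: nrm_ge0.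
  - by rewrite ler_pdivrMr// mul1r lerDl.
  - by rewrite ler_pdivrMr// mul1r lerDl.
move=> x; apply/ler_addgt0Pl => eps eps0.
(* Replacing x by w costs |c'| |x - w| in the norm of f x and c |x - w| in the bound c |w|. *)
have c1 : 0 < `|c'| + c + 1 by rewrite ltr_wpDl// addr_ge0.
have [_ [p [u [v ->]]]] := ten_dense ht x (divr_gt0 eps0 c1).
set w := \sum_s _ => xw; rewrite ltr_pdivlMr// in xw.
have h := main p u v; rewrite -/w in h.
have fx : nrm (f x) <= `|c'| * nrm (x - w) + nrm (f w).
  rewrite (le_trans (nrm_le_dist _ (f w)))// lerD2r -(linB lf).
  by rewrite (le_trans (bf _))// ler_wpM2r ?nrm_ge0// ler_norm.
have wx : nrm w <= nrm (x - w) + nrm x.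
  by rewrite nrmB nrm_le_dist.
have := ler_wpM2l c0 wx.
have := nrm_ge0 (x - w).
move: (nrm (x - w)) (nrm w) (nrm x) (nrm (f x)) (nrm (f w)) (`|c'|) xw h fx => *; nra.
Qed.

Variables (D : cstarAlg R) (t : A -> K -> D).
Hypothesis hD : is_cstar_tensor t.

Lemma cstar_tensor_norm_le n (a : 'I_n -> A) (k : 'I_n -> K) (c : R) :
  0 <= c ->
  (forall (H1 : hilbert R) (r1 : A -> H1 -> H1), is_star_rep r1 ->
     matrix_bound r1 a k c) ->
  nrm (\sum_i t (a i) (k i)) <= c.
Proof.
move=> c0 h; case: hD => _ _ _ _ /(_ n a k)[_]; apply.
move=> d [H1 [r1 [H2 [r2 [H [t' [f [h1 h2 ht [lf fE] [d0 bd dm]]]]]]]]].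
by apply: dm => //; exact: (ten_rep_bound h1 h2 ht lf fE bd c0 (h _ _ h1)).
Qed.

(** Converse of [cstar_tensor_norm_le]: the pair of r1 with the identical representation takes part
    in the supremum, and the matrix is a compression of the resulting operator. *)
Lemma cstar_tensor_matrix_bound n (a : 'I_n -> A) (k : 'I_n -> K)
    (H1 : hilbert R) (r1 : A -> H1 -> H1) : is_star_rep r1 ->
  matrix_bound r1 a k (nrm (\sum_i t (a i) (k i))).
Proof.
move=> h1; have [H [t' ht']] := hilbert_tensor_exists H1 H0.
have [||||||f [lf bf fE]] := ten_op_exists ht' (S := fun i => r1 (a i))
    (T := fun i => r (k i)) (c := fun i => nrm (a i)) (d := fun i => nrm (k i)).
- by move=> i; exact: star_rep_linr.
- by move=> i; exact: (ka_lin hK).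
- by move=> i; exact: nrm_ge0.
- by move=> i; exact: nrm_ge0.
- by move=> i; exact: star_rep_contractive.
- by move=> i; exact: (ka_bound hK).
have [c hc] := opnorm_exists bf.
have cle : c <= nrm (\sum_i t (a i) (k i)).
  case: hD => _ _ _ _ /(_ n a k)[ub _]; apply: ub.
  exists H1, r1, H0, r, H, t', f; split=> //; exact: ka_rep.
set N := nrm _ in cle *.
have c0 : 0 <= c by case: hc.
have bN : opbound f N by apply: opbound_le cle _; case: hc.
move=> m e u oe.
pose y x : H1 := \sum_y \sum_i ip (r (k i) (e y)) (e x) *: r1 (a i) (u y).
pose w : H := \sum_y t' (u y) (e y).
pose z : H := \sum_x t' (y x) (e x).
have N0 : 0 <= N by exact: nrm_ge0.
(* z is the projection of f w onto H1 (x) span e, so its norm is at most that of f w. *)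
have fz : ip (f w) z = ip z z.
  rewrite {2}/z (ten_orthonormal ht')// /z ip_sumr; apply: eq_bigr => x _.
  rewrite (linsum lf) ip_suml {2}/y ip_suml; apply: eq_bigr => l _.
  rewrite fE !ip_suml; apply: eq_bigr => i _.
  by rewrite (ten_ip ht') ipZl mulrC.
have nz : nrm z ^+ 2 = \sum_x nrm (y x) ^+ 2 by rewrite (ten_orthonormal_nrm ht').
have nw : nrm w ^+ 2 = \sum_y nrm (u y) ^+ 2 by rewrite (ten_orthonormal_nrm ht').
rewrite -/(y _) -nw (eq_bigr (fun x => nrm (y x) ^+ 2))// -nz -exprMn.
rewrite ler_sqr ?nnegrE ?mulr_ge0 ?nrm_ge0// (le_trans _ (bN w))//.
have := ip_CauchySchwarz (f w) z; rewrite fz ipE cnR ger0_norm ?sqr_ge0//.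
by apply: sqr_le_mul; exact: nrm_ge0.
Qed.

End MatrixBound.

Section Closures.
Variable R : realType.
Local Notation C := R[i].

Lemma ncl_sub (V : normedModType C) (S : set V) x : S x -> ncl S x.
Proof. by move=> Sx e e0; exists x => //; rewrite subrr nrm0. Qed.

Lemma ncl_ncl (V : normedModType C) (S : set V) x : ncl (ncl S) x -> ncl S x.
Proof.
move=> h e e0; have e2 : 0 < e / 2 by rewrite divr_gt0.
have [y hy xy] := h _ e2; have [z Sz yz] := hy _ e2; exists z => //.
by rewrite (le_lt_trans (nrmBt y _ _))// (splitr e) ltrD.
Qed.

Lemma ncl_mono (V : normedModType C) (S T : set V) : S `<=` T -> ncl S `<=` ncl T.
Proof. by move=> ST x h e e0; have [s /ST Ts xs] := h e e0; exists s. Qed.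

Lemma ncl_map (V W : normedModType C) (f : V -> W) (c : R) (S : set V) x :
  (forall y, nrm (f x - f y) <= c * nrm (x - y)) ->
  ncl S x -> ncl (f @` S) (f x).
Proof.
move=> fc h e e0; have c1 : 0 < `|c| + 1 by rewrite ltr_wpDl.
have [s Ss xs] := h _ (divr_gt0 e0 c1); exists (f s); first by exists s.
rewrite (le_lt_trans (fc _))//; move: xs; rewrite ltr_pdivlMr//.
apply: le_lt_trans; rewrite mulrC ler_wpM2l ?nrm_ge0//.
by rewrite (le_trans (ler_norm c))// lerDl.
Qed.

Lemma ncl_mapS (V W : normedModType C) (f : V -> W) (c : R) (S : set V)
    (T : set W) x : (forall y, nrm (f x - f y) <= c * nrm (x - y)) ->
  (forall s, S s -> T (f s)) -> ncl S x -> ncl T (f x).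
Proof.
move=> fc ST h; apply: ncl_mono (ncl_map fc h) => _ [s Ss <-]; exact: ST.
Qed.

Lemma ncl_subspace (V : normedModType C) (S : set V) :
  is_subspace S -> is_subspace (ncl S).
Proof.
move=> SP; split; first by apply: ncl_sub; case: SP.
move=> a x y hx hy e e0; have a1 : 0 < cn a + 1 by rewrite ltr_wpDl ?cn_ge0.
have e2 : 0 < e / 2 by rewrite divr_gt0.
have [s Ss xs] := hx _ (divr_gt0 e2 a1); have [s' Ss' ys'] := hy _ e2.
exists (a *: s + s'); first by case: SP => _; apply.
rewrite opprD addrACA -scalerBr (le_lt_trans (nrmD _ _))// (splitr e) ltr_leD//.
  rewrite nrmZ; move: xs; rewrite ltr_pdivlMr//; apply: le_lt_trans.
  by rewrite mulrC ler_wpM2l ?nrm_ge0// lerDl.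
exact: ltW.
Qed.

Lemma ncl_closed (V : normedModType C) (S : set V) (u : nat -> V) l :
  (forall n, ncl S (u n)) -> tends u l -> ncl S l.
Proof.
move=> hu ul; apply: ncl_ncl => e e0; have [N hN] := ul e e0.
by exists (u N) => //; rewrite nrmB hN.
Qed.

Lemma tends_mul (A : cstarAlg R) (u v : nat -> A) x y :
  tends u x -> tends v y -> tends (fun n => cs_mul (u n) (v n)) (cs_mul x y).
Proof.
move=> ux vy e e0.
pose M := nrm x + nrm y + 1.
have M0 : 0 < M by rewrite ltr_wpDl// addr_ge0 ?nrm_ge0.
(* The minimum with 1 gives |u n| <= 1 + |x|, so the error is at most M times e / (2 M). *)
have d0 : 0 < Num.min 1 (e / (2 * M)).
  by rewrite lt_min ltr01 divr_gt0// mulr_gt0.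
have [N hN] := ux _ d0; have [N' hN'] := vy _ d0.
exists (maxn N N') => n; rewrite geq_max => /andP[/hN + /hN'].
rewrite !lt_min => /andP[h1 h2] /andP[_ h3].
have -> : cs_mul (u n) (v n) - cs_mul x y =
    cs_mul (u n) (v n - y) + cs_mul (u n - x) y.
  by rewrite (linB (cs_linr _)) (linB (cs_linl _)) addrA subrK.
rewrite (le_lt_trans (nrmD _ _))//.
have := cs_normM (u n) (v n - y); have := cs_normM (u n - x) y.
have un : nrm (u n) <= 1 + nrm x.
  by rewrite (le_trans (nrm_le_dist _ x))// lerD2r ltW.
have := nrm_ge0 (v n - y); have := nrm_ge0 (u n - x).
have := nrm_ge0 x; have := nrm_ge0 y.
move: h2 h3; rewrite !ltr_pdivlMr ?mulr_gt0// /M.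
move: (nrm x) (nrm y) (nrm (u n)) (nrm (u n - x)) (nrm (v n - y)) un => *.
nra.
Qed.

Lemma tends_star (A : cstarAlg R) (u : nat -> A) x :
  tends u x -> tends (fun n => cs_star (u n)) (cs_star x).
Proof.
move=> h e e0; have [N hN] := h e e0; exists N => n Nn.
by rewrite -cs_starB cs_nrm_star hN.
Qed.

Lemma tensor_dense_ind (A K D : cstarAlg R) (t : A -> K -> D) (T : set D) :
  is_cstar_tensor t -> is_subspace T -> (forall a k, ncl T (t a k)) ->
  forall d, ncl T d.
Proof.
move=> hD ST h d; have [_ _ _ /ndenseP td _] := hD.
apply: ncl_ncl; apply: ncl_mono (td d).
move=> _ [n [s [hs ->]]]; apply: subspace_sum; first exact: ncl_subspace.
by move=> i _; have [a [k ->]] := hs i; exact: h.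
Qed.

Lemma starHom_make (A B : cstarAlg R) (f : A -> B) (c : R) :
  linear f -> (forall x y, f (cs_mul x y) = cs_mul (f x) (f y)) ->
  (forall x, f (cs_star x) = cs_star (f x)) -> opbound f c ->
  exists F : starHom A B, F =1 f.
Proof.
move=> lf fM fS fb.
pose F := HB.pack_for {linear A -> B} f (GRing.isLinear.Build _ _ _ _ f lf).
by exists (@StarHom R A B F fM fS (ex_intro _ c fb)).
Qed.

(** The hypotheses are symmetric in A and B, so closing the relation in both directions gives the
    isomorphism and its inverse. Norm preservation makes both extensions well defined. *)
Lemma graph_star_isomorphic (A B : cstarAlg R) (G : A -> B -> Prop) :
  (forall a x y x' y', G x y -> G x' y' -> G (a *: x + x') (a *: y + y')) ->
  (forall x y x' y', G x y -> G x' y' -> G (cs_mul x x') (cs_mul y y')) ->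
  (forall x y, G x y -> G (cs_star x) (cs_star y)) ->
  (forall x y, G x y -> nrm x = nrm y) ->
  ndense [set x | exists y, G x y] -> ndense [set y | exists x, G x y] ->
  star_isomorphic A B.
Proof.
move=> GL GM GS GN Gd Gr.
have [||||f [lf bf fG fs]] := @extend_graph _ A B G 1; rewrite //.
  by move=> x y /GN ->; rewrite mul1r.
have [||||g [lg bg gG gs]] := @extend_graph _ B A (fun y x => G x y) 1; rewrite //.
- by move=> a x y x' y'; exact: GL.
- by move=> x y /GN ->; rewrite mul1r.
(* Stated for an arbitrary relation, to be applied to G and to its converse. *)
have mulP (A' B' : cstarAlg R) (G' : A' -> B' -> Prop) (h : A' -> B') :
    (forall x y x' y', G' x y -> G' x' y' -> G' (cs_mul x x') (cs_mul y y')) ->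
    linear h -> opbound h 1 -> (forall x y, G' x y -> h x = y) ->
    (forall x, exists u w, [/\ forall n, G' (u n) (w n), tends u x & tends w (h x)])
    -> forall x y, h (cs_mul x y) = cs_mul (h x) (h y).
  move=> G'M lh bh hG hs x y.
  have [u [w [Gu ux wx]]] := hs x; have [u' [w' [Gu' ux' wx']]] := hs y.
  apply: (tends_uniq (opbound_tends lh bh (tends_mul ux ux'))).
  rewrite (_ : _ \o _ = (fun n => cs_mul (w n) (w' n))); first exact: tends_mul.
  by apply/funext => n /=; apply: hG; exact: G'M.
have starP (A' B' : cstarAlg R) (G' : A' -> B' -> Prop) (h : A' -> B') :
    (forall x y, G' x y -> G' (cs_star x) (cs_star y)) ->
    linear h -> opbound h 1 -> (forall x y, G' x y -> h x = y) ->
    (forall x, exists u w, [/\ forall n, G' (u n) (w n), tends u x & tends w (h x)])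
    -> forall x, h (cs_star x) = cs_star (h x).
  move=> G'S lh bh hG hs x; have [u [w [Gu ux wx]]] := hs x.
  apply: (tends_uniq (opbound_tends lh bh (tends_star ux))).
  rewrite (_ : _ \o _ = (fun n => cs_star (w n))); first exact: tends_star.
  by apply/funext => n /=; apply: hG; exact: G'S.
have [F FE] := starHom_make lf (mulP _ _ _ _ GM lf bf fG fs)
  (starP _ _ _ _ GS lf bf fG fs) bf.
have [F' FE'] := starHom_make lg
  (mulP _ _ (fun y x => G x y) _ (fun x y x' y' => @GM y x y' x') lg bg gG gs)
  (starP _ _ (fun y x => G x y) _ (fun x y => @GS y x) lg bg gG gs) bg.
exists F, F'; split=> x.
- rewrite FE FE'; have [u [w [Gu ux wx]]] := fs x.
  apply: (tends_uniq (opbound_tends lg bg wx)).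
  by rewrite (_ : g \o w = u)//; apply/funext => n /=; exact: gG.
- rewrite FE FE'; have [u [w [Gu ux wx]]] := gs x.
  apply: (tends_uniq (opbound_tends lf bf wx)).
  by rewrite (_ : f \o w = u)//; apply/funext => n /=; exact: fG.
Qed.

Lemma starIso_nrm (A B : cstarAlg R) (f : starHom A B) (g : starHom B A) x :
  cancel f g -> nrm (f x) = nrm x.
Proof.
move=> fg; apply/eqP; rewrite eq_le starHom_contractive/=.
by rewrite -{1}[x]fg starHom_contractive.
Qed.

Lemma ten_lin_eq (H1 H2 H : hilbert R) (t : H1 -> H2 -> H) (W : normedModType C)
    (f g : H -> W) (c d : R) : is_hilbert_tensor t ->
  linear f -> linear g -> opbound f c -> opbound g d ->
  (forall u v, f (t u v) = g (t u v)) -> f =1 g.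
Proof.
move=> ht lf lg bf bg fg x; have [u hu ux] := ncl_seq (ten_dense ht x).
apply: (tends_uniq (opbound_tends lf bf ux)).
rewrite (_ : f \o u = g \o u); first exact: opbound_tends lg bg ux.
apply/funext => n /=; have [m [p [q ->]]] := hu n.
by rewrite (linsum lf) (linsum lg); apply: eq_bigr => i _; exact: fg.
Qed.

(** The bounded operator in the supremum agrees on simple tensors with the one from [ten_op_exists],
    which comes with the product bound. *)
Lemma cstar_tensor_cross (A K D : cstarAlg R) (t : A -> K -> D) a k :
  is_cstar_tensor t -> nrm (t a k) <= nrm a * nrm k.
Proof.
move=> [_ _ _ _ /(_ 1%N (fun=> a) (fun=> k))]; rewrite big_ord1 => -[_]; apply.
move=> d [H1 [r1 [H2 [r2 [H [t' [f [h1 h2 ht [lf fE] [d0 bd dm]]]]]]]]].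
apply: dm; first by rewrite mulr_ge0 ?nrm_ge0.
have [||||||g [lg bg gE]] := ten_op_exists ht (S := fun _ : 'I_1 => r1 a)
    (T := fun=> r2 k) (c := fun=> nrm a) (d := fun=> nrm k).
- by move=> _; exact: star_rep_linr.
- by move=> _; exact: star_rep_linr.
- by move=> _; exact: nrm_ge0.
- by move=> _; exact: nrm_ge0.
- by move=> _; exact: star_rep_contractive.
- by move=> _; exact: star_rep_contractive.
rewrite big_ord1 in bg; move=> x.
have -> : f x = g x; last exact: bg.
by apply: (ten_lin_eq ht lf lg bd bg) => u v; rewrite fE gE.
Qed.

End Closures.

(** * The stable isomorphism *)

Section Corner.
Variable R : realType.
Local Notation C := R[i].
Variables (H' H : hilbert R) (V : H' -> H).
Hypothesis lV : linear V.
Hypothesis Vip : forall u v, ip (V u) (V v) = ip u v.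
Variables (K' : cstarAlg R) (r' : K' -> H' -> H').
Variables (K : cstarAlg R) (r : K -> H -> H).
Hypothesis hK' : is_compact_algebra r'.
Hypothesis hK : is_compact_algebra r.

(** The corner embedding is k |-> V k V^*, and conjugation preserves compactness. *)
Lemma corner_exists : exists Vs : H -> H', exists io : K' -> K,
  (forall u w, ip (Vs u) w = ip u (V w)) /\
  forall k u, r (io k) u = V (r' k (Vs u)).
Proof.
have [Vs [VsP lVs bVs VsK]] := isometry_adjoint lV Vip.
have ex k : exists k1, r k1 = V \o r' k \o Vs.
  apply: (ka_exists hK); apply: compact_conj => //.
  - by move=> u; rewrite mul1r (isometry_nrm Vip).
  - by move=> u; rewrite mul1r bVs.
  - by case: hK' => _ _ h _; exact: h.
have [io hio] := choice ex.
by exists Vs, io; split=> // k u; rewrite hio.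
Qed.

Variables (Vs : H -> H') (io : K' -> K).
Hypothesis VsP : forall u w, ip (Vs u) w = ip u (V w).
Hypothesis ioE : forall k u, r (io k) u = V (r' k (Vs u)).

Lemma cornerK : cancel V Vs.
Proof. by move=> u; apply: ip_inj => w; rewrite VsP Vip. Qed.

Lemma corner_linear : linear io.
Proof.
move=> a x y; apply: (ka_inj hK) => u.
by rewrite (ka_linl hK u) !ioE (ka_linl hK') lV.
Qed.

Lemma corner_mul x y : io (cs_mul x y) = cs_mul (io x) (io y).
Proof.
apply: (ka_inj hK) => u.
by rewrite (ka_mul hK) !ioE cornerK (ka_mul hK').
Qed.

Lemma corner_star x : io (cs_star x) = cs_star (io x).
Proof.
apply: (ka_inj hK) => u; apply: ip_inj => v.
by rewrite (ka_star hK) !ioE -VsP [LHS]ipC -VsP -ipC (ka_star hK').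
Qed.

Lemma corner_rep (H2 : hilbert R) (r2 : K -> H2 -> H2) :
  is_star_rep r2 -> is_star_rep (fun k => r2 (io k)).
Proof.
move=> h2; have [[l1 l2] _ rM rS] := h2; split.
- split=> [u a x y|k]; last exact: l2.
  by rewrite corner_linear (star_rep_linl u h2).
- exists 1 => k u; rewrite mul1r (le_trans (star_rep_contractive _ h2 _))//.
  rewrite ler_wpM2r ?nrm_ge0//; apply: (ka_norm hK); first exact: nrm_ge0.
  move=> w; rewrite ioE (isometry_nrm Vip) (le_trans (ka_bound hK' _ _))//.
  rewrite ler_wpM2l ?nrm_ge0//.
  have [Ws [WsP _ bW _]] := isometry_adjoint lV Vip.
  have -> : Vs w = Ws w by apply: ip_inj => z; rewrite VsP WsP.
  exact: bW.
- by move=> x y u; rewrite corner_mul rM.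
- by move=> x u v; rewrite corner_star rS.
Qed.

(** The two inequalities have different sources. The matrix of k over e is that of io k over V \o e,
    which bounds the small algebra by the large one; conversely every representation of K pulls back
    along [io] to one of K'. *)
Lemma corner_tensor_nrm (A D' D : cstarAlg R) (t' : A -> K' -> D')
    (t : A -> K -> D) n (a : 'I_n -> A) (k : 'I_n -> K') :
  is_cstar_tensor t' -> is_cstar_tensor t ->
  nrm (\sum_i t' (a i) (k i)) = nrm (\sum_i t (a i) (io (k i))).
Proof.
move=> ht' ht; apply/eqP; rewrite eq_le; apply/andP; split.
  apply: (cstar_tensor_norm_le hK' ht'); first exact: nrm_ge0.
  move=> H1 r1 h1 m e u oe.
  have oVe : orthonormal (V \o e) by move=> i j /=; rewrite Vip.
  have := cstar_tensor_matrix_bound hK ht a (fun i => io (k i)) h1 u oVe.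
  congr (_ <= _); apply: eq_bigr => x _; congr (nrm _ ^+ 2).
  apply: eq_bigr => y _; apply: eq_bigr => i _.
  by rewrite /= ioE cornerK Vip.
case: ht => _ _ _ _ /(_ n a (fun i => io (k i)))[_]; apply.
move=> d [H1 [r1 [H2 [r2 [H0 [t0 [f [h1 h2 ht0 [lf fE] fd]]]]]]]].
case: ht' => _ _ _ _ /(_ n a k)[ub _]; apply: ub.
exists H1, r1, H2, (fun k => r2 (io k)), H0, t0, f; split=> //.
exact: corner_rep.
Qed.

End Corner.

Section ThetaSpan.
Variable R : realType.
Local Notation C := R[i].
Variables (H : hilbert R) (K : cstarAlg R) (r : K -> H -> H) (th : H -> H -> K).
Hypothesis hK : is_compact_algebra r.
Hypothesis thE : forall xi eta u, r (th xi eta) u = ip u eta *: xi.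

Lemma theta_span_dense (P : set K) : is_subspace P ->
  (forall xi eta, P (th xi eta)) -> forall k, ncl P k.
Proof.
move=> SP Pth k e e0; have e2 : 0 < e / 2 by rewrite divr_gt0.
have [m [f [_ hf]]] := finite_part_approx hK thE (fun _ : 'I_1 => k) e2.
exists (finite_part r th f k).
  apply: subspace_sum => // x _; apply: subspace_sum => // y _.
  exact: subspaceZ.
by rewrite (le_lt_trans (hf ord0))// {2}(splitr e) ltrDl.
Qed.

(** Used with E the union of the ranges of the inclusions of the L^2(U_N), where rank one operators
    are seen at a finite level. The two vectors are approximated one after the other. *)
Lemma theta_ncl (P : set K) (E : set H) : is_subspace P -> ndense E ->
  (forall xi eta, E xi -> E eta -> P (th xi eta)) -> forall k, ncl P k.
Proof.
move=> SP Ed PE k; apply: ncl_ncl; apply: theta_span_dense; first exact: ncl_subspace.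
have h xi eta : E eta -> ncl P (th xi eta).
  move=> Eeta; apply: (@ncl_mapS R _ _ (th^~ eta) (nrm eta) E P xi _ _ (Ed xi));
    last by move=> s Es; exact: PE.
  move=> y; rewrite -(linB (theta_linear hK thE _)) mulrC.
  exact: (theta_nrm hK thE).
move=> xi eta; apply: ncl_ncl.
apply: (@ncl_mapS R _ _ (th xi) (nrm xi) E _ eta _ _ (Ed eta));
  last by move=> s Es; exact: h.
move=> y; have -> : th xi eta - th xi y = th xi (eta - y).
  have := theta_linearr hK thE xi (-1) y eta.
  by rewrite rmorphN1 !scaleN1r => h'; rewrite [RHS](congr1 _ (addrC _ _)) h' addrC.
exact: (theta_nrm hK thE).
Qed.

End ThetaSpan.

Section InductiveLimitTensor.
Variable R : realType.
Local Notation C := R[i].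
Variables (kappa : int -> int -> int) (X : topologicalType) (act : TPi R -> X -> X).
Variables (A : cstarAlg R) (jA : (TPi R -> X -> C) -> A) (W : L2tower R).
Variable L : LTcrossedProduct kappa act jA W.
Variables (K : cstarAlg R) (r : K -> l2_lim W -> l2_lim W).
Hypothesis hK : is_compact_algebra r.
Variables (D : cstarAlg R) (t : A -> K -> D).
Hypothesis hD : is_cstar_tensor t.

Local Notation V N := (l2_inc W N).
Let lV N : linear (V N).
Proof. by move=> a u v; rewrite linearP. Qed.
Let Vip N u v : ip (V N u) (V N v) = ip u v.
Proof. exact: l2_inc_ip. Qed.

Let hKN N := @lx_rep_compact _ _ _ _ _ _ _ L N.
Let corner N := corner_exists (@lV N) (@Vip N) (@hKN N) hK.

Lemma tower_corner : exists (Vs : forall N, l2_lim W -> l2_H W N)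
    (io : forall N, lx_K L N -> K),
  (forall N u w, ip (Vs N u) w = ip u (V N w)) /\
  forall N k u, r (io N k) u = V N (lx_rep k (Vs N u)).
Proof.
pose Vs N := projT1 (cid (corner N)); pose io N := projT1 (cid (projT2 (cid (corner N)))).
exists Vs, io; split=> N.
  by case: (projT2 (cid (projT2 (cid (corner N))))).
by case: (projT2 (cid (projT2 (cid (corner N))))).
Qed.

Variables (Vs : forall N, l2_lim W -> l2_H W N) (io : forall N, lx_K L N -> K).
Hypothesis VsP : forall N u w, ip (Vs N u) w = ip u (V N w).
Hypothesis ioE : forall N k u, r (io k) u = V N (lx_rep k (Vs N u)).

Lemma l2_gauss_nrm : nrm (l2_gauss W) = 1.
Proof. by rewrite /nrm l2_gauss_norm. Qed.

(** Tensoring with the Gaussian projection is conjugation by the isometry J u = u (x) Gaussian, and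
    the inclusion of level N + 1 composed with J is the inclusion of level N. *)
Lemma io_tenP N (k : lx_K L N) : io (lx_tenP k) = io k.
Proof.
have ht := l2_ten_tensor W N.
pose J (u : l2_H W N) : l2_H W N.+1 := l2_ten u (l2_gauss W).
have lJ : linear J by move=> a u v; exact: (tenl ht).
have Jip u v : ip (J u) (J v) = ip u v.
  by rewrite (ten_ip ht) ipE l2_gauss_nrm expr1n mulr1.
have [S [SP lS bS SJ]] := isometry_adjoint lJ Jip.
have St u v : S (l2_ten u v) = ip v (l2_gauss W) *: u.
  by apply: ip_inj => w; rewrite SP (ten_ip ht) ipZl mulrC.
have tE w : lx_rep (lx_tenP k) w = J (lx_rep k (S w)).
  apply: (@ten_lin_eq R _ _ _ _ _ _ (fun w => J (lx_rep k (S w)))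
    (nrm (lx_tenP k)) (nrm k) ht).
  - exact: (ka_lin (hKN N.+1)).
  - by move=> a x y; rewrite lS (ka_lin (hKN N)) lJ.
  - exact: (ka_bound (hKN N.+1)).
  - move=> x; rewrite (isometry_nrm Jip) (le_trans (ka_bound (hKN N) _ _))//.
    by rewrite ler_wpM2l ?nrm_ge0.
  - by move=> u v; rewrite lx_tenPE St (linZ (ka_lin (hKN N) k)) (linZ lJ) (linZ (tenr ht _)).
apply: (ka_inj hK) => u; rewrite !ioE tE /J l2_inc_gauss.
congr (l2_inc W N (lx_rep k _)); apply: ip_inj => w.
by rewrite SP !VsP /J l2_inc_gauss.
Qed.

Lemma conn_sum N (I : finType) (a : I -> A) (k : I -> lx_K L N) :
  lx_conn L N (lx_Psi L N (\sum_i lx_ten (a i) (k i))) =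
  lx_Psi L N.+1 (\sum_i lx_ten (a i) (lx_tenP (k i))).
Proof.
rewrite !linear_sum; apply: eq_bigr => i _.
rewrite -[LHS](lx_PhiK (l := L)); congr (lx_Psi L N.+1 _).
by apply: lx_connE; rewrite lx_PsiK.
Qed.

Lemma iter_conn_sum N n (a : 'I_n -> A) (k : 'I_n -> lx_K L N) m :
  exists k' : 'I_n -> lx_K L (m + N),
    iter_conn (lx_conn L) m (lx_Psi L N (\sum_i lx_ten (a i) (k i))) =
      lx_Psi L (m + N) (\sum_i lx_ten (a i) (k' i)) /\
    forall i, io (k' i) = io (k i).
Proof.
elim: m => [|m [k' [IH ik]]]; first by exists k.
exists (fun i => lx_tenP (k' i)); split; last by move=> i; rewrite io_tenP.
by rewrite /= IH conn_sum.
Qed.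

Lemma Psi_nrm N x : nrm (lx_Psi L N x) = nrm x.
Proof. exact/starIso_nrm/lx_PsiK. Qed.

(** The norms along the connecting maps are constant, because [io] does not change and
    [corner_tensor_nrm] applies at every level; so their limit is that constant. *)
Lemma eta_sum_nrm N n (a : 'I_n -> A) (k : 'I_n -> lx_K L N) :
  nrm (lx_eta L N (lx_Psi L N (\sum_i lx_ten (a i) (k i)))) =
  nrm (\sum_i t (a i) (io (k i))).
Proof.
have [_ _ /(_ N (lx_Psi L N (\sum_i lx_ten (a i) (k i)))) h] := lx_lim L.
have h' : (fun m => nrm (iter_conn (lx_conn L) m
    (lx_Psi L N (\sum_i lx_ten (a i) (k i))))) =
    (fun=> nrm (\sum_i t (a i) (io (k i)))).
  apply/funext => m; have [k' [-> ik]] := iter_conn_sum a k m.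
  rewrite Psi_nrm (corner_tensor_nrm (@lV (m + N)%N) (@Vip (m + N)%N)
    (@hKN (m + N)%N) hK (@VsP (m + N)%N)
    (@ioE (m + N)%N) a k' (lx_ten_tensor L (m + N)%N) hD).
  by congr nrm; apply: eq_bigr => i _; rewrite ik.
move: h; rewrite h' => h.
apply: (cvg_unique _ h); first exact: (@norm_hausdorff R R^o).
exact: cvg_cst.
Qed.

(** Restricted to finite sums of simple tensors, where the partner in D is explicit;
    [graph_star_isomorphic] takes care of the closure. *)
Definition lgraph N (x : L) (y : D) : Prop :=
  exists n (a : 'I_n -> A) (k : 'I_n -> lx_K L N),
    x = lx_eta L N (lx_Psi L N (\sum_i lx_ten (a i) (k i))) /\
    y = \sum_i t (a i) (io (k i)).

Lemma lgraph_fin N (I : finType) (a : I -> A) (k : I -> lx_K L N) :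
  lgraph N (lx_eta L N (lx_Psi L N (\sum_i lx_ten (a i) (k i))))
           (\sum_i t (a i) (io (k i))).
Proof.
exists #|I|, (a \o enum_val), (k \o enum_val).
by split; rewrite (reindex (@enum_val I I)) //=; exact/onW_bij/enum_val_bij.
Qed.

Lemma lgraphS N x y : lgraph N x y -> lgraph N.+1 x y.
Proof.
move=> [n [a [k [-> ->]]]]; exists n, a, (fun i => lx_tenP (k i)); split.
  by rewrite -conn_sum; case: (lx_lim L) => -> _ _.
by apply: eq_bigr => i _; rewrite io_tenP.
Qed.

Lemma lgraph_le N M x y : (N <= M)%N -> lgraph N x y -> lgraph M x y.
Proof.
move=> NM h; rewrite -(subnK NM); elim: (M - N)%N => //= m IH.
exact: lgraphS.
Qed.

Definition ltgraph x y := exists N, lgraph N x y.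

Lemma ltgraph2 x y x' y' : ltgraph x y -> ltgraph x' y' ->
  exists N, lgraph N x y /\ lgraph N x' y'.
Proof.
move=> [N h] [M h']; exists (maxn N M).
by split; [apply: lgraph_le h; rewrite leq_maxl|apply: lgraph_le h'; rewrite leq_maxr].
Qed.

Let lx_tenl N k : linear (fun a => lx_ten (l := L) (N := N) a k).
Proof. by case: (lx_ten_tensor L N) => -[h _] _ _ _ _; exact: h. Qed.
Let tl k : linear (t^~ k). Proof. by case: hD => -[h _] _ _ _ _; exact: h. Qed.
Let tr a : linear (t a). Proof. by case: hD => -[_ h] _ _ _ _; exact: h. Qed.

Lemma ltgraph_lin a x y x' y' : ltgraph x y -> ltgraph x' y' ->
  ltgraph (a *: x + x') (a *: y + y').
Proof.
move=> h h'; have [N [[n [b [k [-> ->]]]] [m [b' [k' [-> ->]]]]]] := ltgraph2 h h'.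
exists N.
pose B (z : 'I_n + 'I_m) := match z with inl i => a *: b i | inr i => b' i end.
pose k2 (z : 'I_n + 'I_m) := match z with inl i => k i | inr i => k' i end.
have := lgraph_fin B k2; rewrite !big_sumType /=.
congr (lgraph N _ (_ + _)).
  rewrite -!linearP /=; congr (lx_eta L N (lx_Psi L N (_ + _))).
  by rewrite scaler_sumr; apply: eq_bigr => i _; rewrite (linZ (lx_tenl _)).
by rewrite scaler_sumr; apply: eq_bigr => i _; rewrite (linZ (tl _)).
Qed.

Let ctensorM (A' K' D' : cstarAlg R) (t' : A' -> K' -> D') n m
    (a : 'I_n -> A') (k : 'I_n -> K') (b : 'I_m -> A') (q : 'I_m -> K') :
  is_cstar_tensor t' ->
  cs_mul (\sum_i t' (a i) (k i)) (\sum_j t' (b j) (q j)) =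
  \sum_(z : 'I_n * 'I_m) t' (cs_mul (a z.1) (b z.2)) (cs_mul (k z.1) (q z.2)).
Proof.
move=> [_ tM _ _ _]; rewrite (linsum (cs_linl _)).
rewrite -(pair_bigA _ (fun i j => t' (cs_mul (a i) (b j)) (cs_mul (k i) (q j)))) /=.
by apply: eq_bigr => i _; rewrite (linsum (cs_linr _)); apply: eq_bigr => j _.
Qed.

Lemma ltgraph_mul x y x' y' : ltgraph x y -> ltgraph x' y' ->
  ltgraph (cs_mul x x') (cs_mul y y').
Proof.
move=> h h'; have [N [[n [b [k [-> ->]]]] [m [b' [k' [-> ->]]]]]] := ltgraph2 h h'.
exists N; rewrite -!sh_mul (ctensorM _ _ _ _ (lx_ten_tensor L N)) (ctensorM _ _ _ _ hD).
have := lgraph_fin (fun z : 'I_n * 'I_m => cs_mul (b z.1) (b' z.2))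
  (fun z => cs_mul (k z.1) (k' z.2)).
congr lgraph; apply: eq_bigr => z _; congr (t _ _).
exact: (corner_mul (@Vip N) (@hKN N) hK (@VsP N) (@ioE N)).
Qed.

Lemma ltgraph_star x y : ltgraph x y -> ltgraph (cs_star x) (cs_star y).
Proof.
move=> [N [n [b [k [-> ->]]]]]; exists N, n, (fun i => cs_star (b i)), (fun i => cs_star (k i)).
have [_ _ sL _ _] := lx_ten_tensor L N; have [_ _ sD _ _] := hD; split.
  rewrite -!sh_star cs_star_sum; congr (lx_eta L N (lx_Psi L N _)).
  by apply: eq_bigr => i _; rewrite sL.
rewrite cs_star_sum; apply: eq_bigr => i _; rewrite -sD; congr (t _ _).
by rewrite (corner_star (@hKN N) hK (@VsP N) (@ioE N)).
Qed.

Lemma ltgraph_dom : ndense [set x | exists y, ltgraph x y].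
Proof.
move=> x; set S := [set x | _].
have [_ /ndenseP ld _] := lx_lim L.
apply: ncl_ncl; apply: ncl_mono (ld x) => _ [N _ [b _ <-]].
have [_ _ _ /ndenseP td _] := lx_ten_tensor L N.
rewrite -[b](lx_PhiK (l := L)).
apply: (@ncl_mapS R _ _ (fun z => lx_eta L N (lx_Psi L N z)) 1 _ S (lx_Phi L N b) _ _
  (td _)).
  by move=> z; rewrite mul1r -!linearB (le_trans (starHom_contractive _ _))//
    starHom_contractive.
move=> _ [n [s [hs ->]]].
have ex i : exists ak : A * lx_K L N, s i = lx_ten ak.1 ak.2.
  by have [a [k ->]] := hs i; exists (a, k).
have [f hf] := choice ex.
exists (\sum_i t (f i).1 (io (f i).2)), N, n, (fun i => (f i).1), (fun i => (f i).2).
by split=> //; congr (lx_eta L N (lx_Psi L N _)); apply: eq_bigr.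
Qed.

Lemma ltgraph_ran : ndense [set y | exists x, ltgraph x y].
Proof.
set S := [set y | _].
have SP : is_subspace S.
  split.
    exists (lx_eta L 0%N (lx_Psi L 0%N (\sum_(i < 0) lx_ten 0 0))), 0%N, 0%N.
    by exists (fun=> 0), (fun=> 0); rewrite !big_ord0.
  by move=> a y y' [x h] [x' h']; exists (a *: x + x'); exact: ltgraph_lin.
have tk a k : ncl S (t a k).
  pose P := [set k | S (t a k)].
  have PP : is_subspace P.
    split; first by rewrite /P /= (lin0 (tr a)); case: SP.
    by move=> b y z hy hz; rewrite /P /= (tr a); case: SP => _; apply.
  have [th thE] := theta_exists hK.
  pose E := [set u | exists N w, u = V N w].
  have Ed : ndense E.
    move=> u e e0; have [w [N _ [w' _ ww']] uw] := proj1 (ndenseP _) (@l2_inc_dense R W) u e e0.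
    by exists w => //; exists N, w'.
  have up N M w : (N <= M)%N -> exists w', V N w = V M w'.
    move=> NM; rewrite -(subnK NM); elim: (M - N)%N => [|m [w' ->]]; first by exists w.
    by exists (l2_ten w' (l2_gauss W)); rewrite l2_inc_gauss.
  have hP : forall k, ncl P k.
    apply: (theta_ncl hK thE PP Ed) => _ _ [N [w ->]] [M [w' ->]].
    have [v ->] := up N (maxn N M) w (leq_maxl _ _).
    have [v' ->] := up M (maxn N M) w' (leq_maxr _ _).
    set Q := maxn N M.
    (* A rank one operator with both vectors in the range of level Q is the image of a rank one
       operator of that level. *)
    have [th' th'E] := theta_exists (@hKN Q).
    have -> : th (V Q v) (V Q v') = io (th' v v').
      by apply: (ka_inj hK) => u; rewrite thE ioE th'E -VsP (linZ (@lV Q)).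
    exists (lx_eta L Q (lx_Psi L Q (\sum_(i < 1) lx_ten a (th' v v')))), Q.
    by exists 1%N, (fun=> a), (fun=> th' v v'); rewrite !big_ord1.
  apply: (@ncl_mapS R _ _ (t a) (nrm a) P S k _ _ (hP k)) => //.
  by move=> y; rewrite -(linB (tr a)); exact: cstar_tensor_cross.
by move=> x; exact: (tensor_dense_ind hD SP tk).
Qed.

End InductiveLimitTensor.

Theorem LTcrossedProduct_stable (R : realType) (kappa : int -> int -> int)
    (X : topologicalType) (act : TPi R -> X -> X)
    (A : cstarAlg R) (jA : (TPi R -> X -> R[i]) -> A) (W : L2tower R)
    (L : LTcrossedProduct kappa act jA W)
    (K : cstarAlg R) (r : K -> l2_lim W -> l2_lim W) (D : cstarAlg R)
    (t : A -> K -> D) :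
  is_compact_algebra r -> is_cstar_tensor t -> star_isomorphic L D.
Proof.
move=> hK hD; have [Vs [io [VsP ioE]]] := tower_corner L hK.
apply: (@graph_star_isomorphic _ _ _ (ltgraph t io)).
- by move=> a x y x' y'; exact: (ltgraph_lin hK hD VsP ioE).
- by move=> x y x' y'; exact: (ltgraph_mul hK hD VsP ioE).
- by move=> x y; exact: (ltgraph_star hK hD VsP ioE).
- by move=> x y [N [n [a [k [-> ->]]]]]; exact: (eta_sum_nrm hK hD VsP ioE).
- exact: ltgraph_dom.
- exact: (ltgraph_ran hK hD VsP ioE).
Qed.

(** * Approximate units and square roots *)

Section Faithful.
Variable R : realType.
Local Notation C := R[i].
Variable A : cstarAlg R.

(* By Gelfand-Naimark every C*-algebra has this property; a crossed product has it
   by the definition of its norm. *)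
Definition rep_normed : Prop := forall (a : A) (c : R), 0 <= c ->
  (forall (H : hilbert R) (r : A -> H -> H), is_star_rep r -> opbound (r a) c) ->
  nrm a <= c.

(** Positivity as it can be checked in representations and passed to limits; [positive_sqrt] turns
    it into the form b^* b required of an imprimitivity bimodule. *)
Definition rep_pos (y : A) : Prop := forall (H : hilbert R) (r : A -> H -> H) u,
  is_star_rep r -> 0 <= ip (r y u) u.

Hypothesis fA : rep_normed.

Lemma star_rep_mul (H : hilbert R) (r : A -> H -> H) x y u : is_star_rep r ->
  r (cs_mul x y) u = r x (r y u).
Proof. by case. Qed.

Lemma star_rep_star (H : hilbert R) (r : A -> H -> H) x u v : is_star_rep r ->
  ip (r (cs_star x) u) v = ip u (r x v).
Proof. by case. Qed.

Lemma star_rep_sqr (H : hilbert R) (r : A -> H -> H) a u : is_star_rep r ->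
  ip (r (cs_mul (cs_star a) a) u) u = ((nrm (r a u) ^+ 2)%:C)%C.
Proof. by move=> hr; rewrite star_rep_mul// star_rep_star// ipE. Qed.

(** Expanding the square gives |v|^2 - 2 |a v|^2 + |a^* a v|^2, and the last term is at most |a
    v|^2. *)
Lemma contraction_sub_sqr (H : hilbert R) (r : A -> H -> H) a v :
  is_star_rep r -> nrm a <= 1 ->
  nrm (v - r (cs_mul (cs_star a) a) v) ^+ 2 <= nrm v ^+ 2 - nrm (r a v) ^+ 2.
Proof.
move=> hr a1; rewrite nrm_sqrD nrmN ipNr ipC (star_rep_sqr _ _ hr) conjR /=.
have : nrm (r (cs_mul (cs_star a) a) v) ^+ 2 <= nrm (r a v) ^+ 2.
  rewrite ler_sqr ?nnegrE ?nrm_ge0// star_rep_mul//.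
  rewrite (le_trans (star_rep_contractive _ hr _))// cs_nrm_star.
  by rewrite ler_piMl ?nrm_ge0.
lra.
Qed.

(* In the unitization, 1 - approx_unit a n = (1 - a^* a)^n. *)
Fixpoint approx_unit (a : A) n : A :=
  let y := cs_mul (cs_star a) a in
  if n is m.+1 then y + approx_unit a m - cs_mul y (approx_unit a m) else 0.

(** With v k = (1 - a^* a)^k u and c k = |a v k|^2, [contraction_sub_sqr] telescopes to a sum of the
    c k bounded by |u|^2. As c decreases, (n + 1) c n <= |u|^2. *)
Lemma approx_unit_nrm a n : nrm a <= 1 ->
  nrm (a - cs_mul a (approx_unit a n)) <= Num.sqrt (n.+1%:R^-1).
Proof.
move=> a1; apply: fA => [|H r hr u]; first exact: sqrtr_ge0.
pose y := cs_mul (cs_star a) a.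
pose v k := u - r (approx_unit a k) u.
have vS k : v k.+1 = v k - r y (v k).
  rewrite /v /= -/y (linB (star_rep_linl u hr)) (linD (star_rep_linl u hr)).
  rewrite star_rep_mul// (linB (star_rep_linr y hr)).
  rewrite !opprB addrCA [RHS]addrCA; congr (_ + _).
  by rewrite opprD addrA addrAC.
pose c k := nrm (r a (v k)) ^+ 2.
have cS k : c k.+1 <= c k.
  rewrite /c vS (linB (star_rep_linr a hr)) -star_rep_mul// cs_mulA star_rep_mul//.
  have := @contraction_sub_sqr H r (cs_star a) (r a (v k)) hr.
  rewrite cs_nrm_star cs_starK => /(_ a1)/le_trans; apply.
  by rewrite gerBl sqr_ge0.
have cm k m : (k <= m)%N -> c m <= c k.
  move=> km; rewrite -(subnK km); elim: (m - k)%N => //= j IH.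
  by rewrite addSn (le_trans (cS _)).
have tel m : \sum_(k < m) c k <= nrm u ^+ 2 - nrm (v m) ^+ 2.
  elim: m => [|m IH].
    by rewrite big_ord0 /v /= (lin0 (star_rep_linl u hr)) subr0 subrr.
  rewrite big_ord_recr /=; have := contraction_sub_sqr (v m) hr a1.
  by rewrite -/y -vS -/(c m); move: IH; lra.
have hn : n.+1%:R * c n <= nrm u ^+ 2.
  apply: (@le_trans _ _ (\sum_(k < n.+1) c k)).
    rewrite -{1}[n.+1]card_ord -sum1_card natr_sum mulr_suml.
    by apply: ler_sum => k _; rewrite mul1r cm// -ltnS.
  by rewrite (le_trans (tel _))// gerBl sqr_ge0.
rewrite (linB (star_rep_linl u hr)) star_rep_mul// -(linB (star_rep_linr a hr)).
rewrite -/(v n) -ler_sqr ?nnegrE ?mulr_ge0 ?nrm_ge0 ?sqrtr_ge0//.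
rewrite exprMn sqr_sqrtr ?invr_ge0// -/(c n).
by rewrite mulrC ler_pdivlMr// mulrC.
Qed.

(** After scaling a to norm at most 1, multiply it by its approximate unit. Fullness of both inner
    products rests on this. *)
Lemma products_dense (a : A) : ncl [set x | exists b c : A, x = cs_mul b c] a.
Proof.
have base (b : A) : nrm b <= 1 -> ncl [set x | exists b c : A, x = cs_mul b c] b.
  move=> b1 e e0; have [n hn] := inv_lt_eps (exprn_gt0 2 e0).
  exists (cs_mul b (approx_unit b n)); first by do 2 eexists.
  rewrite (le_lt_trans (approx_unit_nrm n b1))//.
  by rewrite -(ger0_norm (ltW e0)) -sqrtr_sqr ltr_sqrt ?exprn_gt0// hn.
have n1 : 0 < nrm a + 1 by rewrite ltr_wpDl ?nrm_ge0.
pose s : C := ((nrm a + 1)%:C)%C.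
have s0 : s != 0.
  by apply/negP => /eqP/(@complexI R (nrm a + 1) 0) s0; rewrite s0 ltxx in n1.
have -> : a = s *: (s^-1 *: a) by rewrite scalerA divff// scale1r.
apply: (@ncl_mapS R _ _ (fun x => s *: x) (cn s) _ _ (s^-1 *: a)); last 1 first.
- apply: base; rewrite nrmZ.
  have -> : cn s^-1 = (nrm a + 1)^-1.
    by rewrite /s -fmorphV /= cnR ger0_norm// invr_ge0 ltW.
  by rewrite mulrC ler_pdivrMr// mul1r lerDl.
- by move=> y; rewrite -scalerBr nrmZ.
- by move=> _ [b [c ->]]; exists (s *: b), c; rewrite (linZ (cs_linl c)).
Qed.

(** Cauchy-Schwarz for the semidefinite form q v w = <y v, w>, applied to v and y v, gives |y v|^2
    <= q v v. Then |v - y v|^2 = |v|^2 - 2 q v v + |y v|^2 <= |v|^2. *)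
Lemma rep_pos_sub1 (H : hilbert R) (r : A -> H -> H) y v :
  rep_pos y -> cs_star y = y -> nrm y <= 1 -> is_star_rep r ->
  nrm (v - r y v) <= nrm v.
Proof.
move=> yp ys y1 hr; pose q (v w : H) := ip (r y v) w.
have qP (a : C) u w z : q (a *: u + w) z = a * q u z + q w z.
  by rewrite /q (star_rep_linr y hr) ipP.
have qC u w : q w u = (q u w)^*.
  by rewrite /q -[in LHS]ys star_rep_star// [LHS]ipC.
have qpos u : 0 <= q u u by exact: yp.
have := form_CauchySchwarz qP qC qpos v (r y v).
rewrite {1}/q ipE cnR ger0_norm ?sqr_ge0// => cs.
have qE u : q u u = ((complex.Re (q u u))%:C)%C by exact: form_Re.
have q0 u : 0 <= complex.Re (q u u) by rewrite -lecR -qE.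
have qle : complex.Re (q (r y v) (r y v)) <= nrm (r y v) ^+ 2.
  rewrite -lecR -qE (le_trans (real_ler_norm _))//; first by rewrite ger0_real.
  rewrite cnE lecR (le_trans (ip_CauchySchwarz _ _))// expr2 ler_wpM2r ?nrm_ge0//.
  rewrite (le_trans (star_rep_contractive _ hr _))//.
  by rewrite ler_piMl ?nrm_ge0.
have h1 : nrm (r y v) ^+ 2 <= complex.Re (q v v).
  have [->|n0] := eqVneq (nrm (r y v) ^+ 2) 0; first exact: q0.
  have np : 0 < nrm (r y v) ^+ 2 by rewrite lt_def n0 sqr_ge0.
  rewrite -(ler_pM2r np) -expr2 (le_trans cs)// ler_wpM2l//.
rewrite -ler_sqr ?nnegrE ?nrm_ge0// nrm_sqrD nrmN ipNr ipC -/(q v v) qE conjR /=.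
by have := q0 v; lra.
Qed.

Lemma half_real : ((2^-1 : R)%:C)%C = 2^-1 :> C.
Proof. by rewrite -[in RHS]two_real -fmorphV. Qed.

Lemma cn_half : cn (2^-1 : C) = 2^-1.
Proof. by rewrite -half_real cnR ger0_norm. Qed.

(** The scalar part of the iterates in the unitization, and at the same time the iteration for y =
    0, which dominates all the others. *)
Fixpoint sqrt_scal n : R := if n is m.+1 then (1 + sqrt_scal m ^+ 2) / 2 else 0.

(* [sqrt_scal n - sqrt_iter y n] is the n-th iterate of w |-> (1 - y + w ^+ 2) / 2,
   which decreases to 1 minus the square root of [y]. *)
Fixpoint sqrt_iter (y : A) n : A :=
  if n is m.+1 then (2^-1 : C) *:
    (y + (2 * (sqrt_scal m)%:C)%C *: sqrt_iter y m
       - cs_mul (sqrt_iter y m) (sqrt_iter y m)) else 0.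

(** The defect d = 1 - [sqrt_scal] n evolves by d - d^2 / 2, whose solutions decay like 2 / n; the
    shift by 2 fits the start d = 1. *)
Lemma sqrt_scal_bounds n : 0 <= sqrt_scal n /\ 1 - 2 / n.+2%:R <= sqrt_scal n <= 1.
Proof.
elim: n => [|n [h0 /andP[h1 h2]]] /=; first by rewrite divff//; lra.
have p : (0 : R) <= n%:R by [].
split; first by rewrite divr_ge0// addr_ge0// sqr_ge0.
apply/andP; split; last by nra.
have e1 : n.+2%:R = n%:R + 2 :> R by rewrite -addn2 natrD.
have e2 : n.+3%:R = n%:R + 3 :> R by rewrite -addn3 natrD.
have : (1 - sqrt_scal n) * (n%:R + 2) <= 2.
  by rewrite -e1 -ler_pdivlMr// lerBlDr addrC -lerBlDr.
rewrite e2 lerBlDr -lerBlDl; set x := sqrt_scal n in h0 h1 h2 *; set N := n%:R in p *.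
move=> hx; rewrite ler_pdivlMr; last lra.
have -> : (1 - (1 + x ^+ 2) / 2) = (1 - x) * (1 + x) / 2 by field.
set d := 1 - x in hx *; have -> : 1 + x = 2 - d by rewrite /d; lra.
have d0 : 0 <= d by rewrite /d; lra.
have d1 : d <= 1 by rewrite /d; lra.
nra.
Qed.

(** Majorant method: in a representation the iterate W k has norm at most [sqrt_scal] k, and its
    increments are bounded by those of [sqrt_scal]. The factor 2 arises because the step of
    [sqrt_iter] is the scalar increment minus the increment of W. *)
Lemma sqrt_iter_step (y : A) : rep_pos y -> cs_star y = y -> nrm y <= 1 ->
  forall n, nrm (sqrt_iter y n.+1 - sqrt_iter y n) <=
    2 * (sqrt_scal n.+1 - sqrt_scal n).
Proof.
move=> yp ys y1 n.
have mono : 0 <= sqrt_scal n.+1 - sqrt_scal n.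
  by have [h0 /andP[_ h1]] := sqrt_scal_bounds n; rewrite /=; nra.
apply: fA => [|H r hr u]; first by rewrite mulr_ge0.
pose W k u : H := ((sqrt_scal k)%:C)%C *: u - r (sqrt_iter y k) u.
have lW k : linear (W k).
  move=> a v w; rewrite /W (star_rep_linr _ hr) scalerDr scalerBr !scalerA.
  by rewrite opprD addrACA (mulrC a).
have WS k v : W k.+1 v = (2^-1 : C) *: ((v - r y v) + W k (W k v)).
  rewrite /W /= (linZ (star_rep_linl v hr)) (linB (star_rep_linl v hr)).
  rewrite (linD (star_rep_linl v hr)) (linZ (star_rep_linl v hr)) star_rep_mul//.
  set z := sqrt_iter y k; set al := sqrt_scal k.
  rewrite (linB (star_rep_linr z hr)) (linZ (star_rep_linr z hr)).
  set s := (al%:C)%C.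
  have -> : (((1 + al ^+ 2) / 2)%:C)%C = 2^-1 * (1 + s ^+ 2) :> C.
    by rewrite mulrC rmorphM /= half_real rmorphD rmorph1 rmorphXn.
  rewrite -scalerA -scalerBr; congr (_ *: _).
  rewrite !scalerBr scalerDl scale1r scalerA -expr2.
  rewrite (_ : (2 * s) *: r z v = s *: r z v + s *: r z v); last first.
    by rewrite -scalerDl; congr (_ *: _); ring.
  move: (s ^+ 2 *: v) (r y v) (s *: r z v) (r z (r z v)) => a b c d.
  rewrite (opprB c) (opprB _ d) (opprD b) (addrCA d) (addrACA v).
  by congr (_ + _); rewrite (opprD c) [RHS](addrACA a) !addrA.
have bW k v : nrm (W k v) <= sqrt_scal k * nrm v.
  elim: k v => [|k IH] v.
    by rewrite /W /= scale0r (lin0 (star_rep_linl v hr)) subr0 nrm0 mul0r.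
  have [s0 _] := sqrt_scal_bounds k.
  rewrite WS nrmZ cn_half /= mulrAC mulrC ler_wpM2r ?invr_ge0// mulrDl mul1r.
  rewrite (le_trans (nrmD _ _))// lerD ?rep_pos_sub1//.
  by rewrite (le_trans (IH _))// expr2 -mulrA ler_wpM2l.
have dW k v : nrm (W k.+1 v - W k v) <= (sqrt_scal k.+1 - sqrt_scal k) * nrm v.
  elim: k v => [|k IH] v.
    have W0 w : W 0%N w = 0.
      by rewrite /W /= scale0r (lin0 (star_rep_linl w hr)) subr0.
    rewrite WS !W0 addr0 subr0 nrmZ cn_half /= expr0n addr0 subr0 mul1r ler_wpM2l ?invr_ge0//.
    exact: rep_pos_sub1.
  have [s0 _] := sqrt_scal_bounds k; have [s1 _] := sqrt_scal_bounds k.+1.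
  rewrite [W k.+2 v]WS {2}[W k.+1 v]WS -scalerBr nrmZ cn_half opprD addrACA subrr add0r.
  (* The operator form of p^2 - q^2 = p (p - q) + (p - q) q; its scalar analogue is the increment of
     the majorant. *)
  have -> : W k.+1 (W k.+1 v) - W k (W k v) =
     W k.+1 (W k.+1 v - W k v) + (W k.+1 (W k v) - W k (W k v)).
    by rewrite [in RHS](linB (lW _)) [RHS]addrA subrK.
  have := nrmD (W k.+1 (W k.+1 v - W k v)) (W k.+1 (W k v) - W k (W k v)).
  have := ler_wpM2l s1 (IH v); have := bW k.+1 (W k.+1 v - W k v).
  have := IH (W k v); have := bW k v.
  have e : sqrt_scal k.+2 = (1 + sqrt_scal k.+1 ^+ 2) / 2 by [].
  have e' : sqrt_scal k.+1 = (1 + sqrt_scal k ^+ 2) / 2 by [].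
  have inc : 0 <= sqrt_scal k.+1 - sqrt_scal k.
    by have [_ /andP[_ h1]] := sqrt_scal_bounds k; rewrite e'; nra.
  move=> b1 b2 b3 b4 b5.
  have := ler_wpM2l inc b1.
  rewrite ler_pdivrMl// e.
  move: b2 b3 b4 b5.
  have -> : (1 + sqrt_scal k.+1 ^+ 2) / 2 - sqrt_scal k.+1 =
    (sqrt_scal k.+1 - sqrt_scal k) * (sqrt_scal k.+1 + sqrt_scal k) / 2.
    by rewrite {2}e'; field.
  move: (sqrt_scal k.+1 - sqrt_scal k) (sqrt_scal k.+1) (sqrt_scal k) => d p q.
  by move: (nrm v) (nrm (W k v)) => V Wv; nra.
have -> : r (sqrt_iter y n.+1 - sqrt_iter y n) u =
    ((sqrt_scal n.+1 - sqrt_scal n)%:C)%C *: u - (W n.+1 u - W n u).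
  rewrite /W (linB (star_rep_linl u hr)) rmorphB scalerBl.
  move: (_ *: u) (_ *: u) (r _ u) (r _ u) => b a z x.
  rewrite (opprB (a - x)) (opprB a) (addrA (a - b)) (addrA (a - b) b) subrK.
  by rewrite [RHS]addrC addrA subrK.
rewrite (le_trans (nrmD _ _))// nrmN nrmZ cnR ger0_norm//.
by rewrite [2 * _]mulr_natl mulr2n [leRHS]mulrDl lerD.
Qed.

Lemma sqrt_iter_star (y : A) n : cs_star y = y ->
  cs_star (sqrt_iter y n) = sqrt_iter y n.
Proof.
move=> ys; elim: n => [|n IH] /=; first exact: cs_star0.
rewrite cs_starZ cs_starB cs_starD cs_starZ ys cs_starM IH.
by rewrite -half_real conjR rmorphM /= conjR -two_real conjR.
Qed.

Lemma positive_sqrt1 (y : A) : rep_pos y -> cs_star y = y -> nrm y <= 1 ->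
  exists b, y = cs_mul (cs_star b) b.
Proof.
move=> yp ys y1.
have bnd n m : (n <= m)%N ->
    nrm (sqrt_iter y m - sqrt_iter y n) <= 2 * (sqrt_scal m - sqrt_scal n).
  move=> nm; rewrite -(subnK nm); elim: (m - n)%N => [|k IH].
    by rewrite !subrr nrm0 mulr0.
  rewrite (le_trans (nrmBt (sqrt_iter y (k + n)) _ _))// addSn.
  have := sqrt_iter_step yp ys y1 (k + n); move: IH.
  by move: (sqrt_scal (k + n).+1) (sqrt_scal (k + n)) (sqrt_scal n) => p q s; lra.
have small (e : R) : 0 < e -> exists N, forall n, (N <= n)%N ->
    1 - sqrt_scal n < e.
  move=> e0; have [N hN] := inv_lt_eps (divr_gt0 e0 (ltr0n R 2)).
  exists N => n Nn; have [_ /andP[h1 _]] := sqrt_scal_bounds n.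
  apply: (@le_lt_trans _ _ (2 / n.+2%:R)); first by rewrite lerBlDr addrC -lerBlDr.
  by rewrite mulrC -ltr_pdivlMr// hN// leqW.
have zC : ncauchy (sqrt_iter y).
  move=> e e0; have [N hN] := small (e / 4) ltac:(by rewrite divr_gt0).
  exists N => m n Nm Nn.
  wlog nm : m n Nm Nn / (n <= m)%N => [wl|].
    by case/orP: (leq_total n m) => h; [|rewrite nrmB]; exact: wl.
  rewrite (le_lt_trans (bnd _ _ nm))//.
  have [_ /andP[_ m1]] := sqrt_scal_bounds m; have := hN n Nn.
  by move: (sqrt_scal m) (sqrt_scal n) m1 => p q *; lra.
have [z zz] := ncauchy_cvg zC.
have zs : cs_star z = z.
  apply: (tends_uniq (tends_star zz)).
  rewrite (_ : (fun n => _) = sqrt_iter y)//.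
  by apply/funext => n; rewrite sqrt_iter_star.
exists z; rewrite zs; apply: (@tends_uniq _ _ (fun n =>
  cs_mul (sqrt_iter y n) (sqrt_iter y n))); last exact: tends_mul.
(* With z n = [sqrt_iter] y n and s n = [sqrt_scal] n, y - (z n)^2 = 2 (z (n + 1) - z n) + 2 (1 - s
   n) z n. The two terms are at most 4 (1 - s n) and 6 (1 - s n), in total less than 11 times e /
   11. *)
move=> e e0; have [N hN] := small (e / 11) ltac:(by rewrite divr_gt0).
exists N => n Nn; rewrite nrmB.
have -> : y - cs_mul (sqrt_iter y n) (sqrt_iter y n) =
    (2 : C) *: (sqrt_iter y n.+1 - sqrt_iter y n) +
    (2 * (1 - sqrt_scal n)%:C)%C *: sqrt_iter y n.
  rewrite scalerBr /= scalerA divff ?pnatr_eq0// scale1r.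
  set w := sqrt_iter y n; set s := sqrt_scal n.
  have -> : ((2 * (1 - s)%:C)%C *: w : A) = (2 : C) *: w - (2 * s%:C)%C *: w.
    by rewrite -scalerBl; congr (_ *: _); rewrite rmorphB rmorph1 mulrBr mulr1.
  rewrite addrA subrK addrAC; congr (_ - _).
  by rewrite addrK.
rewrite (le_lt_trans (nrmD _ _))// !nrmZ cnM cnR (_ : cn 2 = 2); last first.
  by rewrite -two_real cnR ger0_norm.
have [_ /andP[_ m1]] := sqrt_scal_bounds n.
rewrite ger0_norm ?subr_ge0//.
have := sqrt_iter_step yp ys y1 n; have := hN n Nn.
have h3 : nrm (sqrt_iter y n) <= 3.
  have := bnd 0%N n (leq0n n); rewrite /= !subr0 => h.
  by rewrite (le_trans h)//; move: m1; lra.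
have [_ /andP[_ m2]] := sqrt_scal_bounds n.+1.
move: (nrm (sqrt_iter y n.+1 - sqrt_iter y n)) (sqrt_scal n.+1) m2 => p q q1.
have := nrm_ge0 (sqrt_iter y n); move: m1 h3.
move: (nrm (sqrt_iter y n)) (sqrt_scal n) => w s *; nra.
Qed.

Lemma positive_sqrt (y : A) : rep_pos y -> cs_star y = y ->
  exists b, y = cs_mul (cs_star b) b.
Proof.
move=> yp ys; pose s := nrm y + 1.
have s0 : 0 < s by rewrite ltr_wpDl ?nrm_ge0.
have [|||b hb] := @positive_sqrt1 (((s^-1)%:C)%C *: y).
- move=> H r u hr; rewrite (linZ (star_rep_linl u hr)) ipZl.
  by rewrite mulr_ge0 ?yp// lecR invr_ge0 ltW.
- by rewrite cs_starZ conjR ys.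
- rewrite nrmZ cnR ger0_norm ?invr_ge0 ?(ltW s0)//.
  by rewrite mulrC ler_pdivrMr// mul1r lerDl.
exists (((Num.sqrt s)%:C)%C *: b).
rewrite cs_starZ conjR (linZ (cs_linl _)) (linZ (cs_linr _)) -hb !scalerA.
by rewrite -!rmorphM /= -expr2 sqr_sqrtr ?(ltW s0)// divff ?gt_eqF// scale1r.
Qed.

End Faithful.

(** * The imprimitivity bimodule *)

Section Morita.
Variable R : realType.
Local Notation C := R[i].
Variables (A : cstarAlg R) (H : hilbert R) (K : cstarAlg R) (r : K -> H -> H).
Hypothesis fA : rep_normed A.
Hypothesis hK : is_compact_algebra r.
Variables (D : cstarAlg R) (t : A -> K -> D).
Hypothesis hD : is_cstar_tensor t.
Variable e : H.
Hypothesis e1 : nrm e = 1.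
Variables (L : cstarAlg R) (F : starHom L D) (G : starHom D L).
Hypothesis FK : cancel F G.
Hypothesis GK : cancel G F.
Variable th : H -> H -> K.
Hypothesis thE : forall xi eta u, r (th xi eta) u = ip u eta *: xi.

Let tl k : linear (t^~ k). Proof. by case: hD => -[h _] _ _ _ _; exact: h. Qed.
Let tr a : linear (t a). Proof. by case: hD => -[_ h] _ _ _ _; exact: h. Qed.
Let tM a a' k k' : cs_mul (t a k) (t a' k') = t (cs_mul a a') (cs_mul k k').
Proof. by case: hD. Qed.
Let tS a k : cs_star (t a k) = t (cs_star a) (cs_star k).
Proof. by case: hD. Qed.
Let ee : ip e e = 1. Proof. by rewrite ipE e1 expr1n. Qed.

(* a (x) p, with p the projection onto the line spanned by e *)
Definition corner_emb (a : A) : D := t a (th e e).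
Local Notation phi := corner_emb.

Lemma corner_emb_linear : linear phi.
Proof. exact: tl. Qed.

Lemma corner_embM a b : phi (cs_mul a b) = cs_mul (phi a) (phi b).
Proof. by rewrite /phi tM (thetaM hK thE) ee scale1r. Qed.

Lemma corner_embS a : phi (cs_star a) = cs_star (phi a).
Proof. by rewrite /phi tS (theta_star hK thE). Qed.

(** For the lower bound, the 1 x 1 matrix of a (x) p over the single vector e is r1 a, and
    [rep_normed] recovers the norm of a from all r1. *)
Lemma corner_emb_nrm a : nrm (phi a) = nrm a.
Proof.
apply/eqP; rewrite eq_le; apply/andP; split.
  rewrite (le_trans (cstar_tensor_cross _ _ hD))// ler_piMr ?nrm_ge0//.
  by rewrite (le_trans (theta_nrm hK thE _ _))// e1 mulr1.
apply: fA => [|H1 r1 h1 u]; first exact: nrm_ge0.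
have oe : orthonormal (fun _ : 'I_1 => e).
  by move=> i j; rewrite ee !ord1 eqxx.
have := cstar_tensor_matrix_bound hK hD (fun _ : 'I_1 => a) (fun=> th e e) h1 (fun=> u) oe.
rewrite !big_ord1 thE ipZl ee mulr1 scale1r -exprMn ler_sqr//.
  by rewrite nnegrE nrm_ge0.
by rewrite nnegrE mulr_ge0 ?nrm_ge0.
Qed.

Definition corner_ran : set D := [set d | exists a, d = phi a].

Lemma corner_ran_subspace : is_subspace corner_ran.
Proof.
split; first by exists 0; rewrite (lin0 corner_emb_linear).
by move=> c _ _ [a ->] [b ->]; exists (c *: a + b); rewrite corner_emb_linear.
Qed.

Lemma corner_ran_closed d : ncl corner_ran d -> corner_ran d.
Proof.
move=> /ncl_seq[u hu ud]; have [a ha] := choice hu.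
have [b ab] : exists b, tends a b.
  apply: ncauchy_cvg => eps e0; have [N hN] := tends_cauchy ud e0.
  exists N => m n Nm Nn.
  by rewrite -corner_emb_nrm (linB corner_emb_linear) -!ha hN.
exists b; apply: (tends_uniq ud).
rewrite (_ : u = phi \o a); last by apply/funext => n; rewrite ha.
by apply: (opbound_tends corner_emb_linear (c := 1) _ ab) => x;
  rewrite mul1r corner_emb_nrm.
Qed.

(* the module of the a (x) xi e^*, i.e. D (1 (x) p) *)
Definition col0 : set D := finsums [set d | exists a xi, d = t a (th xi e)].
Definition col : set D := ncl col0.

Lemma col0_subspace : is_subspace col0.
Proof.
apply: finsums_subspace => c _ [a [xi ->]]; exists (c *: a), xi.
by rewrite (linZ (tl _)).
Qed.

Lemma col_subspace : is_subspace col.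
Proof. exact/ncl_subspace/col0_subspace. Qed.

Lemma colI a xi : col (t a (th xi e)).
Proof. by apply: ncl_sub; apply: finsums_sub; exists a, xi. Qed.

Lemma cs_mul_bound (B : cstarAlg R) (d x y : B) :
  nrm (cs_mul d x - cs_mul d y) <= nrm d * nrm (x - y).
Proof. by rewrite -(linB (cs_linr d)) cs_normM. Qed.

Lemma cs_mul_boundr (B : cstarAlg R) (d x y : B) :
  nrm (cs_mul x d - cs_mul y d) <= nrm d * nrm (x - y).
Proof. by rewrite -(linB (cs_linl d)) mulrC cs_normM. Qed.

Lemma finsums_map (V W : normedModType C) (f : V -> W) (S : set V) (T : set W) x :
  linear f -> is_subspace T -> (forall s, S s -> T (f s)) ->
  finsums S x -> T (f x).
Proof.
move=> lf PT ST [n [s [hs ->]]]; rewrite (linsum lf).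
by apply: subspace_sum => // i _; exact: ST.
Qed.

Lemma col_mull d x : col x -> col (cs_mul d x).
Proof.
have base a k y : col y -> col (cs_mul (t a k) y).
  move=> cy; apply: (ncl_mapS (@cs_mul_bound D (t a k) y) _ cy) => z.
  apply: (finsums_map (cs_linr _) col0_subspace) => _ [b [xi ->]].
  by apply: finsums_sub; exists (cs_mul a b), (r k xi); rewrite tM (thetaMl hK thE).
move=> cx.
pose T := [set d | col (cs_mul d x)].
have ST : is_subspace T.
  split; first by rewrite /T /= (lin0 (cs_linl x)); case: col_subspace.
  by move=> c y z hy hz; rewrite /T /= (cs_linl x); case: col_subspace => _; apply.
apply: ncl_ncl; apply: (@ncl_mapS R _ _ (fun z => cs_mul z x) (nrm x) T (ncl col0) d) => //.
  exact: cs_mul_boundr.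
by apply: (tensor_dense_ind hD ST) => a k; apply: ncl_sub; exact: base.
Qed.

Lemma col_mulr x b : col x -> col (cs_mul x (phi b)).
Proof.
move=> cx; apply: (@ncl_mapS R _ _ (fun z => cs_mul z (phi b)) (nrm (phi b))
  col0 col0 x _ _ cx) => [z|z]; first exact: cs_mul_boundr.
apply: (finsums_map (cs_linl _) col0_subspace) => _ [a [xi ->]].
by apply: finsums_sub; exists (cs_mul a b), xi; rewrite tM (thetaM hK thE) ee scale1r.
Qed.

Lemma col_ip x y : col x -> col y -> corner_ran (cs_mul (cs_star x) y).
Proof.
have b0 a xi z : col z -> corner_ran (cs_mul (cs_star (t a (th xi e))) z).
  move=> cz; apply: corner_ran_closed.
  apply: (ncl_mapS (@cs_mul_bound D _ z) _ cz) => w.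
  apply: (finsums_map (cs_linr _) corner_ran_subspace) => _ [b [eta ->]].
  exists (ip eta xi *: cs_mul (cs_star a) b).
  rewrite tS tM (theta_star hK thE) (thetaM hK thE) /phi.
  by rewrite (linZ (tl _)) (linZ (tr _)).
move=> cx cy; apply: corner_ran_closed.
apply: (@ncl_mapS R _ _ (fun x => cs_mul (cs_star x) y) (nrm y) col0 _ x _ _ cx).
  by move=> z; rewrite -(cs_nrm_star (x - z)) cs_starB; exact: cs_mul_boundr.
move=> _ [n [s [hs ->]]]; rewrite cs_star_sum (linsum (cs_linl _)).
apply: subspace_sum; first exact: corner_ran_subspace.
by move=> i _; have [a [xi ->]] := hs i; exact: b0.
Qed.

(** For x = \sum_i a i (x) xi i e^*, the number <r1 y u, u> is the squared norm of \sum_i r1 (a i) u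
    (x) xi i in H1 (x) H. *)
Lemma col_ip_pos x y : col x -> cs_mul (cs_star x) x = phi y -> rep_pos y.
Proof.
move=> cx xy H1 r1 u h1.
have phiI : injective phi.
  move=> a b ab; apply/subr0_eq/nrm_eq0.
  by rewrite -corner_emb_nrm (linB corner_emb_linear) ab subrr nrm0.
have base z w : col0 z -> cs_mul (cs_star z) z = phi w -> 0 <= ip (r1 w u) u.
  move=> [n [s [hs ->]]] zw.
  have ex i : exists ax : A * H, s i = t ax.1 (th ax.2 e).
    by have [a [xi ->]] := hs i; exists (a, xi).
  have [f hf] := choice ex.
  have wE : w = \sum_i \sum_j ip (f j).2 (f i).2 *: cs_mul (cs_star (f i).1) (f j).1.
    apply: phiI; rewrite -zw cs_star_sum (linsum (cs_linl _)) (linsum corner_emb_linear).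
    apply: eq_bigr => i _; rewrite (linsum (cs_linr _)) (linsum corner_emb_linear).
    apply: eq_bigr => j _; rewrite !hf tS tM (theta_star hK thE) (thetaM hK thE) /phi.
    by rewrite (linZ (tl _)) (linZ (tr _)).
  have [H2 [t' ht']] := hilbert_tensor_exists H1 H.
  rewrite (_ : ip _ _ = ip (\sum_j t' (r1 (f j).1 u) (f j).2)
                           (\sum_j t' (r1 (f j).1 u) (f j).2)) ?ip_ge0//.
  rewrite wE (star_rep_sum _ _ _ _ h1) ip_suml ip_sumr; apply: eq_bigr => i _.
  rewrite (star_rep_sum _ _ _ _ h1) !ip_suml; apply: eq_bigr => j _.
  rewrite (linZ (star_rep_linl u h1)) ipZl (star_rep_mul _ _ _ h1).
  by rewrite (star_rep_star _ _ _ h1) (ten_ip ht') mulrC.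
have [v hv vx] := ncl_seq cx.
have [w hw] := choice (fun n => col_ip (ncl_sub (hv n)) (ncl_sub (hv n))).
have wy : tends w y.
  move=> eps eps0; have [N hN] := tends_mul (tends_star vx) vx eps0; exists N => n /hN.
  by rewrite xy hw -(linB corner_emb_linear) corner_emb_nrm.
apply: (tends_ge0 (tends_ipl u (opbound_tends (star_rep_linl u h1) (c := nrm u) _ wy))).
  by move=> z; rewrite mulrC; exact: star_rep_contractive.
by move=> n; exact: base (hv n) (hw n).
Qed.

(** For fullness over D: only elements whose first leg is a product bc factor as x y^* with x and y
    in the module. *)
Lemma products_finsums (T : set D) :
  is_subspace T -> (forall a b xi eta, T (t (cs_mul a b) (th xi eta))) ->
  forall d, ncl T d.
Proof.
move=> ST hT; apply: (tensor_dense_ind hD ST) => a k.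
have h xi eta : ncl T (t a (th xi eta)).
  apply: (@ncl_mapS R _ _ (t^~ (th xi eta)) (nrm (th xi eta))
    [set x | exists b c : A, x = cs_mul b c] T a _ _ (products_dense fA a)).
    move=> y; rewrite -(linB (tl _)) mulrC; exact: cstar_tensor_cross.
  by move=> _ [b [c ->]]; exact: hT.
have SP : is_subspace [set k | ncl T (t a k)].
  have [n0 nL] := ncl_subspace ST.
  split; first by rewrite /= (lin0 (tr a)).
  by move=> c x y hx hy; rewrite /= (tr a); exact: nL.
apply: ncl_ncl; apply: (@ncl_mapS R _ _ (t a) (nrm a) [set k | ncl T (t a k)]
  (ncl T) k _ _ (theta_span_dense hK thE SP h k)) => // y.
by rewrite -(linB (tr a)); exact: cstar_tensor_cross.
Qed.

Theorem stable_morita_equivalent : morita_equivalent L A.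
Proof.
have [c0 cL] := col_subspace.
have [||||V [i [li Pi Si Ni]]] := @subBanach_exists R D col (@nrm R D) c0 cL.
- by move=> x y _ _; exact: nrmD.
- by move=> a x _; exact: nrmZ.
- by move=> x _; exact: nrm_eq0.
- move=> u hu uC; have [l ul] := ncauchy_cvg uC; exists l; last exact: ul.
  exact: ncl_closed hu ul.
have iI : injective i.
  by move=> x y xy; apply/subr0_eq/nrm_eq0; rewrite Ni (linB li) xy subrr nrm0.
have [l' hl] := choice (fun z : L * V => Si _ (col_mull (F z.1) (Pi z.2))).
have [r' hr] := choice (fun z : V * A => Si _ (col_mulr z.2 (Pi z.1))).
have [q' hq] := choice (fun z : V * V => col_ip (Pi z.1) (Pi z.2)).
pose l a x := l' (a, x); pose rr x b := r' (x, b); pose rip x y := q' (x, y).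
pose lip x y := G (cs_mul (i x) (cs_star (i y))).
have lE a x : i (l a x) = cs_mul (F a) (i x) by exact: hl.
have rE x b : i (rr x b) = cs_mul (i x) (phi b) by exact: hr.
have qE x y : phi (rip x y) = cs_mul (cs_star (i x)) (i y) by rewrite -hq.
have phiI : injective phi.
  move=> a b ab; apply/subr0_eq/nrm_eq0.
  by rewrite -corner_emb_nrm (linB corner_emb_linear) ab subrr nrm0.
have colV a xi : exists v, i v = t a (th xi e) by apply: Si; exact: colI.
refine (ex_intro _ (@ImprimitivityBimodule R L A V l rr lip rip
  _ _ _ _ _ _ _ _ _ _ _ _ _ _ _ _ _ _ _ _) I).
- split=> [x a y z|a b x y]; apply: iI; rewrite li !lE.
    by rewrite linearP (cs_linl (i x)).
  by rewrite li (cs_linr (F a)).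
- split=> [x a y z|a b x y]; apply: iI; rewrite li !rE.
    by rewrite li (cs_linl (phi x)).
  by rewrite corner_emb_linear (cs_linr (i a)).
- by move=> a a' x; apply: iI; rewrite !lE sh_mul cs_mulA.
- by move=> x b b'; apply: iI; rewrite !rE corner_embM cs_mulA.
- by move=> a x b; apply: iI; rewrite !(lE, rE) cs_mulA.
- by move=> y a x z; rewrite /lip li (cs_linl _) linearP.
- by move=> x y; rewrite /lip -sh_star cs_starM cs_starK.
- by move=> a x y; rewrite /lip lE -[a in RHS]FK -sh_mul cs_mulA.
- move=> x; exists (G (cs_star (i x))).
  by rewrite /lip -sh_star -sh_mul cs_starK.
- move=> x; rewrite /lip (starIso_nrm _ GK) Ni -{1}[i x]cs_starK cs_normC.
  by rewrite cs_nrm_star.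
- apply/ndenseP => a; rewrite -[a]FK.
  pose T : set D := finsums [set d | exists x y, d = cs_mul (i x) (cs_star (i y))].
  have ST : is_subspace T.
    apply: finsums_subspace => c _ [x [y ->]]; exists (c *: x), y.
    by rewrite (linZ li) (linZ (cs_linl _)).
  have dT : ncl T (F a).
    apply: (products_finsums ST) => b c xi eta; apply: finsums_sub.
    (* bc (x) xi eta^* is x y^* for x = b (x) xi e^* and y = c^* (x) eta e^*. *)
    have [x hx] := colV b xi; have [y hy] := colV (cs_star c) eta.
    exists x, y; rewrite hx hy tS tM (theta_star hK thE) (thetaM hK thE) ee.
    by rewrite scale1r cs_starK.
  apply: (@ncl_mapS R _ _ G 1 T _ (F a) _ _ dT).
    by move=> y; rewrite mul1r -linearB starHom_contractive.
  move=> _ [n [s [hs ->]]]; exists n, (fun j => G (s j)); split.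
    by move=> j; have [x [y ->]] := hs j; exists x, y.
  by rewrite linear_sum.
- move=> x a y z; apply: phiI; rewrite corner_emb_linear !qE li.
  by rewrite (cs_linr _).
- by move=> x y; apply: phiI; rewrite corner_embS !qE cs_starM cs_starK.
- by move=> x y b; apply: phiI; rewrite corner_embM !qE rE cs_mulA.
(* x itself is not in the corner, so x^* x being of the form b^* b with b in A requires a square
   root in A. *)
- move=> x; apply: (positive_sqrt fA); last first.
    by apply: phiI; rewrite corner_embS qE cs_starM cs_starK.
  exact: (col_ip_pos (Pi x) (esym (qE x x))).
- by move=> x; rewrite -corner_emb_nrm qE cs_normC Ni.
- apply/ndenseP => a.
  apply: ncl_mono (products_dense fA a) => _ [b [c ->]]; apply: finsums_sub.
  have [x hx] := colV (cs_star b) e; have [y hy] := colV c e.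
  exists x, y; apply: phiI; rewrite qE hx hy corner_embM -/(phi _) corner_embS.
  by rewrite cs_starK.
- by move=> a x y; apply: phiI; rewrite !qE !lE cs_starM sh_star cs_mulA.
- by move=> x y b; rewrite /lip !rE cs_starM corner_embS cs_starK cs_mulA.
- move=> x y z; apply: iI; rewrite lE rE qE /lip GK cs_mulA //.
Qed.

End Morita.

(** * Crossed products *)

Section CrossedProductReps.
Variable R : realType.
Local Notation C := R[i].
Variables (G : groupData R) (X : topologicalType) (act : G -> X -> X).
Variables (sigma : G -> G -> C) (A : cstarAlg R) (j : (G -> X -> C) -> A).
Hypothesis hA : is_crossed_product act sigma j.
Hypothesis Cc_lin : forall (a : C) F1 F2, @Cc R G X F1 -> Cc F2 ->
  Cc (fun g x => a * F1 g x + F2 g x).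
Hypothesis Cc_mul : forall F1 F2, @Cc R G X F1 -> Cc F2 ->
  Cc (cp_mul act sigma F1 F2).
Hypothesis Cc_star : forall F, @Cc R G X F -> Cc (cp_star act sigma F).

Lemma cp_rep_bound (H : hilbert R) (r : (G -> X -> C) -> H -> H) F :
  cp_is_rep act sigma r -> Cc F -> opbound (r F) (nrm (j F)).
Proof.
move=> hr cF; have [_ rb _ _] := hr; have [_ bF] := rb F cF.
have [c hc] := opnorm_exists bF.
have [_ _ _ _ /(_ F cF)[ub _]] := hA.
by apply: opbound_le (ub c _) _; [exists H, r|case: hc].
Qed.

(** The norm of j F dominates that of r F, so for each vector u the map j F |-> r F u extends to A.
    This needs no injectivity of j; the algebraic laws follow by approximation. *)
Lemma cp_rep_extend (H : hilbert R) (r : (G -> X -> C) -> H -> H) :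
  cp_is_rep act sigma r ->
  exists2 pi : A -> H -> H, is_star_rep pi & forall F, Cc F -> pi (j F) = r F.
Proof.
move=> hr; have [rlin rb rM rS] := hr.
have [jlin jM jS /ndenseP jd _] := hA.
have ex u : exists f : A -> H, [/\ linear f, opbound f (nrm u) &
    forall F, Cc F -> f (j F) = r F u].
  pose Gr (x : A) (y : H) := exists F, [/\ Cc F, x = j F & y = r F u].
  have [||||f [lf bf fG _]] := @extend_graph _ A H Gr (nrm u).
  - exact: nrm_ge0.
  - move=> a _ _ _ _ [F1 [c1 -> ->]] [F2 [c2 -> ->]].
    exists (fun g x => a * F1 g x + F2 g x).
    by split; [exact: Cc_lin|rewrite jlin|rewrite rlin].
  - by move=> _ _ [F [cF -> ->]]; rewrite mulrC; exact: cp_rep_bound.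
  - move=> x e e0; have [_ [F cF <-] xF] := jd x e e0.
    by exists (j F) => //; exists (r F u), F.
  by exists f; split=> // F cF; apply: fG; exists F.
have [f hf] := choice ex.
pose pi x u := f u x.
have piE F u : Cc F -> pi (j F) u = r F u by case: (hf u) => _ _; apply.
have pil u : linear (pi^~ u) by case: (hf u).
have pib x u : nrm (pi x u) <= nrm x * nrm u.
  by rewrite mulrC; case: (hf u) => _ b _; exact: b.
have sq x : exists2 F : nat -> G -> X -> C, forall n, Cc (F n) &
    tends (fun n => j (F n)) x.
  have [v hv vx] := ncl_seq (jd x).
  have ex' n : exists F, Cc F /\ j F = v n by have [F cF <-] := hv n; exists F.
  have [F hF] := choice ex'; exists F => [n|]; first by case: (hF n).
  by rewrite (_ : (fun n => _) = v)//; apply/funext => n; case: (hF n).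
have pit u (x : nat -> A) l : tends x l -> tends (fun n => pi (x n) u) (pi l u).
  by move=> xl; apply: (opbound_tends (pil u) (c := nrm u)) xl => y; rewrite mulrC.
have pilr x : linear (pi x).
  move=> a u v; have [F cF Fx] := sq x.
  apply: (tends_uniq (pit _ _ _ Fx)).
  rewrite (_ : (fun n => _) = (fun n => a *: pi (j (F n)) u + pi (j (F n)) v)).
    by apply: tendsL; exact: pit.
  apply/funext => n; rewrite !piE//.
  by have [lr _] := rb _ (cF n); exact: lr.
exists pi; last first.
  by move=> F cF; apply/funext => u; rewrite piE.
split.
- by split.
- by exists 1 => x u; rewrite mul1r.
(* Multiplicativity is extended in one factor at a time; the second factor uses the boundedness of
   pi x. *)
- have step F' x u : Cc F' -> pi (cs_mul x (j F')) u = pi x (pi (j F') u).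
    move=> cF'; have [F cF Fx] := sq x.
    apply: (tends_uniq (pit u _ _ (tends_mul Fx (tends_cst (j F'))))).
    rewrite (_ : (fun n => _) = (fun n => pi (j (F n)) (pi (j F') u))); first exact: pit.
    by apply/funext => n; rewrite -jM// !piE ?rM//; exact: Cc_mul.
  move=> x y u; have [F cF Fy] := sq y.
  apply: (tends_uniq (pit u _ _ (tends_mul (tends_cst x) Fy))).
  rewrite (_ : (fun n => _) = (fun n => pi x (pi (j (F n)) u))).
    by apply: (opbound_tends (pilr x) (c := nrm x)) (pit u _ _ Fy) => v; exact: pib.
  by apply/funext => n; rewrite step.
- move=> x u v; have [F cF Fx] := sq x.
  apply: (tends_uniq (tends_ipl v (pit u _ _ (tends_star Fx)))).
  rewrite (_ : (fun n => _) = (fun n => ip u (pi (j (F n)) v) : C^o)).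
    exact/tends_ipr/pit.
  by apply/funext => n; rewrite -jS// !piE ?rS//; exact: Cc_star.
Qed.

(** On the dense image of j the norm is by definition a supremum over representations of the
    convolution algebra, and each of these extends to A. *)
Lemma crossed_product_rep_normed : rep_normed A.
Proof.
move=> a c c0 hc; apply/ler_addgt0Pl => e e0; have e2 : 0 < e / 2 by rewrite divr_gt0.
have [_ _ _ /ndenseP jd _] := hA.
have [_ [F cF <-] aF] := jd a _ e2.
rewrite (le_trans (nrm_le_dist _ (j F)))// (splitr e) -addrA lerD//; first exact: ltW.
have [_ _ _ _ /(_ F cF)[_]] := hA; apply => d [H [r [hr [d0 bd dm]]]].
apply: dm; first by rewrite addr_ge0// ltW.
have [pi hpi piE] := cp_rep_extend hr; move=> u; rewrite -piE//.
rewrite (le_trans (nrm_le_dist _ (pi a u)))// mulrDl lerD//; last exact: hc.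
rewrite nrmB -(linB (star_rep_linl u hpi)) (le_trans (star_rep_contractive _ hpi _))//.
by rewrite ler_wpM2r ?nrm_ge0// ltW.
Qed.

End CrossedProductReps.

(** * Compactly supported functions with values in C_0(X) *)

Section CompactSupport.
Variable R : realType.
Local Notation C := R[i].
Variables (G X : topologicalType).
Implicit Types F : G -> X -> C.

Lemma Cc_joint F : Cc F -> continuous ((fun z : G * X => F z.1 z.2) : G * X -> C^o).
Proof.
move=> [F0 Fu _]; apply/contCP => -[g0 x0] e e0.
have e2 : 0 < e / 2 by rewrite divr_gt0.
have [fc _] := F0 g0.
have h1 := Fu g0 _ (divr_gt0 e2 (ltr0n R 2)).
have h2 := (proj1 (contCP _) fc) x0 _ e2.
exists ([set g | forall x, nrm (F g x - F g0 x : C^o) <= e / 2 / 2],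
        [set x | cn (F g0 x - F g0 x0) < e / 2]) => //=.
move=> [g x] [/= hg hx]; rewrite (splitr e).
rewrite (_ : F g x - F g0 x0 = (F g x - F g0 x) + (F g0 x - F g0 x0)); last first.
  by rewrite addrA subrK.
rewrite (le_lt_trans (cnD _ _))// ltr_leD//; last exact: ltW.
by rewrite (le_lt_trans (hg x))// ltr_pdivrMr// ltr_pMr// ltr1n.
Qed.

Lemma Cc_uniform_C0 F (e : R) : Cc F -> 0 < e ->
  exists2 K, compact K & forall g x, ~ K x -> cn (F g x) < e.
Proof.
move=> [F0 Fu [K cK hK]] e0.
(* The filter of large compact sets: finitely many compact subsets of X, one for each piece of a
   cover of K, are absorbed by their union. *)
pose FX : set_system (set X) :=
  filter_from [set K : set X | compact K] (fun K => [set K' | K `<=` K']).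
have FF : Filter FX.
  apply: filter_from_filter; first by exists set0; exact: compact0.
  move=> A B cA cB; exists (A `|` B); first exact: compactU.
  by move=> D AB; split=> x Ax; apply: AB; [left|right].
have : \forall K' \near FX, forall g, K g -> forall x, ~ K' x -> cn (F g x) < e.
  apply: compact_near cK _ => g _.
  have e2 : 0 < e / 2 by rewrite divr_gt0.
  have [_ /(_ _ e2)[K' cK' hK']] := F0 g.
  exists ([set g' | forall x, nrm (F g' x - F g x : C^o) <= e / 2],
    [set K1 | K' `<=` K1]); first by split; [exact: Fu|exists K'].
  move=> [g' K1] [/= hg K1'] x nK.
  rewrite -[F g' x](subrK (F g x)) (le_lt_trans (cnD _ _))// (splitr e).
  by rewrite ler_ltD//; [exact: hg|apply: hK' => /K1'].
move=> [K' cK' hK']; exists K' => // g x nx.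
have [Kg|nKg] := pselect (K g); first by apply: (hK' K').
by rewrite hK// cn0.
Qed.

Lemma Cc_bounded F : Cc F -> exists2 M : R, 0 <= M & forall g x, cn (F g x) <= M.
Proof.
move=> cF; have [_ _ [K cK hK]] := cF; have [K' cK' hK'] := Cc_uniform_C0 cF ltr01.
have : \forall M \near +oo%R, forall z, (K `*` K') z -> cn (F z.1 z.2) <= M :> R.
  apply: compact_near (compact_setX cK cK') _ => z _.
  exists ([set z' | cn (F z'.1 z'.2 - F z.1 z.2) < 1], [set M | 1 + cn (F z.1 z.2) <= M]).
    split; first exact: (proj1 (contCP _) (Cc_joint cF) z _ ltr01).
    exact: (nbhs_pinfty_ge (num_real _)).
  move=> [z' M] [/= hz hM]; rewrite -[F z'.1 _](subrK (F z.1 z.2)).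
  by rewrite (le_trans (cnD _ _))// (le_trans _ hM)// lerD2r ltW.
move=> hM; have [M [hM1 M1]] := filter_ex (filterI hM (nbhs_pinfty_ge (num_real 1))).
have M0 : 0 <= M by exact: le_trans M1.
exists M => // g x; have [Kg|nKg] := pselect (K g); last by rewrite (hK _ nKg) cn0.
have [Kx|nx] := pselect (K' x); first exact: (hM1 (g, x)).
by rewrite (le_trans (ltW (hK' g x nx))).
Qed.

Lemma Cc_linear (a : C) F1 F2 : Cc F1 -> Cc F2 ->
  Cc (fun g x => a * F1 g x + F2 g x).
Proof.
move=> cF1 cF2; have [F10 F1u [K1 cK1 hK1]] := cF1; have [F20 F2u [K2 cK2 hK2]] := cF2.
have a1 : 0 < cn a + 1 by rewrite ltr_wpDl ?cn_ge0.
have bnd (e p q : R) : p <= e / 2 / (cn a + 1) -> q <= e / 2 -> 0 < e ->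
    cn a * p + q <= e.
  move=> hp hq e0; rewrite (splitr e) lerD//.
  rewrite (le_trans (ler_wpM2l (cn_ge0 a) hp))// mulrA ler_pdivrMr// mulrC.
  by rewrite ler_wpM2l ?divr_ge0 ?(ltW e0)// lerDl.
have lin x y x' y' : (a * x + y) - (a * x' + y') = a * (x - x') + (y - y').
  by ring.
split.
- move=> g; have [f1 f10] := F10 g; have [f2 f20] := F20 g; split.
    move=> x; apply: cvgD; last exact: f2.
    by apply: cvgM; [exact: cvg_cst|exact: f1].
  move=> e e0; have e2 : 0 < e / 2 by rewrite divr_gt0.
  have e4 : 0 < e / 2 / 2 by rewrite divr_gt0.
  have [A cA hA] := f10 _ (divr_gt0 e4 a1).
  have [B cB hB] := f20 _ e4.
  exists (A `|` B); first exact: compactU.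
  move=> x /not_orP[nA nB].
  apply: (@le_lt_trans _ _ (e / 2)); last by rewrite {2}(splitr e) ltrDl.
  apply: (le_trans (cnD _ _)); rewrite cnM; apply: bnd => //.
    exact/ltW/hA.
  exact/ltW/hB.
- move=> g0 e e0; have e2 : 0 < e / 2 by rewrite divr_gt0.
  have h1 := F1u g0 _ (divr_gt0 e2 a1); have h2 := F2u g0 _ e2.
  apply: filterS2 h1 h2 => g hg1 hg2 x.
  have -> : (a * F1 g x + F2 g x - (a * F1 g0 x + F2 g0 x) : C^o) =
    a * (F1 g x - F1 g0 x) + (F2 g x - F2 g0 x) by exact: lin.
  apply: (le_trans (cnD _ _)); rewrite cnM; apply: bnd => //; [exact: hg1|exact: hg2].
- exists (K1 `|` K2); first exact: compactU.
  by move=> g /not_orP[n1 n2] x; rewrite hK1// hK2// mulr0 addr0.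
Qed.

(** Converse of [Cc_joint]: uniformity in x comes from joint continuity over a compact subset of X,
    and from smallness outside it. That compact set has to serve all g near g0. *)
Lemma Cc_of_joint F :
  continuous ((fun z : G * X => F z.1 z.2) : G * X -> C^o) ->
  (forall (g0 : G) (e : R), 0 < e -> exists2 K : set X, compact K &
    \forall g \near g0, forall x, ~ K x -> cn (F g x) < e) ->
  (exists2 K : set G, compact K & forall g, ~ K g -> forall x, F g x = 0) ->
  Cc F.
Proof.
move=> /contCP Fj Fv Fs; split=> //.
- move=> g; split.
    apply/contCP => x0 e e0; have [[A B] [/= Ag Bx] AB] := Fj (g, x0) e e0.
    apply: filterS Bx => x Bx; apply: (AB (g, x)); split=> //=.
    exact: nbhs_singleton Ag.
  move=> e e0; have [K cK hK] := Fv g e e0; exists K => // x nx.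
  exact: (nbhs_singleton hK).
- move=> g0 e e0; have e2 : 0 < e / 2 by rewrite divr_gt0.
  have [K cK hK] := Fv g0 _ e2.
  have hn : \forall g \near g0, forall x, K x -> cn (F g x - F g0 x) <= e.
    apply: compact_near cK _ => x _.
    have [[A B] [/= Ag Bx] AB] := Fj (g0, x) _ e2.
    exists (B, A) => // -[x' g] [/= Bx' Ag'].
    have h1 := AB (g, x') (conj Ag' Bx').
    have h2 := AB (g0, x') (conj (nbhs_singleton Ag) Bx').
    rewrite /= in h1 h2; rewrite (_ : _ - _ = (F g x' - F g0 x) - (F g0 x' - F g0 x)).
      by rewrite (le_trans (cnD _ _))// cnN (splitr e) lerD// ltW.
    by rewrite opprB addrA subrK.
  have hv0 := nbhs_singleton hK; apply: filterS2 hn hK => g hg hv x; have [Kx|nx] := pselect (K x); first exact: hg.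
  apply: (le_trans (cnD (F g x) (- F g0 x))); rewrite cnN (splitr e) lerD// ltW//.
    exact: hv.
  exact: hv0.
Qed.

End CompactSupport.

(** * Closure of the convolution algebra under its operations *)

Section Convolution.
Variable R : realType.
Local Notation C := R[i].
Variables (G : groupData R) (X : topologicalType) (act : G -> X -> X).
Variable sigma : G -> G -> C.
Hypothesis mul_cont : continuous (fun z : G * G => gd_mul z.1 z.2).
Hypothesis inv_cont : continuous (@gd_inv R G).
Hypothesis act_cont : continuous (fun z : G * X => act z.1 z.2).
Hypothesis sigma_cont : continuous ((fun z : G * G => sigma z.1 z.2) : G * G -> C^o).
Hypothesis sigma1 : forall g h, cn (sigma g h) <= 1.
Hypothesis mulVK : forall h g : G, gd_mul h (gd_mul (gd_inv h) g) = g.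
Hypothesis invK : forall g : G, gd_inv (gd_inv g) = g.
Hypothesis actVK : forall g x, act g (act (gd_inv g) x) = x.
Hypothesis G_lc : forall g0 : G, exists2 N, compact N & nbhs g0 N.
Hypothesis haar0 : gd_haar (fun _ : G => 0) = 0.
(** The Haar integral enters only through this Lipschitz property for the sup norm on functions with
    support in a fixed compact set, and through [haar0]. *)
Hypothesis haar_dist : forall K : set G, compact K -> exists2 c : R, 0 <= c &
  forall (f f' : G -> R) (e : R), continuous (f : G -> R^o) ->
    continuous (f' : G -> R^o) ->
    (forall g, ~ K g -> f g = 0) -> (forall g, ~ K g -> f' g = 0) ->
    (forall g, `|f g - f' g| <= e) -> `|gd_haar f - gd_haar f'| <= c * e.

Lemma haarC0 : haarC (fun _ : G => 0) = 0.
Proof. by rewrite /haarC /= haar0. Qed.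

Lemma haarC_dist (K : set G) : compact K -> exists2 c : R, 0 <= c &
  forall (f f' : G -> C) (e : R), continuous (f : G -> C^o) ->
    continuous (f' : G -> C^o) ->
    (forall g, ~ K g -> f g = 0) -> (forall g, ~ K g -> f' g = 0) ->
    (forall g, cn (f g - f' g) <= e) -> cn (haarC f - haarC f') <= c * e.
Proof.
move=> cK; have [c c0 hc] := haar_dist cK; exists (2 * c); first by rewrite mulr_ge0.
move=> f f' e fc fc' f0 f0' ff'; rewrite (le_trans (cn_le_ReIm _))//.
rewrite (_ : 2 * c * e = c * e + c * e); last by ring.
rewrite lerD//.
  apply: hc; [exact: contC_Re|exact: contC_Re| | |].
  - by move=> g ng; rewrite f0.
  - by move=> g ng; rewrite f0'.
  - by move=> g; rewrite -raddfB (le_trans (cn_ge_Re _)).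
apply: hc; [exact: contC_Im|exact: contC_Im| | |].
- by move=> g ng; rewrite f0.
- by move=> g ng; rewrite f0'.
- by move=> g; rewrite -raddfB (le_trans (cn_ge_Im _)).
Qed.

Lemma cont_pair (T U V : topologicalType) (f : T -> U) (g : T -> V) :
  continuous f -> continuous g -> continuous (fun z => (f z, g z)).
Proof. by move=> fc gc z; apply: cvg_pair; [exact: fc|exact: gc]. Qed.

Lemma cont_comp2 (T U V W : topologicalType) (h : U * V -> W) (f : T -> U)
    (g : T -> V) : continuous h -> continuous f -> continuous g ->
  continuous (fun z => h (f z, g z)).
Proof.
move=> hc fc gc z; apply: (@cvg_comp _ _ _ (fun z => (f z, g z)) h).
  exact: cont_pair.
exact: hc.
Qed.

Lemma cont_fst (T U : topologicalType) : continuous (@fst T U).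
Proof. by move=> z; exact: cvg_fst. Qed.
Lemma cont_snd (T U : topologicalType) : continuous (@snd T U).
Proof. by move=> z; exact: cvg_snd. Qed.
Lemma cont_comp (T U V : topologicalType) (f : U -> V) (g : T -> U) :
  continuous f -> continuous g -> continuous (fun z => f (g z)).
Proof. by move=> fc gc z; apply: (@cvg_comp _ _ _ g f); [exact: gc|exact: fc]. Qed.

Lemma cp_integrand_cont F1 F2 : @Cc R G X F1 -> Cc F2 ->
  continuous ((fun z : (G * X) * G => F1 z.2 z.1.2 *
    F2 (gd_mul (gd_inv z.2) z.1.1) (act (gd_inv z.2) z.1.2) *
    sigma z.2 (gd_mul (gd_inv z.2) z.1.1)) : (G * X) * G -> C^o).
Proof.
move=> /Cc_joint c1 /Cc_joint c2.
have s : continuous (@snd (G * X)%type G) by exact: cont_snd.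
have f1 : continuous (fun z : (G * X) * G => z.1.1).
  by apply: (cont_comp (@cont_fst G X)); exact: cont_fst.
have f2 : continuous (fun z : (G * X) * G => z.1.2).
  by apply: (cont_comp (@cont_snd G X)); exact: cont_fst.
have i : continuous (fun z : (G * X) * G => gd_inv z.2) by exact: cont_comp inv_cont s.
have m := cont_comp2 mul_cont i f1.
have a := cont_comp2 act_cont i f2.
apply: contC_mul; last exact: (cont_comp2 sigma_cont s m).
apply: contC_mul; first exact: (cont_comp2 c1 s f2).
exact: (cont_comp2 c2 m a).
Qed.

(** F1 confines the integration variable h to a compact set K1, over which joint continuity is
    uniform. Decay in x comes from F1 h x alone, F2 being bounded, and the support lies in the
    product K1 K2. *)
Lemma Cc_cp_mul F1 F2 : @Cc R G X F1 -> Cc F2 -> Cc (cp_mul act sigma F1 F2).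
Proof.
move=> cF1 cF2; have Pc := cp_integrand_cont cF1 cF2.
set Psi := (fun z : (G * X) * G => _) in Pc.
have [M1 M10 hM1] := Cc_bounded cF1; have [M2 M20 hM2] := Cc_bounded cF2.
have [_ _ [K1 cK1 hK1]] := cF1; have [_ _ [K2 cK2 hK2]] := cF2.
have [c c0 hc] := haarC_dist cK1.
have Psi0 z h : ~ K1 h -> Psi (z, h) = 0.
  by move=> nh; rewrite /Psi /= hK1// !mul0r.
have Psic z : continuous ((fun h => Psi (z, h)) : G -> C^o).
  by apply: (cont_comp2 Pc); [exact: cst_continuous|move=> h; exact: cvg_id].
have PsiB z h : cn (Psi (z, h)) <= cn (F1 h z.2) * M2.
  rewrite /Psi /= !cnM -[leRHS]mulr1 ler_pM ?mulr_ge0 ?cn_ge0//.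
  by rewrite ler_wpM2l ?cn_ge0.
have TE g x : cp_mul act sigma F1 F2 g x = haarC (fun h => Psi ((g, x), h)) by [].
apply: Cc_of_joint.
- apply/contCP => z0 e e0.
  have d0 : 0 < e / (c + 1) by rewrite divr_gt0// ltr_wpDl.
  have d2 : 0 < e / (c + 1) / 2 by rewrite divr_gt0.
  have hn : \forall z \near z0, forall h, K1 h ->
      cn (Psi (z, h) - Psi (z0, h)) <= e / (c + 1).
    apply: (compact_near (nbhs_filter z0) cK1) => h _.
    have [[A B] [/= Az Bh] AB] := (proj1 (contCP _) Pc) (z0, h) _ d2.
    exists (B, A) => // -[h' z] [/= Bh' Az'].
    have h1 := AB (z, h') (conj Az' Bh').
    have h2 := AB (z0, h') (conj (nbhs_singleton Az) Bh').
    rewrite (_ : _ - _ = (Psi (z, h') - Psi (z0, h)) - (Psi (z0, h') - Psi (z0, h))).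
      rewrite (le_trans (cnD _ _))// cnN (splitr (e / (c + 1))) lerD// ltW//.
    by rewrite opprB addrA subrK.
  apply: filterS hn => z hz; rewrite !TE -!surjective_pairing.
  apply: (@le_lt_trans _ _ (c * (e / (c + 1)))).
    apply: hc => //; [by move=> g; exact: Psi0|by move=> g; exact: Psi0|].
    move=> h; have [Kh|nh] := pselect (K1 h); first exact: hz.
    by rewrite !Psi0// subrr cn0 ltW.
  by rewrite mulrA ltr_pdivrMr ?ltr_wpDl// mulrC ltr_pM2l// ltrDl.
- move=> g0 e e0.
  have k1 : 0 < c * M2 + 1 by rewrite ltr_wpDl// mulr_ge0.
  have [K cK hK] := Cc_uniform_C0 cF1 (divr_gt0 e0 k1).
  exists K => //; apply: nearW => g x nx; rewrite TE.
  rewrite -[haarC _]subr0 -haarC0.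
  apply: (@le_lt_trans _ _ (c * (e / (c * M2 + 1) * M2))).
    apply: hc => //; [exact: cst_continuous|by move=> h; exact: Psi0|].
    move=> h; rewrite subr0 (le_trans (PsiB _ _))// ler_wpM2r// ltW//.
    exact: hK.
  rewrite (_ : c * _ = e * ((c * M2) / (c * M2 + 1))); last first.
    by field; rewrite gt_eqF.
  by rewrite gtr_pMr// ltr_pdivrMr// mul1r ltrDl.
- exists ((fun z : G * G => gd_mul z.1 z.2) @` (K1 `*` K2)).
    apply: continuous_compact; first exact: continuous_subspaceT.
    exact: compact_setX.
  move=> g ng x; rewrite TE (_ : (fun h => _) = (fun _ : G => 0)) ?haarC0//.
  apply/funext => h; have [Kh|nh] := pselect (K1 h); last exact: Psi0.
  rewrite /Psi /= hK2 ?mulr0 ?mul0r// => K2h; apply: ng.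
  by exists (h, gd_mul (gd_inv h) g) => //=.
Qed.

Lemma Cc_cp_star F : @Cc R G X F -> Cc (cp_star act sigma F).
Proof.
move=> cF; have [_ _ [K cK hK]] := cF.
have inv1 : continuous (fun z : G * X => gd_inv z.1).
  by apply: (cont_comp inv_cont); exact: cont_fst.
apply: Cc_of_joint.
- apply: contC_mul; apply: contC_conj.
    by apply: (cont_comp2 sigma_cont) => //; exact: cont_fst.
  apply: (cont_comp2 (Cc_joint cF) inv1).
  by apply: (cont_comp2 act_cont inv1); exact: cont_snd.
- move=> g0 e e0; have [K' cK' hK'] := Cc_uniform_C0 cF e0.
  (* The value at x involves F at g^-1 x, so x has to avoid g K' for all g near g0 at once; N K' is
     a compact set containing them. *)
  have [N cN hN] := G_lc g0.
  exists ((fun z : G * X => act z.1 z.2) @` (N `*` K')).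
    apply: continuous_compact; first exact: continuous_subspaceT.
    exact: compact_setX.
  apply: filterS hN => g Ng x nx; rewrite cnM !cnJ.
  apply: (@le_lt_trans _ _ (1 * cn (F (gd_inv g) (act (gd_inv g) x)))).
    by rewrite ler_wpM2r ?cn_ge0.
  rewrite mul1r; apply: hK' => Kx; apply: nx.
  by exists (g, act (gd_inv g) x) => //=; rewrite actVK.
- exists (@gd_inv R G @` K).
    by apply: continuous_compact => //; exact: continuous_subspaceT.
  move=> g ng x; rewrite /cp_star hK ?conjC0 ?mulr0// => Kg; apply: ng.
  by exists (gd_inv g) => //; rewrite invK.
Qed.

End Convolution.

(** * The group T x Pi_T and its action *)

Section CircleGroup.
Variable R : realType.
Local Notation C := R[i].
Local Notation T := (circle R).

Lemma circle_valP (z : T) : (set_val z : C) * (set_val z)^* = 1.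
Proof. by have /set_mem := valP z. Qed.

Lemma circle_val_inj (z w : T) : set_val z = set_val w -> z = w.
Proof. by move=> h; apply: val_inj. Qed.

Lemma circle_cn (z : T) : cn (set_val z : C) = 1.
Proof.
have := circle_valP z; rewrite -cn_sqr => /complexI/eqP.
by rewrite sqrp_eq1 ?cn_ge0// => /eqP.
Qed.

Lemma circle_mulE (z w : T) :
  set_val (circle_mul z w) = (set_val z : C) * set_val w :> C.
Proof. by []. Qed.

Lemma circle_invE (z : T) : set_val (circle_inv z) = (set_val z : C)^* :> C.
Proof. by []. Qed.

Lemma circle_mulVK (z w : T) : circle_mul z (circle_mul (circle_inv z) w) = w.
Proof.
apply: circle_val_inj.
by rewrite !circle_mulE circle_invE mulrA circle_valP mul1r.
Qed.

Lemma circle_invK (z : T) : circle_inv (circle_inv z) = z.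
Proof. by apply: circle_val_inj; rewrite !circle_invE conjCK. Qed.

Lemma circle_cont (U : topologicalType) (f : U -> T) :
  continuous ((fun u => set_val (f u)) : U -> C^o) -> continuous f.
Proof.
exact: continuous_comp_initial.
Qed.

Lemma circle_val_cont : continuous (set_val : T -> C^o).
Proof. exact: initial_continuous. Qed.

Lemma circle_mul_cont : continuous (fun z : T * T => circle_mul z.1 z.2).
Proof.
apply: circle_cont.
apply: (@contC_mul _ _ (fun z : T * T => set_val z.1 : C) (fun z => set_val z.2 : C)).
  by apply: (cont_comp circle_val_cont); exact: cont_fst.
by apply: (cont_comp circle_val_cont); exact: cont_snd.
Qed.

Lemma circle_inv_cont : continuous (@circle_inv R).
Proof. by apply: circle_cont; apply: contC_conj; exact: circle_val_cont. Qed.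

Lemma contC_ext (U : topologicalType) (f g : U -> C) : f =1 g ->
  continuous (f : U -> C^o) -> continuous (g : U -> C^o).
Proof. by move=> /funext ->. Qed.

Lemma circle_expzN (z : T) (n : nat) :
  (set_val z : C) ^ (Negz n) = ((set_val z : C) ^+ n.+1)^*.
Proof.
rewrite NegzE -exprnN -exprVn rmorphXn /=; congr (_ ^+ _).
have z0 : (set_val z : C) != 0.
  by have := circle_valP z; apply: contra_eq_neq => ->; rewrite mul0r eq_sym oner_eq0.
by apply: (mulfI z0); rewrite divff// circle_valP.
Qed.

Lemma circle_expz_cont (n : int) :
  continuous ((fun z : T => (set_val z : C) ^ n) : T -> C^o).
Proof.
have pos (m : nat) : continuous ((fun z : T => (set_val z : C) ^+ m) : T -> C^o).
  elim: m => [|m IH].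
    apply: (@contC_ext _ (fun=> 1)); last exact: cst_continuous.
    by move=> z; rewrite expr0.
  apply: (@contC_ext _ (fun z : T => (set_val z : C) * set_val z ^+ m)).
    by move=> z; rewrite exprS.
  exact: (@contC_mul _ _ (fun z : T => set_val z : C) _ circle_val_cont IH).
case: n => n; first exact: pos.
apply: (@contC_ext _ (fun z : T => ((set_val z : C) ^+ n.+1)^*)); last exact/contC_conj/pos.
by move=> z; rewrite circle_expzN.
Qed.

Lemma expi_cont : continuous (@expi R : R -> C^o).
Proof. by apply: contC_pair; [exact: continuous_cos|exact: continuous_sin]. Qed.

Lemma circle_exp_cont : continuous (@circle_exp R).
Proof.
apply: circle_cont; apply: (cont_comp expi_cont) => x.
by apply: cvgM; [exact: cvg_cst|exact: cvg_id].
Qed.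

Lemma circle_exp_surj (z : T) : exists2 x : R, x \in `[-1, 1] & circle_exp x = z.
Proof.
set a := complex.Re (set_val z : C); set b := complex.Im (set_val z : C).
have ab : a ^+ 2 + b ^+ 2 = 1.
  have := congr1 (@complex.Re R) (circle_valP z).
  by rewrite /a /b; case: (set_val z : C) => x y /=; rewrite mulrN opprK !expr2.
have a1 : -1 <= a <= 1.
  rewrite -ler_norml -(ler_sqr (x := `|a|)) ?nnegrE// real_normK ?num_real//.
  by rewrite expr1n -ab lerDl sqr_ge0.
have [/andP[c0 cpi] cK] := acos_def a1.
have pi0 := pi_gt0 R.
have sb : sin (acos a) ^+ 2 = b ^+ 2.
  by have := cos2Dsin2 (acos a); rewrite cK; move: ab; lra.
have s0 : 0 <= sin (acos a) by apply: sin_ge0_pi; rewrite c0.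
(* The angle is s times the arc cosine of the real part, the sign s being that of the imaginary
   part. *)
have key (s : R) : s = 1 \/ s = -1 -> sin (s * acos a) = b ->
    exists2 x : R, x \in `[-1, 1] & circle_exp x = z.
  move=> s1 sE; exists (s * acos a / (2 * pi)).
    have q0 : 0 <= acos a / (2 * pi) by rewrite divr_ge0// mulr_ge0// ltW.
    have q1 : acos a / (2 * pi) <= 1 by rewrite ler_pdivrMr ?mulr_gt0//; lra.
    by rewrite in_itv /= -mulrA; case: s1 => ->; apply/andP; split; lra.
  apply: circle_val_inj.
  change (expi (2 * pi * (s * acos a / (2 * pi))) = set_val z :> C).
  have fe (p x : R) : 0 < p -> 2 * p * (x / (2 * p)) = x.
    by move=> p0; field; rewrite gt_eqF.
  rewrite fe//.
  rewrite /expi sE (_ : cos (s * acos a) = a).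
    by rewrite /a /b; case: (set_val z : C).
  by case: s1 => ->; rewrite ?mul1r ?mulN1r ?cosN.
have [b0|b0] := leP 0 b.
  apply: (key 1); [by left|]; rewrite mul1r.
  by apply/eqP; rewrite -(eqrXn2 (n := 2))// sb.
apply: (key (-1)); [by right|]; rewrite mulN1r sinN.
have /eqP := sb; rewrite -[b ^+ 2]sqrrN eqrXn2// ?oppr_ge0 ?ltW//.
by move=> /eqP ->; rewrite opprK.
Qed.

Lemma circle_compact : compact [set: T].
Proof.
have -> : [set: T] = @circle_exp R @` `[-1, 1].
  apply/seteqP; split=> // z _; have [x hx <-] := circle_exp_surj z.
  by exists x.
apply: continuous_compact; last exact: segment_compact.
by apply: continuous_subspaceT; exact: circle_exp_cont.
Qed.

Lemma PiT_nbhs (m : PiT) : nbhs m [set m].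
Proof. exact: discrete_set1. Qed.

Lemma PiT_cont (U : topologicalType) (f : PiT -> U) : continuous f.
Proof.
move=> m A /nbhs_singleton Am.
suff : nbhs m (f @^-1` A) by [].
by apply: (@filterS _ (nbhs m) _ [set m]); [move=> n /= ->|exact: PiT_nbhs].
Qed.

Lemma PiT_cont2 (U : topologicalType) (f : PiT * PiT -> U) : continuous f.
Proof.
move=> [m n] A /nbhs_singleton Am.
exists ([set m], [set n]); first by split; exact: PiT_nbhs.
by move=> [m' n'] /= [-> ->].
Qed.

Local Notation G := (groupTPi R).

Lemma TPi_mul_cont : continuous (fun z : G * G => gd_mul z.1 z.2).
Proof.
apply: cont_pair.
  apply: (cont_comp2 circle_mul_cont).
    by apply: (cont_comp (@cont_fst T PiT)); exact: cont_fst.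
  by apply: (cont_comp (@cont_fst T PiT)); exact: cont_snd.
apply: (cont_comp2 (@PiT_cont2 PiT (fun z => (z.1 : int) + z.2))).
  by apply: (cont_comp (@cont_snd T PiT)); exact: cont_fst.
by apply: (cont_comp (@cont_snd T PiT)); exact: cont_snd.
Qed.

Lemma TPi_inv_cont : continuous (@gd_inv R G).
Proof.
apply: cont_pair.
  by apply: (cont_comp circle_inv_cont); exact: cont_fst.
by apply: (cont_comp (@PiT_cont PiT (fun z => - (z : int)))); exact: cont_snd.
Qed.

Lemma TPi_mulVK (h g : G) : gd_mul h (gd_mul (gd_inv h) g) = g.
Proof.
case: h g => [t m] [s n]; congr (_, _) => /=; first exact: circle_mulVK.
exact: addNKr.
Qed.

Lemma TPi_invK (g : G) : gd_inv (gd_inv g) = g.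
Proof. by case: g => [t m]; congr (_, _) => /=; [exact: circle_invK|exact: opprK]. Qed.

Lemma tauTPi_cont (kappa : int -> int -> int) :
  continuous ((fun z : G * G => tauTPi kappa z.1 z.2) : G * G -> C^o).
Proof.
apply/contCP => -[[t m] [s n]] e e0.
have := proj1 (contCP _) (@circle_expz_cont (kappa m 1)) s e e0 => hs.
exists ([set z : T * PiT | z.2 = m],
        [set z : T * PiT | cn ((set_val z.1 : C) ^ kappa m 1 - (set_val s : C) ^ kappa m 1) < e]).
  split=> /=.
    exists (setT, [set m]).
      by split; [exact: filterT|exact: PiT_nbhs].
    by move=> [a b] /= [_ ->].
  exists ([set z : T | cn ((set_val z : C) ^ kappa m 1 - (set_val s : C) ^ kappa m 1) < e], setT).
    by split => //; exact: filterT.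
  by move=> [a b] /= [].
by move=> [[t' m'] [s' n']] /= [-> h].
Qed.

Lemma tauTPi1 (kappa : int -> int -> int) (g h : G) : cn (tauTPi kappa g h) <= 1.
Proof.
have cnX (x : C) m : cn (x ^+ m) = cn x ^+ m.
  by elim: m => [|m IH]; rewrite ?expr0 ?cn1// !exprS cnM IH.
by rewrite /tauTPi /character; case: (kappa g.2 1) => n;
  rewrite ?circle_expzN ?cnJ -?exprnP cnX circle_cn expr1n.
Qed.

Lemma TPi_lc (g0 : G) : exists2 N, compact N & nbhs g0 N.
Proof.
exists ([set: T] `*` [set g0.2]).
  by apply: compact_setX; [exact: circle_compact|exact: compact_set1].
exists (setT, [set g0.2]); last by [].
by split; [exact: filterT|exact: PiT_nbhs].
Qed.

Let I (f : G -> R) (m : int) : R :=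
  (\int[lebesgue_measure]_(x in `[0%R, 1]) f (circle_exp x, m))%R.

Lemma TPi_haar0 : gd_haar (fun _ : G => 0) = 0.
Proof.
apply: fsbig1 => m _.
by rewrite Rintegral_cst ?mul0r//; exact: measurable_itv.
Qed.

Lemma circle_integrand_integrable (f : G -> R) (m : int) :
  continuous (f : G -> R^o) ->
  (@lebesgue_measure R).-integrable `[0%R, 1] (EFin \o (fun x => f (circle_exp x, m))).
Proof.
move=> fc; apply: continuous_compact_integrable; first exact: segment_compact.
apply: continuous_subspaceT.
apply: (@cont_comp _ _ _ f (fun x : R => ((circle_exp x, m) : G))) => //.
by apply: cont_pair; [exact: circle_exp_cont|exact: cst_continuous].
Qed.

Lemma circle_integral_dist (f f' : G -> R) (m : int) (e : R) :
  continuous (f : G -> R^o) -> continuous (f' : G -> R^o) ->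
  (forall g, `|f g - f' g| <= e) -> `|I f m - I f' m| <= e.
Proof.
move=> fc fc' ff'.
have i1 := @circle_integrand_integrable f m fc.
have i2 := @circle_integrand_integrable f' m fc'.
have mI : measurable (`[0%R, 1] : set R) by exact: measurable_itv.
rewrite /I -RintegralB//.
have i3 : (@lebesgue_measure R).-integrable `[0%R, 1]
    (EFin \o (fun x => f (circle_exp x, m) - f' (circle_exp x, m))).
  rewrite (_ : _ \o _ = ((EFin \o (fun x => f (circle_exp x, m))) \-
    (EFin \o (fun x => f' (circle_exp x, m))))%E); first exact: integrableB.
  by apply/funext => x /=; rewrite EFinB.
apply: (@le_trans _ _ (\int[lebesgue_measure]_(x in `[0%R, 1])
    `|f (circle_exp x, m) - f' (circle_exp x, m)|)%R); first exact: le_normr_Rintegral.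
apply: (@le_trans _ _ (\int[lebesgue_measure]_(x in `[0%R, 1]) e)%R).
  apply: le_Rintegral => //.
    by rewrite (_ : _ \o _ = abse \o (EFin \o (fun x => f (circle_exp x, m) - f' (circle_exp x, m))))//;
      exact: integrable_abse.
  apply: continuous_compact_integrable; first exact: segment_compact.
  exact: continuous_subspaceT (@cst_continuous _ _ _).
have E : lebesgue_measure (`[0%R, 1] : set R) = 1%E.
  by rewrite lebesgue_measure_itv /= lte_fin ltr01 oppr0 adde0.
have -> : (\int[lebesgue_measure]_(x in `[0%R, 1]) e)%R = e.
  rewrite Rintegral_cst; last exact: mI.
  by rewrite -[RHS]mulr1; congr (_ * _); exact: (congr1 fine E).
by [].
Qed.

(** A compact set meets finitely many components of T x Pi_T, each of mass 1; the constant counts a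
    finite set of components containing these. *)
Lemma TPi_haar_dist (K : set G) : compact K -> exists2 c : R, 0 <= c &
  forall (f f' : G -> R) (e : R), continuous (f : G -> R^o) ->
    continuous (f' : G -> R^o) ->
    (forall g, ~ K g -> f g = 0) -> (forall g, ~ K g -> f' g = 0) ->
    (forall g, `|f g - f' g| <= e) -> `|gd_haar f - gd_haar f'| <= c * e.
Proof.
move=> cK.
have [N hN] : exists N, forall g, K g -> (absz (g.2 : int) <= N)%N.
  have : \forall N \near \oo, forall g, K g -> (absz (g.2 : int) <= N)%N.
    apply: (compact_near _ cK) => g _.
    exists ([set g' : G | g'.2 = g.2], [set n | (absz (g.2 : int) <= n)%N]).
      split => /=; last exact: nbhs_infty_ge.
      exists (setT, [set g.2]); last by move=> [a b] /= [_ ->].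
      by split; [exact: filterT|exact: PiT_nbhs].
    by move=> [g' n] /= [-> h].
  by move=> /filter_ex[N hN]; exists N.
(* All integers of absolute value at most N; 0 occurs in both lists, hence [undup]. *)
pose J := undup ([seq n%:Z | n <- iota 0 N.+1] ++ [seq - n%:Z | n <- iota 0 N.+1]).
have JP (m : int) : m \notin J -> (N < absz m)%N.
  rewrite ltnNge; apply: contra => mN; rewrite mem_undup mem_cat.
  case: m mN => n nN; apply/orP; [left|right].
    by apply: map_f; rewrite mem_iota /= add0n ltnS.
  by rewrite NegzE; apply: (map_f (fun n : nat => - n%:Z)); rewrite mem_iota /= add0n ltnS.
have IE (f : G -> R) : (forall g, ~ K g -> f g = 0) -> gd_haar f = \sum_(m <- J) I f m.
  move=> f0; rewrite /gd_haar /= (fsbigE J) ?undup_uniq//.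
    by apply: eq_bigl => m; rewrite in_setT.
  move=> m _ /JP mN.
  rewrite -[RHS](mul0r (fine (lebesgue_measure (`[0%R, 1] : set R)))).
  rewrite -Rintegral_cst; last exact: measurable_itv.
  apply: eq_Rintegral => x _; apply: f0 => Kx.
  by have := hN _ Kx; rewrite /= leqNgt mN.
exists (size J)%:R => // f f' e fc fc' f0 f0' ff'.
rewrite !IE// -sumrB (le_trans (ler_norm_sum _ _ _))//.
rewrite (le_trans (ler_sum _ (fun m _ => @circle_integral_dist f f' m e fc fc' ff')))//.
by rewrite big_const_seq count_predT iter_addr_0 mulr_natl.
Qed.

End CircleGroup.

(** * The loops of T x Pi_T in the smooth topology *)

Section Loops.
Variable R : realType.
Local Notation C := R[i].
Local Notation G := (groupTPi R).

(** The real and imaginary parts of the loops of T x Pi_T have this form. The family is stable under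
    derivation at fixed w, so C^k estimates reduce to estimates of the coefficients. *)
Definition trig (a b w : R) : R -> R := fun x => a * cos (w * x) + b * sin (w * x).

Lemma trig_derive (a b w x : R) :
  is_derive x 1 (trig a b w : R -> R^o) (trig (w * b) (- (w * a)) w x).
Proof.
have hw : is_derive x 1 (fun x : R => w * x : R^o) w.
  have h : is_derive (x : R^o) 1 (w \*: (@id R^o)) (w *: (1 : R^o)) by exact: is_deriveZ.
  by rewrite [w *: 1]mulr1 in h.
have hc := @is_derive1_comp R (@cos R) (fun x => w * x) x _ _ (is_derive_cos _) hw.
have hs := @is_derive1_comp R (@sin R) (fun x => w * x) x _ _ (is_derive_sin _) hw.
have h := is_deriveD (is_deriveZ a hc) (is_deriveZ b hs).
have -> : trig (w * b) (- (w * a)) w x =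
    a *: ((- sin (w * x) : R^o) * w) + b *: ((cos (w * x) : R^o) * w).
  by rewrite /trig /GRing.scale /=; ring.
exact: h.
Qed.

Lemma trig_derive1 (a b w : R) : derive1 (trig a b w : R -> R^o) = trig (w * b) (- (w * a)) w.
Proof. by apply/funext => x; rewrite derive1E; have [_ ->] := trig_derive a b w x. Qed.

Lemma trig_derivable (a b w x : R) : derivable (trig a b w : R -> R^o) x 1.
Proof. by have [h _] := trig_derive a b w x. Qed.

Lemma trig_derive1n (k : nat) (a b w : R) : exists a' b' : R,
  derive1n k (trig a b w : R -> R^o) = trig a' b' w.
Proof.
elim: k => [|k [a' [b' IH]]]; first by exists a, b.
by rewrite derive1nS IH trig_derive1; eexists; eexists.
Qed.

Lemma trig_smooth (a b w : R) : smooth1 (trig a b w).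
Proof.
move=> k x; have [a' [b' ->]] := trig_derive1n k a b w; exact: trig_derivable.
Qed.

Lemma trig_derive1n_dist (k : nat) (a b a' b' w x : R) :
  `|derive1n k (trig a b w : R -> R^o) x - derive1n k (trig a' b' w : R -> R^o) x| <=
  `|w| ^+ k * (`|a - a'| + `|b - b'|).
Proof.
elim: k a b a' b' => [|k IH] a b a' b'.
  rewrite expr0 mul1r /= /trig.
  rewrite (_ : _ - _ = (a - a') * cos (w * x) + (b - b') * sin (w * x)); last by ring.
  rewrite (le_trans (ler_normD _ _))// !normrM lerD// ler_piMr//.
    by rewrite ler_norml cos_geN1 cos_le1.
  by rewrite ler_norml sin_geN1 sin_le1.
have E c d : derive1n k.+1 (trig c d w : R -> R^o) = derive1n k (trig (w * d) (- (w * c)) w : R -> R^o).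
  by rewrite /derive1n iterSr trig_derive1.
rewrite !E (le_trans (IH _ _ _ _))// exprSr -mulrA ler_wpM2l ?exprn_ge0//.
by rewrite -opprD normrN -!mulrBr !normrM -mulrDr addrC.
Qed.

Definition TPi_loop (z : TPi R) : R -> C :=
  loop_mul (cst_loop z.1) (winding_loop z.2).

Lemma expi_conj (x : R) : expi x * (expi x)^* = 1 :> C.
Proof.
apply/eqP; rewrite eq_complex /= mulrN opprK -!expr2.
by rewrite cos2Dsin2 eqxx mulrN mulrC addNr /= eqxx.
Qed.

Lemma TPi_loop_unit (z : TPi R) (x : R) : TPi_loop z x * (TPi_loop z x)^* = 1.
Proof. by rewrite rmorphM mulrACA circle_valP expi_conj mulr1. Qed.

Lemma TPi_loop_inv (z : TPi R) (x : R) : TPi_loop (@gd_inv R G z) x = (TPi_loop z x)^*.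
Proof.
rewrite rmorphM; congr (_ * _).
change (expi ((- (z.2 : int))%:~R * x) = (expi ((z.2 : int)%:~R * x))^* :> C).
by rewrite /expi mulrNz mulNr cosN sinN.
Qed.

Lemma TPi_loop_Re (z : TPi R) : (fun x => complex.Re (TPi_loop z x)) =
  trig (complex.Re (set_val z.1 : C)) (- complex.Im (set_val z.1 : C)) (z.2 : int)%:~R.
Proof.
by apply/funext => x; rewrite /TPi_loop /loop_mul /cst_loop; case: (set_val z.1 : C) => a b;
  rewrite /trig /= mulNr.
Qed.

Lemma TPi_loop_Im (z : TPi R) : (fun x => complex.Im (TPi_loop z x)) =
  trig (complex.Im (set_val z.1 : C)) (complex.Re (set_val z.1 : C)) (z.2 : int)%:~R.
Proof.
by apply/funext => x; rewrite /TPi_loop /loop_mul /cst_loop; case: (set_val z.1 : C) => a b;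
  rewrite /trig /= addrC.
Qed.

Lemma trig_periodic (a b : R) (n : int) (x : R) :
  trig a b n%:~R (x + 2 * pi) = trig a b n%:~R x.
Proof.
have E : n%:~R * (x + 2 * pi) = n%:~R * x + (pi *+ 2) *~ n.
  by rewrite mulrDr [2 * pi]mulr_natl [_ * (pi *+ 2)]mulrzl.
rewrite /trig E; case: n {E} => n.
  by rewrite -pmulrn (periodicn (@cosD2pi R)) (periodicn (@sinD2pi R)).
rewrite NegzE mulrNz -pmulrn.
by rewrite -[in RHS](subrK ((pi *+ 2) *+ n.+1) (_ * x)) (periodicn (@cosD2pi R)) (periodicn (@sinD2pi R)).
Qed.

Lemma TPi_loop_is_loop (z : TPi R) : is_loop (TPi_loop z).
Proof.
have hr := TPi_loop_Re z; have hi := TPi_loop_Im z.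
split; [|exact: TPi_loop_unit|rewrite hr; exact: trig_smooth|rewrite hi; exact: trig_smooth].
move=> x; apply/eqP; rewrite eq_complex.
move: (congr1 (fun f => f (x + 2 * pi) = f x) hr) (congr1 (fun f => f (x + 2 * pi) = f x) hi).
by rewrite !trig_periodic => hr' hi'; apply/andP; split; apply/eqP; [rewrite hr'|rewrite hi'].
Qed.

(** The base 1 + |w|, unlike |w|, is at least 1, so its k-th power dominates the factors |w|^m for
    all m <= k. *)
Lemma trig_close (k : nat) (a b a' b' w d : R) (m : nat) (x : R) : (m <= k)%N ->
  `|a - a'| + `|b - b'| < d / (1 + `|w|) ^+ k ->
  `|derive1n m (trig a b w : R -> R^o) x - derive1n m (trig a' b' w : R -> R^o) x| < d.
Proof.
move=> mk; have w1 : 1 <= 1 + `|w| by rewrite lerDl.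
have wk : 0 < (1 + `|w|) ^+ k by rewrite exprn_gt0// (lt_le_trans ltr01).
rewrite ltr_pdivlMr// => h; apply: le_lt_trans h.
rewrite (le_trans (trig_derive1n_dist _ _ _ _ _ _ _))// mulrC ler_wpM2l ?addr_ge0//.
by rewrite (le_trans _ (ler_weXn2l w1 mk))// lerXn2r ?nnegrE ?addr_ge0 ?lerDr.
Qed.

Lemma TPi_loop_close (z0 : TPi R) (k : nat) (e : R) : 0 < e ->
  \forall z \near z0, loop_close k e (TPi_loop z) (TPi_loop z0).
Proof.
move=> e0; pose w : R := (z0.2 : int)%:~R.
have wk : 0 < (1 + `|w|) ^+ k by rewrite exprn_gt0// ltr_pwDl.
have d0 : 0 < e / (1 + `|w|) ^+ k / 2 by rewrite !divr_gt0.
have /contCP/(_ z0.1 _ d0) h1 := @circle_val_cont R.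
(* The winding number is locally constant, so near z0 only the coefficients vary and the frequency
   is fixed. *)
exists ([set c | cn ((set_val c : C) - set_val z0.1) < e / (1 + `|w|) ^+ k / 2], [set z0.2]).
  by split => //; exact: PiT_nbhs.
move=> [c n] [/= hc nE] m x mk; rewrite !TPi_loop_Re !TPi_loop_Im /= nE.
have hr : `|complex.Re (set_val c : C) - complex.Re (set_val z0.1 : C)| < e / (1 + `|w|) ^+ k / 2.
  by rewrite (le_lt_trans _ hc)// -raddfB cn_ge_Re.
have hi : `|complex.Im (set_val c : C) - complex.Im (set_val z0.1 : C)| < e / (1 + `|w|) ^+ k / 2.
  by rewrite (le_lt_trans _ hc)// -raddfB cn_ge_Im.
split; apply: (trig_close _ mk); rewrite [ltRHS]splitr ltrD//.
by rewrite -opprD normrN.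
Qed.

End Loops.

(** * Continuity of the induced action on the locally compact model *)

Section TildeAction.
Variables (R : realType) (M : properLTspace R).
Local Notation G := (groupTPi R).
Local Notation X := (pl_tilde M).
Local Notation act := (@pl_tilde_act R M).

(** The global section lifts the action to the manifold, where continuity is part of the data. *)
Lemma tilde_actE (g : G) (y : X) :
  act g y = pl_p (pl_act (TPi_loop g) (pl_section y)).
Proof. by rewrite -[in LHS](pl_sectionK y) pl_tilde_actE. Qed.

Lemma tilde_actVK (g : G) (y : X) : act g (act (gd_inv g) y) = y.
Proof.
rewrite [act (gd_inv g) y]tilde_actE pl_tilde_actE -pl_actM; try exact: TPi_loop_is_loop.
rewrite (_ : loop_mul _ _ = fun=> 1) ?pl_act1 ?pl_sectionK//.
by apply/funext => x; rewrite /loop_mul TPi_loop_inv TPi_loop_unit.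
Qed.

Lemma tilde_p_cont : continuous (@pl_p R M).
Proof. by apply/continuousP => O; have [_ _ h] := pl_p_orbit M; move/h. Qed.

Lemma tilde_act_cont : continuous (fun z : G * X => act z.1 z.2).
Proof.
move=> [g0 y0] V /=; rewrite tilde_actE => nV.
have [k [e [e0 h]]] := pl_act_cont (TPi_loop_is_loop g0) (tilde_p_cont nV).
have h' := @pl_section_cont _ M y0 _ h.
exists ([set g | loop_close k e (TPi_loop g) (TPi_loop g0)],
  [set y | forall h, is_loop h -> loop_close k e h (TPi_loop g0) ->
     V (pl_p (pl_act h (pl_section y)))]).
  by split; [exact: TPi_loop_close|exact: h'].
move=> [g y] [/= hg hy]; rewrite /= tilde_actE; apply: hy => //; exact: TPi_loop_is_loop.
Qed.

End TildeAction.

(** U_0 is a point of mass 1, so the constant function 1 is a unit vector already at level 0. *)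
Lemma l2_unit_vector (R : realType) (W : L2tower R) : exists e : l2_lim W, nrm e = 1.
Proof.
have U (x : 'M[R]_(0, 2)) : x = 0 by apply/matrixP => -[].
have rapid1 : rapid (fun _ : 'M[R]_(0, 2) => 1 : R[i]).
  split; first exact: cst_continuous.
  move=> k; exists ((1 + `|0 : 'M[R]_(0, 2)|) ^+ k * nrm (1 : R[i]^o)) => x.
  by rewrite (U x).
exists (l2_inc W 0%N (l2_cls W (fun=> 1))).
have [_ h _] := @l2_L2 R W 0%N.
apply/eqP; rewrite -(eqrXn2 (n := 2))// ?nrm_ge0//; apply/eqP; apply: complexI.
rewrite !rmorphXn /= expr1n -nrmE -ip_norm l2_inc_ip h//.
by rewrite /haarC /= mulr1 mul0r oppr0 mulr0 !addr0 mul0r addr0.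
Qed.

Lemma TPi_crossed_product_rep_normed (R : realType) (kappa : int -> int -> int)
    (M : properLTspace R) (A : cstarAlg R) (jA : (TPi R -> pl_tilde M -> R[i]) -> A) :
  is_TPi_crossed_product kappa (@pl_tilde_act R M) jA -> rep_normed A.
Proof.
move=> hA; apply: (crossed_product_rep_normed hA).
- by move=> a F1 F2; exact: Cc_linear.
- by move=> F1 F2; apply: Cc_cp_mul; [exact: TPi_mul_cont|exact: TPi_inv_cont|
    exact: tilde_act_cont|exact: tauTPi_cont|exact: tauTPi1|exact: TPi_mulVK|
    exact: TPi_haar0|exact: TPi_haar_dist].
- move=> F hF; apply: Cc_cp_star hF; [exact: TPi_inv_cont|exact: tilde_act_cont|
    exact: tauTPi_cont|exact: tauTPi1|exact: TPi_invK|exact: tilde_actVK|exact: TPi_lc].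
Qed.

Theorem proposition1p10 (R : realType)
  (* kappa^tau : Pi_T -> Hom(Pi_T, Z), with positive definite form on t *)
  (kappa : int -> int -> int)
  (kappaDl : forall m n p, kappa (m + n) p = kappa m p + kappa n p)
  (kappaDr : forall m n p, kappa m (n + p) = kappa m n + kappa m p)
  (kappa_pos : forall v : R, v != 0 -> 0 < tau_form kappa v v)
  (M : properLTspace R)
  (tilde_lc : locally_compact [set: pl_tilde M])
  (* A = (T x Pi_T) |x_tau C_0(M~) *)
  (A : cstarAlg R) (jA : (TPi R -> pl_tilde M -> R[i]) -> A)
  (hA : is_TPi_crossed_product kappa (@pl_tilde_act R M) jA)
  (W : L2tower R)
  (* K = K(L^2(Omega T_0)) *)
  (K : cstarAlg R) (r : K -> l2_lim W -> l2_lim W)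
  (hK : is_compact_algebra r)
  (* D = A (x) K *)
  (D : cstarAlg R) (t : A -> K -> D)
  (hD : is_cstar_tensor t)
  (* L = LT |x_tau C_0(M) *)
  (L : LTcrossedProduct kappa (@pl_tilde_act R M) jA W) :
  star_isomorphic L D /\ morita_equivalent L A.
Proof.
have LD := LTcrossedProduct_stable L hK hD; split=> //.
have [F [G [FK GK]]] := LD.
have [e e1] := l2_unit_vector W.
have [th thE] := theta_exists hK.
exact: (stable_morita_equivalent (TPi_crossed_product_rep_normed hA) hK hD e1 FK GK thE).
Qed.
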